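(* Let $q\in\mathbb{C}$ be nonzero and not a root of unity. (i) Let $L\in\mathcal{N}$. Then there exist $b\in\mathbb{C}^*$, $z\in\mathbb{C}^*$ and $\lambda\in\mathbb{C}^*$ with $\lambda^2=q^{2d-3}$ for some $d\in\mathbb{N}$, such that $L\cong B_b^{(Y)}(N(\lambda,z))$. In particular, $L$ has a basis $\{v_{k,l}\mid k,l\in\mathbb{Z},\ 0\le l\le d-1\}$ on which the $\mathcal{S}_q$-action is given by \begin{align*} K.v_{k,l}&=\lambda b^{-1}q^{-k-2l}v_{k,l},\qquad C.v_{k,l}=z v_{k,l},\qquad Y.v_{k,l}=v_{k+1,l},\\ F.v_{k,l}&=\begin{cases}v_{k,l+1}, & l<d-1,\\ -\sum_{i=0}^{d-1}\Big(\frac{-q^{d-1}}{\lambda z(q+1)}\Big)^{d-i}\binom{d}{i}_q v_{k+2d-2i,i}, & l=d-1,\end{cases}\\ X.v_{k,l}&=-z\frac{bq^k-1}{q-1}v_{k-1,l}-\lambda^{-1}bq^{k+l-1}[l]_q v_{k+1,l-1},\\ E.v_{k,l}&=\frac{\lambda b^{-1}q^{1-k-l}-\lambda^{-1}bq^{k+l-1}}{q-q^{-1}}[l]_q v_{k,l-1}-\frac{q+q^2-b^{-1}q^{2-k}-bq^{k+1}}{(1-q^2)(q-1)}z v_{k-2,l}. \end{align*} (ii) Let $b,b',z,z'\in\mathbb{C}^*$ and let $\lambda,\lambda'\in\mathbb{C}^*$ with $\lambda^2,\lambda'^2\in q^{-3+2\mathbb{N}}$. Then $B_b^{(Y)}(N(\lambda,z))\cong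 B_{b'}^{(Y)}(N(\lambda',z'))$ if and only if $\lambda=\lambda'$, $z=z'$ and $b^{-1}b'\in q^{\mathbb{Z}}$.
   Context: Notation: $\mathbb{N}=\{1,2,\dots\}$, $\mathbb{Z}_+=\{0,1,2,\dots\}$, $\mathbb{C}^*=\mathbb{C}\setminus\{0\}$, $[n]_q=\frac{q^n-q^{-n}}{q-q^{-1}}$, $\binom{n}{i}_q=\frac{[n]_q[n-1]_q\cdots[n-i+1]_q}{[i]_q[i-1]_q\cdots[1]_q}$, $q^{-3+2\mathbb{N}}=\{q^{2d-3}\mid d\in\mathbb{N}\}$. $\mathcal{S}_q$ is the associative unital $\mathbb{C}$-algebra generated by $C,E,F,K,K^{-1},X,Y$ (with $KK^{-1}=K^{-1}K=1$) subject to: $KEK^{-1}=q^2E$, $KFK^{-1}=q^{-2}F$, $[E,F]=\frac{K-K^{-1}}{q-q^{-1}}$, $KXK^{-1}=qX$, $KYK^{-1}=q^{-1}Y$, $qYX-XY=C$, $EX=qXE$, $EY=X+q^{-1}YE$, $FX=YK^{-1}+XF$, $FY=YF$, and $C$ is central. A weight module is an $\mathcal{S}_q$-module $V=\bigoplus_{\mu\in\mathbb{C}^*}V_\mu$ with $V_\mu=\{v\mid Kv=\mu v\}$. A highest (resp. lowest) weight module is a weight module generated by a nonzero weight vector killed by $E$ and $X$ (resp. by $F$ and $Y$). $\mathcal{N}$ is the class of simple weight $\mathcal{S}_q$-modules with all weight spaces finite-dimensional, on which at least one of $X,Y$ acts nonzero, and which are neither highest weight nor lowest weight modules. $N(\lambda,z)$: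 for $z\in\mathbb{C}^*$ and $\lambda^2=q^{2d-3}$, $d\in\mathbb{N}$, the Verma module $M(\lambda,z)$ is the universal highest weight module generated by $v_{0,0}$ with $Ev_{0,0}=Xv_{0,0}=0$, $Kv_{0,0}=\lambda v_{0,0}$, $Cv_{0,0}=zv_{0,0}$ (it has basis $Y^kF^lv_{0,0}$, $k,l\in\mathbb{Z}_+$), and $N(\lambda,z)$ is its unique simple quotient. It has basis $\{v_{k,l}=Y^kF^lv_{0,0}\mid k,l\in\mathbb{Z}_+,\ l\le d-1\}$ with the action given by $K.v_{k,l}=\lambda q^{-k-2l}v_{k,l}$, $C.v_{k,l}=zv_{k,l}$, $Y.v_{k,l}=v_{k+1,l}$; $F.v_{k,l}=v_{k,l+1}$ for $l<d-1$ and $F.v_{k,d-1}=-\sum_{i=0}^{d-1}\big(\frac{-q^{d-1}}{\lambda z(q+1)}\big)^{d-i}\binom{d}{i}_qv_{k+2d-2i,i}$; $X.v_{k,l}=-z\frac{q^k-1}{q-1}v_{k-1,l}-\lambda^{-1}q^{k+l-1}[l]_qv_{k+1,l-1}$; $E.v_{k,l}=\frac{\lambda q^{1-k-l}-\lambda^{-1}q^{k+l-1}}{q-q^{-1}}[l]_qv_{k,l-1}-\frac{q+q^2-q^{2-k}-q^{k+1}}{(1-q^2)(q-1)}zv_{k-2,l}$. Twisting functor $B_b^{(Y)}$: $\mathcal{S}_q^{(Y)}$ is the Ore localization of $\mathcal{S}_q$ at $\{Y^i\mid i\in\mathbb{Z}_+\}$. For $b\in\mathbb{C}^*$, $\Theta_b^{(Y)}$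 is the algebra automorphism of $\mathcal{S}_q^{(Y)}$ with $Y^{\pm1}\mapsto Y^{\pm1}$, $F\mapsto F$, $C\mapsto C$, $K^i\mapsto b^{-i}K^i$, $X\mapsto bX-\frac{b-1}{q-1}CY^{-1}$, $E\mapsto b^{-1}E+\frac{b-b^{-1}}{q-q^{-1}}Y^{-1}X-\frac{b+qb^{-1}-q-1}{(q-q^{-1})(q-1)}CY^{-2}$. For an $\mathcal{S}_q$-module $V$, $B_b^{(Y)}(V)$ is the $\mathcal{S}_q$-module obtained from $\mathcal{S}_q^{(Y)}\otimes_{\mathcal{S}_q}V$ by letting $a$ act as $\Theta_b^{(Y)}(a)$ and then restricting to $\mathcal{S}_q$. *)

(* Defs.v *)
From HB Require Import structures.
From mathcomp Require Import all_boot all_order all_algebra.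
From mathcomp Require Import boolp.
From mathcomp Require Import ring.

Set Implicit Arguments.
Unset Strict Implicit.
Unset Printing Implicit Defensive.

Import GRing.Theory.
Local Open Scope ring_scope.
Local Open Scope quotient_scope.

(* A-rings presented by generators and relations.  [pterm A G] are formal     *)
(* noncommutative polynomial expressions over [A] in the generators [G], and  *)
(* [pcong rels] is the least ring congruence containing [rels].  The elements   *)
(* of [A] are NOT made central: when [A] is a field of scalars the centrality *)
(* has to be part of [rels].                                                   *)

Inductive pterm (A G : Type) : Type :=
| PIn of A
| PGen of G
| PAdd of pterm A G & pterm A G
| PMul of pterm A G & pterm A G.

Arguments PIn {A G}.
Arguments PGen {A G}.

Declare Scope pterm_scope.
Delimit Scope pterm_scope with P.
Bind Scope pterm_scope with pterm.
Notation "s + t" := (PAdd s t) : pterm_scope.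
Notation "s * t" := (PMul s t) : pterm_scope.

Section Presented.
Variables (A : pzRingType) (G : Type) (rels : pterm A G -> pterm A G -> Prop).

Inductive pcong : pterm A G -> pterm A G -> Prop :=
| pcong_rel s t : rels s t -> pcong s t
| pcong_refl s : pcong s s
| pcong_sym s t : pcong s t -> pcong t s
| pcong_trans s t u : pcong s t -> pcong t u -> pcong s u
| pcong_add s s' t t' : pcong s s' -> pcong t t' -> pcong (s + t) (s' + t')
| pcong_mul s s' t t' : pcong s s' -> pcong t t' -> pcong (s * t) (s' * t')
| pcong_addA s t u : pcong (s + (t + u)) (s + t + u)
| pcong_addC s t : pcong (s + t) (t + s)
| pcong_add0 s : pcong (PIn 0%R + s) s
| pcong_addN s : pcong (PIn (-1)%R * s + s) (PIn 0%R)
| pcong_mulA s t u : pcong (s * (t * u)) (s * t * u)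
| pcong_mul1l s : pcong (PIn 1%R * s) s
| pcong_mul1r s : pcong (s * PIn 1%R) s
| pcong_mulDl s t u : pcong ((s + t) * u) (s * u + t * u)
| pcong_mulDr s t u : pcong (s * (t + u)) (s * t + s * u)
| pcong_inD a b : pcong (PIn (a + b)%R) (PIn a + PIn b)
| pcong_inM a b : pcong (PIn (a * b)%R) (PIn a * PIn b).

HB.instance Definition _ := gen_eqMixin (pterm A G).
HB.instance Definition _ := gen_choiceMixin (pterm A G).

Definition pcongb : rel (pterm A G) := fun s t => `[< pcong s t >].

Lemma pcongb_refl : reflexive pcongb.
Proof. by move=> s; apply/asboolP; apply: pcong_refl. Qed.

Lemma pcongb_sym : symmetric pcongb.
Proof. by move=> s t; apply: asbool_equiv_eq; split; apply: pcong_sym. Qed.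

Lemma pcongb_trans : transitive pcongb.
Proof.
by move=> t s u /asboolP st /asboolP tu; apply/asboolP; apply: pcong_trans st tu.
Qed.

Definition pcong_equiv := EquivRel pcongb pcongb_refl pcongb_sym pcongb_trans.

Definition pres : Type := {eq_quot pcong_equiv}.
HB.instance Definition _ := Choice.on pres.
HB.instance Definition _ := EqQuotient.on pres.

Lemma pres_eq s t : pcong s t <-> \pi_pres s = \pi_pres t.
Proof.
split=> [st|/eqmodP /asboolP //].
by apply/eqmodP; apply/asboolP.
Qed.

Lemma pres_ind (P : pres -> Prop) : (forall t, P (\pi_pres t)) -> forall x, P x.
Proof. by move=> Pt x; rewrite -[x]reprK; apply: Pt. Qed.

Let padd (x y : pres) : pres := \pi_pres (repr x + repr y)%P.
Let pmul (x y : pres) : pres := \pi_pres (repr x * repr y)%P.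
Let popp (x : pres) : pres := \pi_pres (PIn (-1) * repr x)%P.

Lemma pcong_repr t : pcong (repr (\pi_pres t)) t.
Proof. by apply/pres_eq; rewrite reprK. Qed.

Let paddE s t : padd (\pi_pres s) (\pi_pres t) = \pi_pres (s + t)%P.
Proof. by apply/pres_eq; apply: pcong_add; apply: pcong_repr. Qed.

Let pmulE s t : pmul (\pi_pres s) (\pi_pres t) = \pi_pres (s * t)%P.
Proof. by apply/pres_eq; apply: pcong_mul; apply: pcong_repr. Qed.

Let poppE s : popp (\pi_pres s) = \pi_pres (PIn (-1) * s)%P.
Proof.
by apply/pres_eq; apply: pcong_mul; [apply: pcong_refl|apply: pcong_repr].
Qed.

Fact pres_addA : associative padd.
Proof.
elim/pres_ind=> s; elim/pres_ind=> t; elim/pres_ind=> u.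
by rewrite !paddE; apply/pres_eq/pcong_addA.
Qed.

Fact pres_addC : commutative padd.
Proof.
elim/pres_ind=> s; elim/pres_ind=> t.
by rewrite !paddE; apply/pres_eq/pcong_addC.
Qed.

Fact pres_add0 : left_id (\pi_pres (PIn 0)) padd.
Proof. by elim/pres_ind=> s; rewrite paddE; apply/pres_eq/pcong_add0. Qed.

Fact pres_addN : left_inverse (\pi_pres (PIn 0)) popp padd.
Proof.
by elim/pres_ind=> s; rewrite poppE paddE; apply/pres_eq/pcong_addN.
Qed.

HB.instance Definition _ :=
  GRing.isZmodule.Build pres pres_addA pres_addC pres_add0 pres_addN.

Fact pres_mulA : associative pmul.
Proof.
elim/pres_ind=> s; elim/pres_ind=> t; elim/pres_ind=> u.
by rewrite !pmulE; apply/pres_eq/pcong_mulA.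
Qed.

Fact pres_mul1l : left_id (\pi_pres (PIn 1)) pmul.
Proof. by elim/pres_ind=> s; rewrite pmulE; apply/pres_eq/pcong_mul1l. Qed.

Fact pres_mul1r : right_id (\pi_pres (PIn 1)) pmul.
Proof. by elim/pres_ind=> s; rewrite pmulE; apply/pres_eq/pcong_mul1r. Qed.

Fact pres_mulDl : left_distributive pmul +%R.
Proof.
elim/pres_ind=> s; elim/pres_ind=> t; elim/pres_ind=> u.
change (pmul (padd (\pi_pres s) (\pi_pres t)) (\pi_pres u) =
        padd (pmul (\pi_pres s) (\pi_pres u)) (pmul (\pi_pres t) (\pi_pres u))).
by rewrite !(paddE, pmulE); apply/pres_eq/pcong_mulDl.
Qed.

Fact pres_mulDr : right_distributive pmul +%R.
Proof.
elim/pres_ind=> s; elim/pres_ind=> t; elim/pres_ind=> u.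
change (pmul (\pi_pres s) (padd (\pi_pres t) (\pi_pres u)) =
        padd (pmul (\pi_pres s) (\pi_pres t)) (pmul (\pi_pres s) (\pi_pres u))).
by rewrite !(paddE, pmulE); apply/pres_eq/pcong_mulDr.
Qed.

HB.instance Definition _ := GRing.Zmodule_isPzRing.Build pres
  pres_mulA pres_mul1l pres_mul1r pres_mulDl pres_mulDr.

Lemma pres_piD s t : \pi_pres (s + t)%P = \pi_pres s + \pi_pres t :> pres.
Proof. by rewrite -paddE. Qed.

Lemma pres_piM s t : \pi_pres (s * t)%P = \pi_pres s * \pi_pres t :> pres.
Proof. by rewrite -pmulE. Qed.

Definition pin (a : A) : pres := \pi_pres (PIn a).
Definition pgen (g : G) : pres := \pi_pres (PGen g).

Fact pin_nmod_morphism : nmod_morphism pin.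
Proof.
by split=> // a b; rewrite /pin -pres_piD; apply/pres_eq/pcong_inD.
Qed.
HB.instance Definition _ :=
  GRing.isNmodMorphism.Build A pres pin pin_nmod_morphism.

Fact pin_monoid_morphism : monoid_morphism pin.
Proof.
by split=> // a b; rewrite /pin -pres_piM; apply/pres_eq/pcong_inM.
Qed.
HB.instance Definition _ :=
  GRing.isMonoidMorphism.Build A pres pin pin_monoid_morphism.

End Presented.

Section Lift.
Variables (A : pzRingType) (G : Type) (rels : pterm A G -> pterm A G -> Prop).
Variables (B : pzRingType) (phi : {rmorphism A -> B}) (f : G -> B).

Fixpoint peval (t : pterm A G) : B :=
  match t with
  | PIn a => phi a
  | PGen g => f g
  | PAdd s t => peval s + peval t
  | PMul s t => peval s * peval t
  end.

Hypothesis hrel : forall s t, rels s t -> peval s = peval t.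

Lemma peval_cong s t : pcong rels s t -> peval s = peval t.
Proof.
elim=> {s t} /=.
- exact: hrel.
- by [].
- by [].
- by move=> s t u _ -> _ ->.
- by move=> s s' t t' _ -> _ ->.
- by move=> s s' t t' _ -> _ ->.
- by move=> s t u; rewrite addrA.
- by move=> s t; rewrite addrC.
- by move=> s; rewrite rmorph0 add0r.
- by move=> s; rewrite rmorphN1 rmorph0 mulN1r addNr.
- by move=> s t u; rewrite mulrA.
- by move=> s; rewrite rmorph1 mul1r.
- by move=> s; rewrite rmorph1 mulr1.
- by move=> s t u; rewrite mulrDl.
- by move=> s t u; rewrite mulrDr.
- by move=> a b; rewrite rmorphD.
- by move=> a b; rewrite rmorphM.
Qed.

Definition plift (h : forall s t, rels s t -> peval s = peval t) (x : pres rels)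
  : B := peval (repr x).

Lemma plift_pi t : plift hrel (\pi_(pres rels) t) = peval t.
Proof. exact/peval_cong/pcong_repr. Qed.

Fact plift_nmod_morphism : nmod_morphism (plift hrel).
Proof.
split; first by rewrite -[0]/(\pi_(pres rels) (PIn 0)) plift_pi /= rmorph0.
elim/pres_ind=> s; elim/pres_ind=> t.
by rewrite -pres_piD !plift_pi.
Qed.
HB.instance Definition _ :=
  GRing.isNmodMorphism.Build (pres rels) B (plift hrel) plift_nmod_morphism.

Fact plift_monoid_morphism : monoid_morphism (plift hrel).
Proof.
split; first by rewrite -[1]/(\pi_(pres rels) (PIn 1)) plift_pi /= rmorph1.
elim/pres_ind=> s; elim/pres_ind=> t.
by rewrite -pres_piM !plift_pi.
Qed.
HB.instance Definition _ :=
  GRing.isMonoidMorphism.Build (pres rels) B (plift hrel) plift_monoid_morphism.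

Lemma plift_in a : plift hrel (pin rels a) = phi a.
Proof. exact: plift_pi. Qed.

Lemma plift_gen g : plift hrel (pgen rels g) = f g.
Proof. exact: plift_pi. Qed.

End Lift.

(* The localization of [A] at the powers of [y], given by its universal       *)
(* property: a two-sided inverse of [y] is freely adjoined to [A].  When the  *)
(* powers of [y] form an Ore set this is the Ore localization.                *)

Inductive loc_rel (A : pzRingType) (y : A) :
  pterm A unit -> pterm A unit -> Prop :=
| loc_rel_r : loc_rel y (PIn y * PGen tt)%P (PIn 1)
| loc_rel_l : loc_rel y (PGen tt * PIn y)%P (PIn 1).

Definition loc (A : pzRingType) (y : A) : pzRingType := pres (loc_rel y).

Definition loc_in (A : pzRingType) (y : A) : {rmorphism A -> loc y} :=
  pin (loc_rel y).

Definition loc_inv (A : pzRingType) (y : A) : loc y := pgen (loc_rel y) tt.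

Lemma loc_mulV (A : pzRingType) (y : A) : loc_in y y * loc_inv y = 1.
Proof. by rewrite -pres_piM; apply/pres_eq/pcong_rel/loc_rel_r. Qed.

Lemma loc_mulVl (A : pzRingType) (y : A) : loc_inv y * loc_in y y = 1.
Proof. by rewrite -pres_piM; apply/pres_eq/pcong_rel/loc_rel_l. Qed.

Definition restr (A B : pzRingType) (f : {rmorphism A -> B}) (V : lmodType B)
  : Type := V.

Section Restriction.
Variables (A B : pzRingType) (f : {rmorphism A -> B}) (V : lmodType B).

Local Notation restr := (restr f V).

HB.instance Definition _ := GRing.Zmodule.copy restr V.

Let rscale (a : A) (v : restr) : restr := (f a *: (v : V)).

Fact restr_scaleA a b v : rscale a (rscale b v) = rscale (a * b) v.
Proof. by rewrite /rscale scalerA rmorphM. Qed.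
Fact restr_scale1 : left_id 1 rscale.
Proof. by move=> v; rewrite /rscale rmorph1 scale1r. Qed.
Fact restr_scaleDr : right_distributive rscale +%R.
Proof. by move=> a u v; rewrite /rscale scalerDr. Qed.
Fact restr_scaleDl v : {morph rscale^~ v : a b / a + b}.
Proof. by move=> a b; rewrite /rscale rmorphD scalerDl. Qed.

HB.instance Definition _ := GRing.Zmodule_isLmodule.Build A restr
  restr_scaleA restr_scale1 restr_scaleDr restr_scaleDl.

End Restriction.

(* The tensor product over [S] of [A], a right [S]-module through [f], with a *)
(* left [S]-module [V]: sums of pure tensors modulo the congruence [tcong].   *)

Inductive tterm (A V : Type) : Type :=
| TPure of A & V
| TAdd of tterm A V & tterm A V.

Section Tensor.
Variables (S A : pzRingType) (f : {rmorphism S -> A}) (V : lmodType S).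

Inductive tcong : tterm A V -> tterm A V -> Prop :=
| tcong_refl s : tcong s s
| tcong_sym s t : tcong s t -> tcong t s
| tcong_trans s t u : tcong s t -> tcong t u -> tcong s u
| tcong_add s s' t t' :
    tcong s s' -> tcong t t' -> tcong (TAdd s t) (TAdd s' t')
| tcong_addA s t u : tcong (TAdd s (TAdd t u)) (TAdd (TAdd s t) u)
| tcong_addC s t : tcong (TAdd s t) (TAdd t s)
| tcong_add0 s : tcong (TAdd (TPure 0 0) s) s
| tcong_pureDl a b v : tcong (TPure (a + b) v) (TAdd (TPure a v) (TPure b v))
| tcong_pureDr a u v : tcong (TPure a (u + v)) (TAdd (TPure a u) (TPure a v))
| tcong_bal a s v : tcong (TPure (a * f s) v) (TPure a (s *: v)).

Fixpoint tact (a : A) (t : tterm A V) : tterm A V :=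
  match t with
  | TPure b v => TPure (a * b) v
  | TAdd s t => TAdd (tact a s) (tact a t)
  end.

HB.instance Definition _ := gen_eqMixin (tterm A V).
HB.instance Definition _ := gen_choiceMixin (tterm A V).

Definition tcongb : rel (tterm A V) := fun s t => `[< tcong s t >].

Lemma tcongb_refl : reflexive tcongb.
Proof. by move=> s; apply/asboolP; apply: tcong_refl. Qed.

Lemma tcongb_sym : symmetric tcongb.
Proof. by move=> s t; apply: asbool_equiv_eq; split; apply: tcong_sym. Qed.

Lemma tcongb_trans : transitive tcongb.
Proof.
by move=> t s u /asboolP st /asboolP tu; apply/asboolP; apply: tcong_trans st tu.
Qed.

Definition tcong_equiv := EquivRel tcongb tcongb_refl tcongb_sym tcongb_trans.

Definition tens : Type := {eq_quot tcong_equiv}.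
HB.instance Definition _ := Choice.on tens.
HB.instance Definition _ := EqQuotient.on tens.

Lemma tens_eq s t : tcong s t <-> \pi_tens s = \pi_tens t.
Proof.
split=> [st|/eqmodP /asboolP //].
by apply/eqmodP; apply/asboolP.
Qed.

Lemma tens_indpi (P : tens -> Prop) :
  (forall t, P (\pi_tens t)) -> forall x, P x.
Proof. by move=> Pt x; rewrite -[x]reprK; apply: Pt. Qed.

Lemma tcong_repr t : tcong (repr (\pi_tens t)) t.
Proof. by apply/tens_eq; rewrite reprK. Qed.

Lemma tact_cong a s t : tcong s t -> tcong (tact a s) (tact a t).
Proof.
elim=> {s t} /=.
- by move=> s; apply: tcong_refl.
- by move=> s t _; apply: tcong_sym.
- by move=> s t u _ st _; apply: tcong_trans st.
- by move=> s s' t t' _ hs _ ht; apply: tcong_add.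
- by move=> s t u; apply: tcong_addA.
- by move=> s t; apply: tcong_addC.
- by move=> s; rewrite mulr0; apply: tcong_add0.
- by move=> b c v; rewrite mulrDr; apply: tcong_pureDl.
- by move=> b u v; apply: tcong_pureDr.
- by move=> b s v; rewrite mulrA; apply: tcong_bal.
Qed.

Lemma tcong_pure0 v : tcong (TPure 0 v) (TPure 0 0).
Proof.
by have := tcong_bal 0 0 v; rewrite mul0r scale0r.
Qed.

Let tadd (x y : tens) : tens := \pi_tens (TAdd (repr x) (repr y)).
Let topp (x : tens) : tens := \pi_tens (tact (-1) (repr x)).
Let tscale (a : A) (x : tens) : tens := \pi_tens (tact a (repr x)).

Let taddE s t : tadd (\pi_tens s) (\pi_tens t) = \pi_tens (TAdd s t).
Proof. by apply/tens_eq; apply: tcong_add; apply: tcong_repr. Qed.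

Let tscaleE a s : tscale a (\pi_tens s) = \pi_tens (tact a s).
Proof. by apply/tens_eq; apply: tact_cong; apply: tcong_repr. Qed.

Fact tens_addA : associative tadd.
Proof.
elim/tens_indpi=> s; elim/tens_indpi=> t; elim/tens_indpi=> u.
by rewrite !taddE; apply/tens_eq/tcong_addA.
Qed.

Fact tens_addC : commutative tadd.
Proof.
elim/tens_indpi=> s; elim/tens_indpi=> t.
by rewrite !taddE; apply/tens_eq/tcong_addC.
Qed.

Fact tens_add0 : left_id (\pi_tens (TPure 0 0)) tadd.
Proof. by elim/tens_indpi=> s; rewrite taddE; apply/tens_eq/tcong_add0. Qed.

Fact tens_addN : left_inverse (\pi_tens (TPure 0 0)) topp tadd.
Proof.
elim/tens_indpi=> s; rewrite -[topp _]/(tscale (-1) _) tscaleE.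
elim: s => [a v|s hs t ht] /=.
  rewrite taddE mulN1r; apply/tens_eq.
  apply: (tcong_trans _ (tcong_pure0 v)).
  by have := tcong_pureDl (- a) a v; rewrite addNr => /tcong_sym.
rewrite -!taddE -tens_addA (tens_addA (\pi_tens (tact (-1) t))).
rewrite (tens_addC (\pi_tens (tact (-1) t))) -tens_addA ht tens_addA hs.
exact: tens_add0.
Qed.

HB.instance Definition _ :=
  GRing.isZmodule.Build tens tens_addA tens_addC tens_add0 tens_addN.

Fact tens_scaleA a b v : tscale a (tscale b v) = tscale (a * b) v.
Proof.
elim/tens_indpi: v => t; rewrite !tscaleE; congr (\pi_tens _).
by elim: t => [c v|s /= -> t -> //] /=; rewrite mulrA.
Qed.

Fact tens_scale1 : left_id 1 tscale.
Proof.
elim/tens_indpi=> t; rewrite !tscaleE; congr (\pi_tens _).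
by elim: t => [c v|s /= -> t -> //] /=; rewrite mul1r.
Qed.

Fact tens_scaleDr : right_distributive tscale +%R.
Proof.
move=> a; elim/tens_indpi=> s; elim/tens_indpi=> t.
change (tscale a (tadd (\pi_tens s) (\pi_tens t)) =
        tadd (tscale a (\pi_tens s)) (tscale a (\pi_tens t))).
by rewrite !(taddE, tscaleE).
Qed.

Fact tens_scaleDl v : {morph tscale^~ v : a b / a + b}.
Proof.
elim/tens_indpi: v => t a b.
change (tscale (a + b) (\pi_tens t) =
        tadd (tscale a (\pi_tens t)) (tscale b (\pi_tens t))).
rewrite !tscaleE taddE; elim: t => [c v|s hs t ht] /=.
  by rewrite mulrDl; apply/tens_eq/tcong_pureDl.
rewrite -!taddE hs ht -!taddE -!tens_addA; congr tadd.
by rewrite tens_addA (tens_addC (\pi_tens (tact b s))) -tens_addA.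
Qed.

HB.instance Definition _ := GRing.Zmodule_isLmodule.Build A tens
  tens_scaleA tens_scale1 tens_scaleDr tens_scaleDl.

Definition tpure (a : A) (v : V) : tens := \pi_tens (TPure a v).

End Tensor.

Section Submodules.
Variables (S : pzRingType) (V : lmodType S).

Definition submodule (U : V -> Prop) : Prop :=
  [/\ U 0, forall u v, U u -> U v -> U (u + v)
     & forall (a : S) u, U u -> U (a *: u)].

Definition msubspan (P : V -> Prop) (v : V) : Prop :=
  forall U : V -> Prop, submodule U -> (forall u, P u -> U u) -> U v.

Definition simple_module : Prop :=
  (exists v : V, v <> 0) /\
  forall U : V -> Prop, submodule U ->
    (forall v, U v -> v = 0) \/ (forall v, U v).

Lemma msubspan_submodule P : submodule (msubspan P).
Proof.
split=> [U [] //|u v hu hv U hU hP|a u hu U hU hP]; case: (hU) => _ hD hZ.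
  by apply: hD; [apply: hu|apply: hv].
by apply: hZ; apply: hu.
Qed.

End Submodules.

Section QuotientModule.
Variables (S : pzRingType) (V : lmodType S) (P : V -> Prop).

Definition qmodb : rel V := fun u v => `[< msubspan P (u - v) >].

Let hN u : msubspan P u -> msubspan P (- u).
Proof.
by move=> hu; rewrite -scaleN1r; case: (msubspan_submodule P) => _ _; apply.
Qed.

Lemma qmodb_refl : reflexive qmodb.
Proof.
by move=> s; apply/asboolP; rewrite subrr; case: (msubspan_submodule P).
Qed.

Lemma qmodb_sym : symmetric qmodb.
Proof.
by move=> s t; apply: asbool_equiv_eq; split=> /hN; rewrite opprB.
Qed.

Lemma qmodb_trans : transitive qmodb.
Proof.
move=> t s u /asboolP st /asboolP tu; apply/asboolP.
rewrite -[s](subrK t) -addrA.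
by case: (msubspan_submodule P) => _ hD _; apply: hD.
Qed.

Definition qmod_equiv := EquivRel qmodb qmodb_refl qmodb_sym qmodb_trans.

(* [P] need not be a submodule: the quotient is by the span of [P]. *)
Definition qmod : Type := {eq_quot qmod_equiv}.
HB.instance Definition _ := Choice.on qmod.
HB.instance Definition _ := EqQuotient.on qmod.

Lemma qmod_eq u v : msubspan P (u - v) <-> \pi_qmod u = \pi_qmod v.
Proof.
split=> [st|/eqmodP /asboolP //].
by apply/eqmodP; apply/asboolP.
Qed.

Lemma qmod_ind (Q : qmod -> Prop) : (forall t, Q (\pi_qmod t)) -> forall x, Q x.
Proof. by move=> Qt x; rewrite -[x]reprK; apply: Qt. Qed.

Let qadd (x y : qmod) : qmod := \pi_qmod (repr x + repr y).
Let qopp (x : qmod) : qmod := \pi_qmod (- repr x).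
Let qscale (a : S) (x : qmod) : qmod := \pi_qmod (a *: repr x).

Let hrepr v : msubspan P (repr (\pi_qmod v) - v).
Proof. by apply/qmod_eq; rewrite reprK. Qed.

Let qaddE u v : qadd (\pi_qmod u) (\pi_qmod v) = \pi_qmod (u + v).
Proof.
apply/qmod_eq; rewrite opprD addrACA.
by case: (msubspan_submodule P) => _ hD _; apply: hD.
Qed.

Let qoppE v : qopp (\pi_qmod v) = \pi_qmod (- v).
Proof. by apply/qmod_eq; rewrite -opprD; apply: hN. Qed.

Let qscaleE a v : qscale a (\pi_qmod v) = \pi_qmod (a *: v).
Proof.
apply/qmod_eq; rewrite -scalerBr.
by case: (msubspan_submodule P) => _ _; apply.
Qed.

Fact qmod_addA : associative qadd.
Proof.
elim/qmod_ind=> s; elim/qmod_ind=> t; elim/qmod_ind=> u.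
by rewrite !qaddE addrA.
Qed.
Fact qmod_addC : commutative qadd.
Proof. by elim/qmod_ind=> s; elim/qmod_ind=> t; rewrite !qaddE addrC. Qed.
Fact qmod_add0 : left_id (\pi_qmod 0) qadd.
Proof. by elim/qmod_ind=> s; rewrite qaddE add0r. Qed.
Fact qmod_addN : left_inverse (\pi_qmod 0) qopp qadd.
Proof. by elim/qmod_ind=> s; rewrite qoppE qaddE addNr. Qed.

HB.instance Definition _ :=
  GRing.isZmodule.Build qmod qmod_addA qmod_addC qmod_add0 qmod_addN.

Fact qmod_scaleA a b v : qscale a (qscale b v) = qscale (a * b) v.
Proof. by elim/qmod_ind: v => v; rewrite !qscaleE scalerA. Qed.
Fact qmod_scale1 : left_id 1 qscale.
Proof. by elim/qmod_ind=> v; rewrite !qscaleE scale1r. Qed.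
Fact qmod_scaleDr : right_distributive qscale +%R.
Proof.
move=> a; elim/qmod_ind=> s; elim/qmod_ind=> t.
change (qscale a (qadd (\pi_qmod s) (\pi_qmod t)) =
        qadd (qscale a (\pi_qmod s)) (qscale a (\pi_qmod t))).
by rewrite !(qaddE, qscaleE) scalerDr.
Qed.
Fact qmod_scaleDl v : {morph qscale^~ v : a b / a + b}.
Proof.
elim/qmod_ind: v => t a b.
change (qscale (a + b) (\pi_qmod t) =
        qadd (qscale a (\pi_qmod t)) (qscale b (\pi_qmod t))).
by rewrite !(qaddE, qscaleE) scalerDl.
Qed.

HB.instance Definition _ := GRing.Zmodule_isLmodule.Build S qmod
  qmod_scaleA qmod_scale1 qmod_scaleDr qmod_scaleDl.

Definition qmod_pi (v : V) : qmod := \pi_qmod v.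

Fact qmod_pi_nmod_morphism : nmod_morphism qmod_pi.
Proof. by split=> // u v; rewrite /qmod_pi -qaddE. Qed.
HB.instance Definition _ :=
  GRing.isNmodMorphism.Build V qmod qmod_pi qmod_pi_nmod_morphism.
Fact qmod_pi_scalable : scalable qmod_pi.
Proof. by move=> a v; rewrite /qmod_pi -qscaleE. Qed.
HB.instance Definition _ :=
  GRing.isScalable.Build S V qmod *:%R qmod_pi qmod_pi_scalable.

End QuotientModule.

Definition isomorphic (S : pzRingType) (V W : lmodType S) : Prop :=
  exists f : {linear V -> W}, bijective f.

Inductive sgen := GC | GE | GF | GK | GKi | GX | GY.

Section QuantumSchroedinger.
Variable F : fieldType.
Implicit Types q b z lam : F.

Definition generic q : Prop := q != 0 /\ forall n, (0 < n)%N -> q ^+ n != 1.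

Definition qnum q (m : nat) : F := (q ^+ m - q ^- m) / (q - q^-1).
Definition qbinom q (m i : nat) : F :=
  (\prod_(j < i) qnum q (m - j)) / (\prod_(j < i) qnum q j.+1).

Local Notation "c *; t" := (PMul (PIn c) t) (at level 40) : pterm_scope.
Local Notation C := (PGen GC).
Local Notation E := (PGen GE).
Local Notation F_ := (PGen GF).
Local Notation K := (PGen GK).
Local Notation Ki := (PGen GKi).
Local Notation X := (PGen GX).
Local Notation Y := (PGen GY).

Inductive Sq_rel q : pterm F sgen -> pterm F sgen -> Prop :=
| Sq_scal c g : Sq_rel q (PIn c * PGen g)%P (PGen g * PIn c)%P
| Sq_Ccentral g : Sq_rel q (C * PGen g)%P (PGen g * C)%P
| Sq_KKi : Sq_rel q (K * Ki)%P (PIn 1)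
| Sq_KiK : Sq_rel q (Ki * K)%P (PIn 1)
| Sq_KE : Sq_rel q (K * E * Ki)%P (q ^+ 2 *; E)%P
| Sq_KF : Sq_rel q (K * F_ * Ki)%P (q ^- 2 *; F_)%P
| Sq_EF : Sq_rel q (E * F_ + (-1) *; (F_ * E))%P
                   ((q - q^-1)^-1 *; (K + (-1) *; Ki))%P
| Sq_KX : Sq_rel q (K * X * Ki)%P (q *; X)%P
| Sq_KY : Sq_rel q (K * Y * Ki)%P (q^-1 *; Y)%P
| Sq_YX : Sq_rel q (q *; (Y * X) + (-1) *; (X * Y))%P C
| Sq_EX : Sq_rel q (E * X)%P (q *; (X * E))%P
| Sq_EY : Sq_rel q (E * Y)%P (X + q^-1 *; (Y * E))%P
| Sq_FX : Sq_rel q (F_ * X)%P (Y * Ki + X * F_)%P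
| Sq_FY : Sq_rel q (F_ * Y)%P (Y * F_)%P.

Definition Sq q : pzRingType := pres (Sq_rel q).

Definition sgenE q (g : sgen) : Sq q := pgen (Sq_rel q) g.
Definition scal q : {rmorphism F -> Sq q} := pin (Sq_rel q).

Lemma Sq_relP q s t : Sq_rel q s t ->
  peval (scal q) (sgenE q) s = peval (scal q) (sgenE q) t.
Proof.
have piE u : peval (scal q) (sgenE q) u = \pi_(pres (Sq_rel q)) u.
  by elim: u => //= [u -> v ->|u -> v ->]; rewrite ?pres_piD ?pres_piM.
by rewrite !piE => st; apply/pres_eq/pcong_rel.
Qed.

Lemma scal_central q c (x : Sq q) : scal q c * x = x * scal q c.
Proof.
elim/pres_ind: x; elim=> [a|g|s hs t ht|s hs t ht].
- by rewrite -[\pi_(pres _) _]/(scal q a) -!rmorphM mulrC.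
- exact: (Sq_relP (Sq_scal q c g)).
- by rewrite pres_piD mulrDl mulrDr hs ht.
- by rewrite pres_piM mulrA hs -!mulrA ht.
Qed.

Lemma C_central q (x : Sq q) : sgenE q GC * x = x * sgenE q GC.
Proof.
elim/pres_ind: x; elim=> [a|g|s hs t ht|s hs t ht].
- by symmetry; apply: scal_central.
- exact: (Sq_relP (Sq_Ccentral q g)).
- by rewrite pres_piD mulrDl mulrDr hs ht.
- by rewrite pres_piM mulrA hs -!mulrA ht.
Qed.

End QuantumSchroedinger.

Lemma loc_central (A : pzRingType) (y c : A) :
  (forall x, c * x = x * c) -> forall x : loc y, loc_in y c * x = x * loc_in y c.
Proof.
move=> hc; elim/pres_ind; elim=> [a|[]|s hs t ht|s hs t ht].
- by rewrite -[\pi_(pres _) _]/(loc_in y a) -!rmorphM hc.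
- rewrite -[\pi_(pres _) _]/(loc_inv y) -[LHS]mul1r -(loc_mulVl y).
  rewrite -!mulrA [loc_in y y * _]mulrA -rmorphM -hc rmorphM -!mulrA.
  by rewrite loc_mulV mulr1.
- by rewrite pres_piD mulrDl mulrDr hs ht.
- by rewrite pres_piM mulrA hs -!mulrA ht.
Qed.

(* The values of Theta_b on the generators satisfy the relations of S_q; they *)
(* are checked in any ring [B] receiving S_q in which the image of Y has an   *)
(* inverse [yi] and the images of the scalars and of C are central.           *)
Section ThetaRelations.
Variables (F : fieldType) (q b : F).
Hypotheses (hq : generic q) (hb : b != 0).
Variables (B : pzRingType) (phi : {rmorphism Sq q -> B}) (yi : B).

Local Notation sc c := (phi (scal q c)).
Local Notation g := (fun x => phi (sgenE q x)).

Definition theta_gen (x : sgen) : B :=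
  match x with
  | GC => g GC
  | GE => sc b^-1 * g GE + sc ((b - b^-1) / (q - q^-1)) * (yi * g GX)
          - sc ((b + q * b^-1 - q - 1) / ((q - q^-1) * (q - 1)))
            * (g GC * yi ^+ 2)
  | GF => g GF
  | GK => sc b^-1 * g GK
  | GKi => sc b * g GKi
  | GX => sc b * g GX - sc ((b - 1) / (q - 1)) * (g GC * yi)
  | GY => g GY
  end.

Hypotheses (yyi : g GY * yi = 1) (yiy : yi * g GY = 1).
Hypothesis scC : forall c (x : B), sc c * x = x * sc c.
Hypothesis CC : forall x : B, g GC * x = x * g GC.

Let C := g GC. Let E := g GE. Let F_ := g GF. Let K := g GK. Let Ki := g GKi.
Let X := g GX. Let Y := g GY.

Let rl s t : Sq_rel q s t -> phi (peval (scal q) (sgenE q) s) =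
                             phi (peval (scal q) (sgenE q) t).
Proof. by move/Sq_relP->. Qed.

Let scM c d : sc c * sc d = sc (c * d).
Proof. by rewrite !rmorphM. Qed.
Let scMA c d x : sc c * (sc d * x) = sc (c * d) * x.
Proof. by rewrite mulrA scM. Qed.
Let scMl c x y : (sc c * x) * y = sc c * (x * y).
Proof. by rewrite mulrA. Qed.
Let scMr c x y : x * (sc c * y) = sc c * (x * y).
Proof. by rewrite mulrA -scC mulrA. Qed.
Let scD c d x : sc c * x + sc d * x = sc (c + d) * x.
Proof. by rewrite -mulrDl !rmorphD. Qed.
Let scN c : - sc c = sc (- c).
Proof. by rewrite !rmorphN. Qed.
Let scN1 x : sc (-1) * x = - x.
Proof. by rewrite !rmorphN1 mulN1r. Qed.
Let sc1 x : sc 1 * x = x.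
Proof. by rewrite !rmorph1 mul1r. Qed.
Let CMr x y : x * (C * y) = C * (x * y).
Proof. by rewrite mulrA -CC mulrA. Qed.

Let q0 : q != 0. Proof. by case: hq. Qed.
Let q1 : q - 1 != 0.
Proof. by case: hq => _ /(_ 1%N isT); rewrite expr1 subr_eq0. Qed.
Let q2 : q * q - 1 != 0.
Proof. by case: hq => _ /(_ 2%N isT); rewrite expr2 subr_eq0. Qed.
Let qq : q - q^-1 != 0.
Proof.
apply: contra q2 => /eqP h; apply/eqP.
by rewrite -[1](divff q0) -mulrBr h mulr0.
Qed.

Let KKi : K * Ki = 1.
Proof. by have := rl (Sq_KKi q); rewrite /= rmorphM !rmorph1. Qed.
Let KiK : Ki * K = 1.
Proof. by have := rl (Sq_KiK q); rewrite /= rmorphM !rmorph1. Qed.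
Let KE : K * E * Ki = sc (q ^+ 2) * E.
Proof. by have := rl (Sq_KE q); rewrite /= !rmorphM. Qed.
Let KF : K * F_ * Ki = sc (q ^- 2) * F_.
Proof. by have := rl (Sq_KF q); rewrite /= !rmorphM. Qed.
Let KX : K * X * Ki = sc q * X.
Proof. by have := rl (Sq_KX q); rewrite /= !rmorphM. Qed.
Let KY : K * Y * Ki = sc q^-1 * Y.
Proof. by have := rl (Sq_KY q); rewrite /= !rmorphM. Qed.
Let EF : E * F_ = F_ * E + sc (q - q^-1)^-1 * (K - Ki).
Proof.
have := rl (Sq_EF q); rewrite /= !(rmorphD, rmorphM) /= -/E -/F_ -/K -/Ki.
by rewrite !scN1 => <-; rewrite addrC subrK.
Qed.
Let XY : X * Y = sc q * (Y * X) - C.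
Proof.
have := rl (Sq_YX q); rewrite /= !(rmorphD, rmorphM) /= -/X -/Y -/C.
by rewrite scN1 => <-; rewrite opprD opprK addrA subrr add0r.
Qed.
Let EX : E * X = sc q * (X * E).
Proof. by have := rl (Sq_EX q); rewrite /= !rmorphM. Qed.
Let EY : E * Y = X + sc q^-1 * (Y * E).
Proof. by have := rl (Sq_EY q); rewrite /= !(rmorphD, rmorphM). Qed.
Let FX : F_ * X = Y * Ki + X * F_.
Proof. by have := rl (Sq_FX q); rewrite /= !(rmorphD, rmorphM). Qed.
Let FY : F_ * Y = Y * F_.
Proof. by have := rl (Sq_FY q); rewrite /= !rmorphM. Qed.

Let scV c x y : c != 0 -> x = sc c * y -> y = sc c^-1 * x.
Proof. by move=> c0 ->; rewrite scMA mulVf // sc1. Qed.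

Let Xyi : X * yi = sc q^-1 * (yi * X) + sc q^-1 * (C * (yi * yi)).
Proof.
have: yi * (X * Y) * yi = sc q * (X * yi) - C * (yi * yi).
  rewrite XY mulrBr mulrBl scMr -mulrA -mulrA mulrA.
  by rewrite -!mulrA [yi * (Y * _)]mulrA yiy mul1r !mulrA -CC -!mulrA.
rewrite -!mulrA yyi mulr1 -mulrDr => h.
by apply: scV => //; rewrite h subrK.
Qed.

Let Eyi : E * yi = sc q * (yi * E) + sc (-1) * (yi * (yi * X))
                   + sc (-1) * (C * (yi * (yi * yi))).
Proof.
have: yi * (E * Y) * yi = yi * (X * yi) + sc q^-1 * (E * yi).
  by rewrite EY mulrDr mulrDl scMr -!mulrA [yi * (Y * _)]mulrA yiy mul1r.
rewrite -!mulrA yyi mulr1 Xyi mulrDr !scMr CMr => h.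
have -> : E * yi = sc q * (sc q^-1 * (E * yi)) by rewrite scMA mulfV // sc1.
have -> : sc q^-1 * (E * yi) =
  yi * E - (sc q^-1 * (yi * (yi * X)) + sc q^-1 * (C * (yi * (yi * yi)))).
  by rewrite h addrAC subrr add0r.
by rewrite mulrBr mulrDr !scMA mulfV // opprD addrA !sc1 !scN1.
Qed.

Let Fyi : F_ * yi = yi * F_.
Proof.
by rewrite -[LHS]mul1r -yiy -!mulrA [Y * _]mulrA -FY -!mulrA yyi mulr1.
Qed.

Let kM x y : K * (x * y) * Ki = (K * x * Ki) * (K * y * Ki).
Proof. by rewrite -!mulrA [Ki * (K * _)]mulrA KiK mul1r. Qed.

Let Kyi : K * yi * Ki = sc q * yi.
Proof.
have h : (K * yi * Ki) * (sc q^-1 * Y) = 1 by rewrite -KY -kM yiy mulr1.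
have : sc q * ((K * yi * Ki) * (sc q^-1 * Y) * yi) = sc q * yi.
  by rewrite h mul1r.
by rewrite scMr -!mulrA yyi mulr1 scMA mulfV // sc1 => ->.
Qed.

Let KC : K * C * Ki = C.
Proof. by rewrite -CC -mulrA KKi mulr1. Qed.

Let Ksc c x : K * (sc c * x) * Ki = sc c * (K * x * Ki).
Proof. by rewrite scMr -mulrA. Qed.

Let kk x : (sc b^-1 * K) * x * (sc b * Ki) = K * x * Ki.
Proof. by rewrite scMr !scMl scMA mulfV // sc1. Qed.

Let lc m1 m2 m3 m4 m5 a1 a2 a3 a4 a5 :=
  sc a1 * m1 + sc a2 * m2 + sc a3 * m3 + sc a4 * m4 + sc a5 * m5.
Let lcD m1 m2 m3 m4 m5 a1 a2 a3 a4 a5 c1 c2 c3 c4 c5 :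
  lc m1 m2 m3 m4 m5 a1 a2 a3 a4 a5 + lc m1 m2 m3 m4 m5 c1 c2 c3 c4 c5 =
  lc m1 m2 m3 m4 m5 (a1 + c1) (a2 + c2) (a3 + c3) (a4 + c4) (a5 + c5).
Proof.
rewrite /lc -!scD.
rewrite [LHS]addrACA; congr (_ + _); rewrite [LHS]addrACA; congr (_ + _).
rewrite [LHS]addrACA; congr (_ + _); by rewrite [LHS]addrACA.
Qed.


Let al := b^-1.
Let be := (b - b^-1) / (q - q^-1).
Let ga := - ((b + q * b^-1 - q - 1) / ((q - q^-1) * (q - 1))).
Let de := - ((b - 1) / (q - 1)).

Let thE : theta_gen GE =
  sc al * E + sc be * (yi * X) + sc ga * (C * (yi * yi)).
Proof. by rewrite /= -mulNr scN expr2. Qed.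
Let thX : theta_gen GX = sc b * X + sc de * (C * yi).
Proof. by rewrite /= -mulNr scN. Qed.

Let sc0 x : sc 0 * x = 0. Proof. by rewrite !rmorph0 mul0r. Qed.

Let th_scC c x : sc c * x = x * sc c := scC c x.


Let Csc c : C * sc c = sc c * C. Proof. by rewrite scC. Qed.

Let th_KE : theta_gen GK * theta_gen GE * theta_gen GKi
  = sc (q ^+ 2) * theta_gen GE.
Proof.
rewrite [X in X * _ * _]/= [X in _ * X = _]/= kk thE !(mulrDr, mulrDl).
rewrite !Ksc !kM KE !Kyi KX KC !(scMA, scMl, scMr) ?scMA.
rewrite (_ : al * q ^+ 2 = q ^+ 2 * al); last by rewrite mulrC.
rewrite (_ : be * q * q = q ^+ 2 * be); last by ring.
by rewrite (_ : ga * q * q = q ^+ 2 * ga); last by ring.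
Qed.

Let th_KF : theta_gen GK * theta_gen GF * theta_gen GKi
  = sc (q ^- 2) * theta_gen GF.
Proof. by rewrite /= kk KF. Qed.

Let th_KY : theta_gen GK * theta_gen GY * theta_gen GKi
  = sc q^-1 * theta_gen GY.
Proof. by rewrite /= kk KY. Qed.

Let th_KX : theta_gen GK * theta_gen GX * theta_gen GKi
  = sc q * theta_gen GX.
Proof.
rewrite [X in X * _ * _]/= [X in _ * X = _]/= kk thX !(mulrDr, mulrDl).
rewrite !Ksc !kM Kyi KX KC ?(scMA, scMr) ?scMA.
by rewrite [q * b]mulrC [q * de]mulrC.
Qed.

Let th_KKi : theta_gen GK * theta_gen GKi = 1.
Proof. by rewrite /= scMr scMl scMA mulfV // sc1 KKi. Qed.

Let th_KiK : theta_gen GKi * theta_gen GK = 1.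
Proof. by rewrite /= scMr scMl scMA mulVf // sc1 KiK. Qed.

Let th_YX : sc q * (theta_gen GY * theta_gen GX)
  + sc (-1) * (theta_gen GX * theta_gen GY) = theta_gen GC.
Proof.
rewrite thX [theta_gen GY]/= [theta_gen GC]/= -/Y -/C !(mulrDr, mulrDl).
rewrite !(scMA, scMl, scMr) !CMr -!mulrA yyi yiy XY !mulr1 ?(scMA, scMr) !mulrDr.
rewrite -[- C]scN1 ?(scMA, scMr) ?scMA.
have H := lcD (Y * X) C 0 0 0.
have l1 x : sc x * (Y * X) = lc (Y * X) C 0 0 0 x 0 0 0 0.
  by rewrite /lc !sc0 !addr0.
have l2 x : sc x * C = lc (Y * X) C 0 0 0 0 x 0 0 0.
  by rewrite /lc !sc0 !addr0 add0r.
rewrite ?Csc -[RHS]sc1 !(l1, l2) !H; congr lc; rewrite /de.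
all: by field; rewrite ?q0 ?q1.
Qed.

Let th_EX : theta_gen GE * theta_gen GX
  = sc q * (theta_gen GX * theta_gen GE).
Proof.
pose m1 := X * E; pose m2 := C * (yi * E); pose m3 := yi * (X * X).
pose m4 := C * (yi * (yi * X)); pose m5 := C * (C * (yi * (yi * yi))).
have H := lcD m1 m2 m3 m4 m5.
have l1 x : sc x * m1 = lc m1 m2 m3 m4 m5 x 0 0 0 0.
  by rewrite /lc !sc0 !addr0.
have l2 x : sc x * m2 = lc m1 m2 m3 m4 m5 0 x 0 0 0.
  by rewrite /lc !sc0 !addr0 add0r.
have l3 x : sc x * m3 = lc m1 m2 m3 m4 m5 0 0 x 0 0.
  by rewrite /lc !sc0 !addr0 !add0r.
have l4 x : sc x * m4 = lc m1 m2 m3 m4 m5 0 0 0 x 0.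
  by rewrite /lc !sc0 !addr0 !add0r.
have l5 x : sc x * m5 = lc m1 m2 m3 m4 m5 0 0 0 0 x.
  by rewrite /lc !sc0 !add0r.
have p1 : E * X = sc q * m1 by exact: EX.
have p2 : E * (C * yi) = sc q * m2 + sc (-1) * m4 + sc (-1) * m5.
  by rewrite CMr Eyi !mulrDr ?(scMA, scMr).
have p3 : (yi * X) * X = sc 1 * m3 by rewrite sc1 -mulrA.
have p4 : (yi * X) * (C * yi) = sc q^-1 * m4 + sc q^-1 * m5.
  rewrite CMr -mulrA Xyi !mulrDr ?(scMA, scMr); congr (_ + sc _ * (C * _)).
  by rewrite CMr.
have p5 : (C * (yi * yi)) * X = sc 1 * m4 by rewrite sc1 -!mulrA.
have p6 : (C * (yi * yi)) * (C * yi) = sc 1 * m5.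
  by rewrite sc1 CMr -!mulrA.
have r2 : X * (yi * X) = sc q^-1 * m3 + sc q^-1 * m4.
  by rewrite mulrA Xyi mulrDl !scMl -!mulrA.
have r3 : X * (C * (yi * yi)) =
    sc (q^-1 * q^-1) * m4 + sc (q^-1 * q^-1 + q^-1) * m5.
  rewrite CMr [X * _]mulrA Xyi mulrDl !scMl -!mulrA Xyi !mulrDr.
  rewrite ?(scMA, scMr).
  by rewrite -addrA -scD; congr (_ + (sc _ * (C * _) + _)); rewrite CMr.
have r4 : (C * yi) * E = sc 1 * m2 by rewrite sc1 -mulrA.
have r5 : (C * yi) * (yi * X) = sc 1 * m4 by rewrite sc1 -!mulrA.
have r6 : (C * yi) * (C * (yi * yi)) = sc 1 * m5.
  by rewrite sc1 CMr -!mulrA.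
rewrite thE thX !(mulrDl, mulrDr) !(scMA, scMl, scMr).
rewrite p1 p2 p3 p4 p5 p6 r2 r3 r4 r5 r6 -/m1 !mulrDr ?scMA.
rewrite !(l1, l2, l3, l4, l5) !H /al /be /ga /de; congr lc.
all: by field; rewrite ?q0 ?q1 ?q2 ?hb.
Qed.

Let th_EY : theta_gen GE * theta_gen GY
  = theta_gen GX + sc q^-1 * (theta_gen GY * theta_gen GE).
Proof.
pose m1 := X; pose m2 := Y * E; pose m3 := C * yi.
have H := lcD m1 m2 m3 0 0.
have l1 x : sc x * m1 = lc m1 m2 m3 0 0 x 0 0 0 0.
  by rewrite /lc !sc0 !addr0.
have l2 x : sc x * m2 = lc m1 m2 m3 0 0 0 x 0 0 0.
  by rewrite /lc !sc0 !addr0 add0r.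
have l3 x : sc x * m3 = lc m1 m2 m3 0 0 0 0 x 0 0.
  by rewrite /lc !sc0 !addr0 !add0r.
have p1 : E * Y = sc 1 * m1 + sc q^-1 * m2 by rewrite sc1 EY.
have p2 : (yi * X) * Y = sc q * m1 + sc (-1) * m3.
  by rewrite -mulrA XY mulrBr scMr [yi * (Y * X)]mulrA yiy mul1r -CC scN1.
have p3 : (C * (yi * yi)) * Y = sc 1 * m3 by rewrite sc1 -!mulrA yiy mulr1.
have p4 : Y * (yi * X) = sc 1 * m1 by rewrite sc1 mulrA yyi mul1r.
have p5 : Y * (C * (yi * yi)) = sc 1 * m3.
  by rewrite sc1 CMr [Y * _]mulrA yyi mul1r.
rewrite thE thX [theta_gen GY]/= -/Y !(mulrDl, mulrDr) !(scMA, scMl, scMr).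
rewrite p1 p2 p3 p4 p5 -/m1 -/m2 -/m3 !mulrDr ?scMA.
rewrite !(l1, l2, l3) !H /al /be /ga /de; congr lc.
all: by field; rewrite ?q0 ?q1 ?q2 ?hb.
Qed.

Let th_EF : theta_gen GE * theta_gen GF
    + sc (-1) * (theta_gen GF * theta_gen GE) =
  sc (q - q^-1)^-1 * (theta_gen GK + sc (-1) * theta_gen GKi).
Proof.
pose m1 := F_ * E; pose m2 := K; pose m3 := Ki.
pose m4 := yi * (X * F_); pose m5 := C * (yi * (yi * F_)).
have H := lcD m1 m2 m3 m4 m5.
have l1 x : sc x * m1 = lc m1 m2 m3 m4 m5 x 0 0 0 0.
  by rewrite /lc !sc0 !addr0.
have l2 x : sc x * m2 = lc m1 m2 m3 m4 m5 0 x 0 0 0.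
  by rewrite /lc !sc0 !addr0 add0r.
have l3 x : sc x * m3 = lc m1 m2 m3 m4 m5 0 0 x 0 0.
  by rewrite /lc !sc0 !addr0 !add0r.
have l4 x : sc x * m4 = lc m1 m2 m3 m4 m5 0 0 0 x 0.
  by rewrite /lc !sc0 !addr0 !add0r.
have l5 x : sc x * m5 = lc m1 m2 m3 m4 m5 0 0 0 0 x.
  by rewrite /lc !sc0 !add0r.
have p1 : E * F_ = sc 1 * m1 + sc (q - q^-1)^-1 * m2 + sc (- (q - q^-1)^-1) * m3.
  by rewrite sc1 EF mulrBr addrA -scN mulNr.
have p2 : (yi * X) * F_ = sc 1 * m4 by rewrite sc1 -mulrA.
have p3 : (C * (yi * yi)) * F_ = sc 1 * m5 by rewrite sc1 -!mulrA.
have p4 : F_ * E = sc 1 * m1 by rewrite sc1.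
have p5 : F_ * (yi * X) = sc 1 * m3 + sc 1 * m4.
  by rewrite mulrA Fyi -mulrA FX mulrDr !sc1 mulrA yiy mul1r.
have p6 : F_ * (C * (yi * yi)) = sc 1 * m5.
  by rewrite sc1 CMr [F_ * _]mulrA Fyi -mulrA Fyi.
rewrite thE [theta_gen GF]/= [theta_gen GK]/= [theta_gen GKi]/= -/F_ -/K -/Ki.
rewrite !(mulrDl, mulrDr) !(scMA, scMl, scMr) p1 p2 p3 p4 p5 p6 -/m2 -/m3.
rewrite !mulrDr ?scMA !(l1, l2, l3, l4, l5) !H /al /be /ga /de; congr lc.
all: by field; rewrite ?q0 ?q1 ?q2 ?hb.
Qed.

Let th_FX : theta_gen GF * theta_gen GX
  = theta_gen GY * theta_gen GKi + theta_gen GX * theta_gen GF.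
Proof.
rewrite thX /= -/Y -/F_ -/Ki !(mulrDl, mulrDr) !(scMA, scMl, scMr) CMr Fyi FX.
by rewrite !mulrDr -!mulrA !addrA.
Qed.

Let th_Cc y : theta_gen GC * theta_gen y = theta_gen y * theta_gen GC.
Proof. exact: CC. Qed.

Theorem theta_gen_rel s t : Sq_rel q s t ->
  peval (phi \o scal q) theta_gen s = peval (phi \o scal q) theta_gen t.
Proof.
have sc1' : sc 1 = 1 by rewrite !rmorph1.
case=> [c x|x||||||||||||]; rewrite ![peval _ _ _]/=.
- exact: scC.
- exact: CC.
- by rewrite th_KKi.
- by rewrite th_KiK.
- exact: th_KE.
- exact: th_KF.
- exact: th_EF.
- exact: th_KX.
- exact: th_KY.
- exact: th_YX.
- exact: th_EX.
- exact: th_EY.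
- exact: th_FX.
- exact: FY.
Qed.

End ThetaRelations.

Section Twisting.
Variables (F : fieldType) (q b : F).

Definition SqY : pzRingType := loc (sgenE q GY).
Definition SqY_in : {rmorphism Sq q -> SqY} := loc_in (sgenE q GY).
Definition Yinv : SqY := loc_inv (sgenE q GY).

Hypotheses (hq : generic q) (hb : b != 0).

Fact Theta_Sq_rel s t : Sq_rel q s t ->
  peval (SqY_in \o scal q) (theta_gen b SqY_in Yinv) s =
  peval (SqY_in \o scal q) (theta_gen b SqY_in Yinv) t.
Proof.
apply: theta_gen_rel => //.
- exact: loc_mulV.
- exact: loc_mulVl.
- by move=> c; apply: loc_central; apply: scal_central.
- by apply: loc_central; apply: C_central.
Qed.

Definition Theta_Sq : {rmorphism Sq q -> SqY} := plift Theta_Sq_rel.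

Lemma Theta_SqE x : Theta_Sq (sgenE q x) = theta_gen b SqY_in Yinv x.
Proof. exact: plift_gen. Qed.

Fact Theta_rel s t : loc_rel (sgenE q GY) s t ->
  peval Theta_Sq (fun=> Yinv) s = peval Theta_Sq (fun=> Yinv) t.
Proof.
by case=> /=; rewrite rmorph1 Theta_SqE ?loc_mulV ?loc_mulVl.
Qed.

(* Theta_b is determined by [Theta_gen], [Theta_Yinv] and [Theta_scal] below. *)
Definition Theta : {rmorphism SqY -> SqY} := plift Theta_rel.

Lemma Theta_gen x : Theta (SqY_in (sgenE q x)) = theta_gen b SqY_in Yinv x.
Proof. by rewrite [LHS]plift_in Theta_SqE. Qed.

Lemma Theta_Yinv : Theta Yinv = Yinv.
Proof. exact: plift_gen. Qed.

Lemma Theta_scal c : Theta (SqY_in (scal q c)) = SqY_in (scal q c).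
Proof. by rewrite [LHS]plift_in [LHS]plift_in. Qed.

Definition twistB (V : lmodType (Sq q)) : lmodType (Sq q) :=
  restr SqY_in (restr Theta (tens SqY_in V)).

End Twisting.

Section SqModules.
Variables (F : fieldType) (q : F).
Implicit Type V : lmodType (Sq q).

(* An S_q-module is a vector space over the base field through [scal].        *)
Definition cact V (c : F) (v : V) : V := scal q c *: v.
Local Notation "c **: v" := (cact c v) (at level 40).

Definition weight_space V (mu : F) (v : V) : Prop :=
  sgenE q GK *: v = mu **: v.

Definition weight_module V : Prop :=
  (forall v : V, exists (s : seq F) (w : F -> V),
     [/\ uniq s, forall mu, mu \in s -> mu != 0 /\ weight_space mu (w mu)
       & v = \sum_(mu <- s) w mu]) /\
  (forall (s : seq F) (w : F -> V), uniq s ->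
     (forall mu, mu \in s -> mu != 0 /\ weight_space mu (w mu)) ->
     \sum_(mu <- s) w mu = 0 -> forall mu, mu \in s -> w mu = 0).

Definition findim_weight_spaces V : Prop :=
  forall mu, mu != 0 -> exists (n : nat) (e : 'I_n -> V),
    (forall i, weight_space mu (e i)) /\
    forall v : V, weight_space mu v ->
      exists c : 'I_n -> F, v = \sum_(i < n) c i **: e i.

Definition weight_vector V (v : V) : Prop :=
  v <> 0 /\ exists mu, mu != 0 /\ weight_space mu v.

Definition generated_by V (v : V) : Prop :=
  forall w : V, msubspan (fun u => u = v) w.

Definition highest_weight_module V : Prop :=
  weight_module V /\ exists v : V,
    [/\ weight_vector v, sgenE q GE *: v = 0, sgenE q GX *: v = 0
      & generated_by v].

Definition lowest_weight_module V : Prop :=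
  weight_module V /\ exists v : V,
    [/\ weight_vector v, sgenE q GF *: v = 0, sgenE q GY *: v = 0
      & generated_by v].

Definition class_N V : Prop :=
  [/\ simple_module V, weight_module V & findim_weight_spaces V] /\
  [/\ (exists v : V, sgenE q GX *: v <> 0) \/ (exists v : V, sgenE q GY *: v <> 0),
      ~ highest_weight_module V & ~ lowest_weight_module V].

(* M(lam, z): the quotient of the left regular module by the left ideal       *)
(* generated by E, X, K - lam and C - z.                                      *)
Definition verma_rel (lam z : F) (x : (Sq q)^o) : Prop :=
  [\/ x = sgenE q GE, x = sgenE q GX, x = sgenE q GK - scal q lam
    | x = sgenE q GC - scal q z].

Definition verma (lam z : F) : lmodType (Sq q) := qmod (verma_rel lam z).

(* N(lam, z): the quotient of M(lam, z) by the sum of its proper submodules.  *)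
Definition proper_vect V (v : V) : Prop :=
  exists U : V -> Prop, [/\ submodule U, ~ (forall w, U w) & U v].

Definition Nmod (lam z : F) : lmodType (Sq q) :=
  qmod (@proper_vect (verma lam z)).

Definition is_basis V (I : eqType) (e : I -> V) : Prop :=
  (forall v : V, exists (s : seq I) (c : I -> F),
     v = \sum_(i <- s) c i **: e i) /\
  (forall (s : seq I) (c : I -> F), uniq s ->
     \sum_(i <- s) c i **: e i = 0 -> forall i, i \in s -> c i = 0).

(* The action on the basis v_{k,l}.  For l = 0 the terms in v_{k',l-1} have   *)
(* coefficient [0]_q = 0, so that the value l.-1 = 0 is irrelevant there.     *)
Definition basis_action V (b z lam : F) (d : nat) (v : int -> nat -> V) : Prop :=
  forall (k : int) (l : nat), (l < d)%N ->
  [/\ sgenE q GK *: v k l = (lam * b^-1 * q ^ (- k - 2 * l%:Z)) **: v k l,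
      sgenE q GC *: v k l = z **: v k l
    & sgenE q GY *: v k l = v (k + 1) l] /\
  [/\ sgenE q GF *: v k l =
        (if (l < d.-1)%N then v k l.+1 else
         - \sum_(i < d)
             ((- q ^+ d.-1 / (lam * z * (q + 1))) ^+ (d - i) * qbinom q d i)
               **: v (k + 2 * d%:Z - 2 * i%:Z) i),
      sgenE q GX *: v k l =
        (- z * ((b * q ^ k - 1) / (q - 1))) **: v (k - 1) l
        - (lam^-1 * b * q ^ (k + l%:Z - 1) * qnum q l) **: v (k + 1) l.-1
    & sgenE q GE *: v k l =
        ((lam * b^-1 * q ^ (1 - k - l%:Z) - lam^-1 * b * q ^ (k + l%:Z - 1))
           / (q - q^-1) * qnum q l) **: v k l.-1
        - ((q + q ^+ 2 - b^-1 * q ^ (2 - k) - b * q ^ (k + 1))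
             / ((1 - q ^+ 2) * (q - 1)) * z) **: v (k - 2) l].

End SqModules.

(* Main.v *)
(* Let C act by z and put zeta = z / (q - 1), H = Y X - zeta; then H Y = q Y H.
   On a module of class N both X and Y are injective: if Y u = 0 with u <> 0, no
   F^n u vanishes (there is no lowest weight vector), so the X^(2n) F^n u, or the
   E^n F^n u when z = 0, are independent vectors of a single weight space; likewise
   for X.  As weight spaces are finite-dimensional, Y is then bijective.
   On a weight space H has an eigenvector, with a nonzero eigenvalue, and Y^2 E
   raises it until it reaches a vector v_{0,0} on which E is determined by H.  The
   products of the factors F Y^-2 - tau q^(2i) applied to v_{0,0} are eigenvectors of
   H with distinct eigenvalues, so the product of the first d factors vanishes for
   some d; the least d gives lam^2 = q^(2d-3) and z <> 0, and the q-binomial theorem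
   turns the vanishing into the formula for F v_{k,d-1}.

   The twisted module has a basis with the same action: N(lam, z) is embedded in an
   explicit module of functions on Z x N on which Y is invertible, which bounds the
   localization from below, and the span of the v_{k,l} is a submodule stable under
   Y^-1, which bounds it from above.  Modules with such a basis are isomorphic when
   their parameters agree; a shift of k multiplies b by a power of q.  Conversely z
   is the eigenvalue of C, K H has the eigenvalues - zeta lam q^(-2l) with l < d, and
   the eigenvalues of K lie in lam b^-1 q^Z. *)

From HB Require Import structures.
Require Import Defs.
From mathcomp Require Import all_boot all_order all_algebra.
From mathcomp Require Import boolp functions reals complex.
From mathcomp Require Import ring zify.

Set Implicit Arguments.
Unset Strict Implicit.
Unset Printing Implicit Defensive.

Import GRing.Theory.
Local Open Scope ring_scope.
Local Open Scope quotient_scope.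

(** * Linear identities in a vector space *)

(** The shift zeta is forced: it is the scalar for which Y X - zeta and Y q-commute. On vectors of
    weight mu the operator T = Y^-2 F satisfies H T = q^-2 (T H - mu^-1). Hence T fails to lower the
    eigenvalues of H only by the scalar mu^-1, and subtracting a suitable scalar from T repairs
    this; Y^2 E is corrected in the same way by [ediag]. Both operators preserve weights, so their
    chains of eigenvectors stay in one finite-dimensional space and must stop. When the lowering
    chain stops after d steps, E sends the zero vector to [elow d] times the last nonzero one, and
    [elow d = 0] reads (mu h)^2 = zeta^2 q^(2d-3). Since mu h is nonzero this excludes z = 0, a case
    that has to be carried along until then. A highest weight vector has Y X = 0, hence h = - zeta;
    b = - h / zeta measures the deviation from that case, and lam = mu b keeps mu h = - zeta lam.
    For the twisted modules the difficulty is to show that tensors do not vanish over a localization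
    presented by generators and relations; a concrete module with invertible Y detects them. *)

Inductive vexp (F : Type) :=
| VAtom of nat | VZero | VAdd of vexp F & vexp F | VOpp of vexp F
| VScale of F & vexp F.
Arguments VAtom {F}.
Arguments VZero {F}.

Fixpoint veval (F : pzRingType) (V : lmodType F) (env : seq V) (e : vexp F) : V :=
  match e with
  | VAtom n => nth 0 env n
  | VZero => 0
  | VAdd e1 e2 => veval env e1 + veval env e2
  | VOpp e => - veval env e
  | VScale c e => c *: veval env e
  end.

(* A copy of [eqn], which [vect] can unfold without touching [==] inside the
   coefficients. *)
Fixpoint natb (m n : nat) : bool :=
  match m, n with
  | 0%N, 0%N => true | S m, S n => natb m n | _, _ => false
  end.

Fixpoint vcoef (F : pzRingType) (e : vexp F) (i : nat) : F :=
  match e with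
  | VAtom n => if natb n i then 1 else 0
  | VZero => 0
  | VAdd e1 e2 => vcoef e1 i + vcoef e2 i
  | VOpp e => - vcoef e i
  | VScale c e => c * vcoef e i
  end.

Fixpoint vatoms_lt (F : Type) (n : nat) (e : vexp F) : bool :=
  match e with
  | VAtom m => (m < n)%N
  | VZero => true
  | VAdd e1 e2 => vatoms_lt n e1 && vatoms_lt n e2
  | VOpp e => vatoms_lt n e
  | VScale c e => vatoms_lt n e
  end.

Fixpoint vall (P : nat -> Prop) (n : nat) : Prop :=
  match n with
  | 0%N => True
  | n'.+1 => P n' /\ vall P n'
  end.

Lemma vevalE (F : pzRingType) (V : lmodType F) (env : seq V) (e : vexp F) :
  vatoms_lt (size env) e ->
  veval env e = \sum_(i < size env) vcoef e i *: nth 0 env i.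
Proof.
have natbE m n : natb m n = (m == n) by elim: m n => [|m ih] [|n] //=.
elim: e => [n|_|e1 h1 e2 h2|e h|c e h] /=.
- move=> hn; rewrite (bigD1 (Ordinal hn)) //= natbE eqxx scale1r big1 ?addr0 //.
  move=> i /negbTE hi; rewrite natbE eq_sym.
  by rewrite (_ : (_ == n) = false) ?scale0r.
- by rewrite big1 // => i _; rewrite scale0r.
- case/andP=> /h1-> /h2->; rewrite -big_split /=.
  by apply: eq_bigr => i _; rewrite scalerDl.
- move=> /h->; rewrite -sumrN; apply: eq_bigr => i _; by rewrite scaleNr.
- move=> /h->; rewrite scaler_sumr; apply: eq_bigr => i _; by rewrite scalerA.
Qed.

Lemma veval_eq (F : pzRingType) (V : lmodType F) (env : seq V) (e1 e2 : vexp F) :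
  vatoms_lt (size env) e1 -> vatoms_lt (size env) e2 ->
  vall (fun i => vcoef e1 i = vcoef e2 i) (size env) ->
  veval env e1 = veval env e2.
Proof.
move=> h1 h2 h; rewrite !vevalE //; apply: eq_bigr => i _; congr (_ *: _).
elim: (size env) h i => [|n ih] /= h i; first by case: i.
have [->|ni] := eqVneq (nat_of_ord i) n; first by case: h.
have lt : (i < n)%N by move: (ltn_ord i); rewrite ltnS leq_eqVlt (negbTE ni).
by case: h => _ /ih /(_ (Ordinal lt)).
Qed.

Ltac v_mem x l :=
  lazymatch l with
  | nil => false
  | x :: _ => true
  | _ :: ?l => v_mem x l
  end.
Ltac v_add x l :=
  lazymatch v_mem x l with
  | true => l
  | false => constr:(x :: l)
  end.
Ltac v_idx x l :=
  lazymatch l with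
  | x :: _ => constr:(0%N)
  | _ :: ?l => let n := v_idx x l in constr:(S n)
  end.
Ltac v_collect e l :=
  lazymatch e with
  | @GRing.zero _ => l
  | @Algebra.zero _ => l
  | @GRing.add _ ?a ?b => let l := v_collect a l in v_collect b l
  | @GRing.opp _ ?a => v_collect a l
  | @GRing.scale _ _ _ ?a => v_collect a l
  | _ => v_add e l
  end.
Ltac v_reify F e l :=
  lazymatch e with
  | @GRing.zero _ => constr:(@VZero F)
  | @Algebra.zero _ => constr:(@VZero F)
  | @GRing.add _ ?a ?b =>
      let a := v_reify F a l in let b := v_reify F b l in constr:(@VAdd F a b)
  | @GRing.opp _ ?a => let a := v_reify F a l in constr:(@VOpp F a)
  | @GRing.scale _ _ ?c ?a => let a := v_reify F a l in constr:(@VScale F c a)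
  | _ => let n := v_idx e l in constr:(@VAtom F n)
  end.

(** Reduces an equality of vectors to one equality of scalars per atom, within reach of [ring] and
    [field]. Atoms are not compared by arithmetic on their indices, which have to be brought to a
    common form beforehand. *)
Ltac vect F :=
  lazymatch goal with
  | |- @eq ?V ?a ?b =>
    let l := constr:(@nil V) in
    let l := v_collect a l in
    let l := v_collect b l in
    let ea := v_reify F a l in
    let eb := v_reify F b l in
    apply: (@veval_eq F _ l ea eb); [by [] | by [] | ];
    cbv [vall size vcoef natb]; repeat (split; [ | ]); try exact I
  end.

(** * Modules over S_q as vector spaces with operators *)

Lemma submodule_ext (S : pzRingType) (V : lmodType S) (U : V -> Prop) :
  submodule U -> forall u v, U u -> U v -> U (u - v).
Proof.
by case=> _ hD hZ u v hu hv; apply: hD => //; rewrite -scaleN1r; apply: hZ.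
Qed.

Lemma submodule_sum (S : pzRingType) (V : lmodType S) (U : V -> Prop) :
  submodule U -> forall (I : eqType) (s : seq I) (w : I -> V),
  (forall i, i \in s -> U (w i)) -> U (\sum_(i <- s) w i).
Proof.
case=> h0 hD hZ I s w h; rewrite big_seq.
by elim/big_ind: _ => //; exact: hD.
Qed.

Section Operators.
Variables (F : fieldType) (q : F).

(** The same carrier with scalars restricted along [scal]: linear algebra over F takes place in
    [vsp V], submodules live in [V], and the passage between the two is by conversion. *)
Definition vsp (V : lmodType (Sq q)) : lmodType F := restr (scal q) V.

Definition op (V : lmodType (Sq q)) (g : sgen) (v : vsp V) : vsp V :=
  sgenE q g *: (v : V).

Variable V : lmodType (Sq q).
Implicit Types (v w : vsp V) (c : F).

Lemma vscaleE c v : c *: v = scal q c *: (v : V).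
Proof. by []. Qed.

Lemma opD g v w : op g (v + w) = op g v + op g w.
Proof. exact: (@scalerDr _ V). Qed.
Lemma opN g v : op g (- v) = - op g v.
Proof. exact: (@scalerN _ V). Qed.
Lemma opB g v w : op g (v - w) = op g v - op g w.
Proof. exact: (@scalerBr _ V). Qed.
Lemma op0 g : op g (0 : vsp V) = 0.
Proof. exact: (@scaler0 _ V). Qed.
Lemma opZ g c v : op g (c *: v) = c *: op g v.
Proof. by rewrite !vscaleE /op !scalerA scal_central. Qed.
Lemma op_sum g (I : Type) (s : seq I) (P : pred I) (w : I -> vsp V) :
  op g (\sum_(i <- s | P i) w i) = \sum_(i <- s | P i) op g (w i).
Proof. exact: (@scaler_sumr _ V). Qed.

Definition opL := (opD, opN, op0, opZ).

Fact op_linear g : linear (@op V g).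
Proof. by move=> c v w; rewrite opD opZ. Qed.
HB.instance Definition _ g :=
  GRing.isLinear.Build F (vsp V) (vsp V) *:%R (@op V g) (op_linear g).

(** Evaluates a formal expression as an operator, so that a defining relation unfolds by computation
    to an identity between compositions of the [op g]. *)
Fixpoint act (t : pterm F sgen) (v : vsp V) : vsp V :=
  match t with
  | PIn c => c *: v
  | PGen g => op g v
  | PAdd s t => act s v + act t v
  | PMul s t => act s (act t v)
  end.

Lemma actE t v : act t v = peval (scal q) (sgenE q) t *: (v : V).
Proof.
elim: t v => //= s hs t ht v; first by rewrite hs ht scalerDl.
by rewrite ht hs scalerA.
Qed.

Lemma act_rel s t v : Sq_rel q s t -> act s v = act t v.
Proof. by move=> /Sq_relP h; rewrite !actE h. Qed.

Lemma opCC g v : op GC (op g v) = op g (op GC v).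
Proof. exact: (act_rel v (Sq_Ccentral q g)). Qed.
Lemma opKKi v : op GK (op GKi v) = v.
Proof. by have := act_rel v (Sq_KKi q); rewrite /= scale1r. Qed.
Lemma opKiK v : op GKi (op GK v) = v.
Proof. by have := act_rel v (Sq_KiK q); rewrite /= scale1r. Qed.
Lemma opKE v : op GK (op GE v) = q ^+ 2 *: op GE (op GK v).
Proof. by have := act_rel (op GK v) (Sq_KE q); rewrite /= opKiK. Qed.
Lemma opKF v : op GK (op GF v) = q ^- 2 *: op GF (op GK v).
Proof. by have := act_rel (op GK v) (Sq_KF q); rewrite /= opKiK. Qed.
Lemma opKX v : op GK (op GX v) = q *: op GX (op GK v).
Proof. by have := act_rel (op GK v) (Sq_KX q); rewrite /= opKiK. Qed.
Lemma opKY v : op GK (op GY v) = q^-1 *: op GY (op GK v).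
Proof. by have := act_rel (op GK v) (Sq_KY q); rewrite /= opKiK. Qed.
Lemma opEF v : op GE (op GF v) =
  op GF (op GE v) + (q - q^-1)^-1 *: (op GK v - op GKi v).
Proof.
have := act_rel v (Sq_EF q); rewrite /= !scaleN1r => <-.
by rewrite addrC subrK.
Qed.
Lemma opXY v : op GX (op GY v) = q *: op GY (op GX v) - op GC v.
Proof.
have := act_rel v (Sq_YX q); rewrite /= !scaleN1r => <-.
by rewrite opprB addrC subrK.
Qed.
Lemma opEX v : op GE (op GX v) = q *: op GX (op GE v).
Proof. exact: (act_rel v (Sq_EX q)). Qed.
Lemma opEY v : op GE (op GY v) = op GX v + q^-1 *: op GY (op GE v).
Proof. exact: (act_rel v (Sq_EY q)). Qed.
Lemma opFX v : op GF (op GX v) = op GY (op GKi v) + op GX (op GF v).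
Proof. exact: (act_rel v (Sq_FX q)). Qed.
Lemma opFY v : op GF (op GY v) = op GY (op GF v).
Proof. exact: (act_rel v (Sq_FY q)). Qed.

Lemma opXF v : op GX (op GF v) = op GF (op GX v) - op GY (op GKi v).
Proof. by rewrite opFX addrC addKr. Qed.
Lemma opKi_eigen m v : m != 0 -> op GK v = m *: v -> op GKi v = m^-1 *: v.
Proof.
move=> m0 h; have : op GKi (op GK v) = op GKi (m *: v) by rewrite h.
by rewrite opKiK opZ => {2}->; rewrite scalerA mulVf // scale1r.
Qed.

Lemma submodule_gen (U : V -> Prop) :
  U 0 -> (forall u v, U u -> U v -> U (u + v)) ->
  (forall c (u : vsp V), U u -> U (c *: u)) ->
  (forall g (u : vsp V), U u -> U (op g u)) -> submodule U.
Proof.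
move=> h0 hD hZ hg; split=> // a; elim/pres_ind: a; elim=> //.
- by move=> s hs t ht u hu; rewrite pres_piD scalerDl; apply: hD; auto.
- by move=> s hs t ht u hu; rewrite pres_piM -scalerA; auto.
Qed.

Lemma submodule_op (U : V -> Prop) : submodule U ->
  [/\ submodule (U : vsp V -> Prop) & forall g (u : vsp V), U u -> U (op g u)].
Proof. by case=> h0 hD hZ; split=> [|g u]; [split=> // c u|]; exact: hZ. Qed.

Lemma simple_full (U : V -> Prop) (v : V) :
  simple_module V -> submodule U -> U v -> v <> 0 -> forall w, U w.
Proof. by case=> _ h /h [h0|//] /h0. Qed.

End Operators.

(** * Annihilation of eigenvectors *)

Section Kill.
Variables (F : fieldType) (V : lmodType F) (A : {linear V -> V}).

(** The product of the operators A - a for a in [s]. It replaces projections to eigenspaces: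
    annihilating the unwanted eigenvalues keeps a nonzero multiple of the eigenvector that is
    wanted. *)
Definition kill (s : seq F) (v : V) : V := foldr (fun a u => A u - a *: u) v s.

Lemma kill_cons a s v : kill (a :: s) v = A (kill s v) - a *: kill s v.
Proof. by []. Qed.

Lemma kill_cat s t v : kill (s ++ t) v = kill s (kill t v).
Proof. exact: foldr_cat. Qed.

Lemma killP s c u v : kill s (c *: u + v) = c *: kill s u + kill s v.
Proof.
elim: s => // a s ih; rewrite !kill_cons ih (linearP A).
by vect (F : pzRingType); ring.
Qed.
Lemma kill0 s : kill s 0 = 0.
Proof. by have := killP s (-1) 0 0; rewrite !scaleN1r !addNr. Qed.
Lemma killZ s c v : kill s (c *: v) = c *: kill s v.
Proof. by have := killP s c v 0; rewrite kill0 !addr0. Qed.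
Lemma killD s u v : kill s (u + v) = kill s u + kill s v.
Proof. by have := killP s 1 u v; rewrite !scale1r. Qed.
Lemma kill_sum s (I : Type) (r : seq I) (P : pred I) (w : I -> V) :
  kill s (\sum_(i <- r | P i) w i) = \sum_(i <- r | P i) kill s (w i).
Proof. exact: (big_morph _ (killD s) (kill0 s)). Qed.

Lemma killC1 a s v : kill s (A v - a *: v) = A (kill s v) - a *: kill s v.
Proof.
elim: s => // b s ih; rewrite !kill_cons ih !(linearB A) !(linearZ_LR A).
by vect (F : pzRingType); ring.
Qed.

Lemma killC s t v : kill s (kill t v) = kill t (kill s v).
Proof. by elim: t => // a t ih; rewrite !kill_cons killC1 ih. Qed.

Lemma kill_eigen s a v :
  A v = a *: v -> kill s v = (\prod_(b <- s) (a - b)) *: v.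
Proof.
move=> h; elim: s => [|b s ih]; first by rewrite big_nil scale1r.
by rewrite kill_cons ih (linearZ_LR A) h big_cons; vect (F : pzRingType); ring.
Qed.

Lemma kill_eigen0 s a v : A v = a *: v -> a \in s -> kill s v = 0.
Proof.
move=> h has; rewrite (kill_eigen s h) [X in X *: _](_ : _ = 0) ?scale0r //.
by rewrite (big_rem a) //= subrr mul0r.
Qed.

Lemma kill_eigen_neq0 s a v :
  A v = a *: v -> a \notin s -> kill s v = 0 -> v = 0.
Proof.
move=> h has; rewrite (kill_eigen s h) => /eqP; rewrite scaler_eq0.
case/orP=> /eqP // /eqP; rewrite prodf_seq_eq0 => /hasP [b hb /=].
by rewrite subr_eq0 => /eqP e; rewrite e hb in has.
Qed.

Lemma kill0_cat s t v : kill s v = 0 -> kill (s ++ t) v = 0.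
Proof. by move=> h; rewrite kill_cat killC h kill0. Qed.

End Kill.

(** * Bases and isomorphisms *)

Section Bases.
Variables (F : fieldType) (q : F).

Definition in_span (V : lmodType F) (I : eqType) (e : I -> V) (v : V) : Prop :=
  exists (s : seq I) (c : I -> F), v = \sum_(i <- s) c i *: e i.

(** The multiplicity of a repeated index is absorbed into its coefficient; freeness only speaks of
    lists without repetition. *)
Lemma in_span_uniq (V : lmodType F) (I : eqType) (e : I -> V) v :
  in_span e v -> exists (s : seq I) (c : I -> F),
    uniq s /\ v = \sum_(i <- s) c i *: e i.
Proof.
case=> s [c ->].
exists (undup s), (fun i => (count_mem i s)%:R * c i); split.
  exact: undup_uniq.
rewrite -big_undup_iterop_count /=; apply: eq_bigr => i _ /=.
elim: (count_mem i s) => [|n ih]; first by rewrite mul0r scale0r.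
case: n ih => [|n] ih; first by rewrite /= mul1r.
rewrite -[LHS]/(c i *: e i + iterop n.+1 +%R (c i *: e i) 0) ih.
by rewrite -(natr1 n.+1); vect (F : pzRingType); ring.
Qed.

Lemma sum_extend (V : lmodType F) (I : eqType) (e : I -> V) (s t : seq I)
    (c : I -> F) : uniq s -> uniq t -> {subset s <= t} ->
  \sum_(i <- s) c i *: e i =
  \sum_(i <- t) (if i \in s then c i else 0) *: e i.
Proof.
move=> us ut st.
rewrite [RHS](eq_bigr (fun i => if i \in s then c i *: e i else 0)); last first.
  by move=> i _; case: ifP; rewrite ?scale0r.
rewrite -big_mkcond -big_filter; apply: perm_big.
apply: uniq_perm => //; first exact: filter_uniq.
by move=> i; rewrite mem_filter; case: (boolP (i \in s)) => // /st->.
Qed.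

Lemma in_span_submodule (V : lmodType F) (I : eqType) (e : I -> V) :
  submodule (in_span e).
Proof.
split; first by exists [::], (fun=> 0); rewrite big_nil.
  move=> u v /in_span_uniq [s [c [us ->]]] /in_span_uniq [t [d [ut ->]]].
  set r := undup (s ++ t); have ur : uniq r := undup_uniq _.
  rewrite (sum_extend e c us ur); last first.
    by move=> i hi; rewrite mem_undup mem_cat hi.
  rewrite (sum_extend e d ut ur); last first.
    by move=> i hi; rewrite mem_undup mem_cat hi orbT.
  rewrite -big_split /=; eexists r, _; apply: eq_bigr => i _.
  by rewrite -scalerDl; reflexivity.
move=> a u [s [c ->]]; exists s, (fun i => a * c i).
by rewrite scaler_sumr; apply: eq_bigr => i _; rewrite scalerA.
Qed.

Lemma in_span_base (V : lmodType F) (I : eqType) (e : I -> V) i :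
  in_span e (e i).
Proof. by exists [:: i], (fun=> 1); rewrite big_seq1 scale1r. Qed.

Definition is_free (V : lmodType F) (I : eqType) (e : I -> V) : Prop :=
  forall (s : seq I) (c : I -> F), uniq s ->
    \sum_(i <- s) c i *: e i = 0 -> forall i, i \in s -> c i = 0.

End Bases.

(** * Families generated by F and Y *)

(** Suited to families on which Y shifts k: the step up applies Y, the step down cancels Y by
    injectivity. *)
Lemma int_shift_ind (P : int -> Prop) :
  P 0 -> (forall k, P k -> P (k + 1)) -> (forall k, P (k + 1) -> P k) ->
  forall k, P k.
Proof.
move=> h0 hS hP; elim/int_rec => // n ih.
  by rewrite -addn1 PoszD; apply: hS.
by apply: hP; rewrite (_ : - n.+1%:Z + 1 = - n%:Z) //; lia.
Qed.

(** * Powers of a parameter that is not a root of unity *)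

Section Generic.
Variables (F : fieldType) (q : F).
Hypothesis hq : generic q.

Lemma gen_neq0 : q != 0. Proof. by case: hq. Qed.
Lemma gen_sub1 : q - 1 != 0.
Proof. by case: hq => _ /(_ 1%N isT); rewrite expr1 subr_eq0. Qed.
Lemma gen_sqr : q ^+ 2 - 1 != 0.
Proof. by case: hq => _ /(_ 2%N isT); rewrite subr_eq0. Qed.
Lemma gen_sqr' : 1 - q ^+ 2 != 0.
Proof. by rewrite -opprB oppr_eq0 gen_sqr. Qed.
Lemma gen_mul : q * q - 1 != 0. Proof. by rewrite -expr2 gen_sqr. Qed.
Lemma gen_mul' : 1 - q * q != 0. Proof. by rewrite -expr2 gen_sqr'. Qed.
Lemma gen_add1 : q + 1 != 0.
Proof.
apply: contra gen_sqr => /eqP h; apply/eqP.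
have -> : q ^+ 2 - 1 = (q + 1) * (q - 1) by ring.
by rewrite h mul0r.
Qed.
Lemma gen_quant : q - q^-1 != 0.
Proof.
apply: contra gen_mul => /eqP h; apply/eqP.
by rewrite -[1](divff gen_neq0) -mulrBr h mulr0.
Qed.
Lemma gen_pow (k : int) : q ^ k = 1 -> k = 0.
Proof.
case: k => n h; case: (posnP n) => [->//|n0].
- by case: hq => _ /(_ _ n0) /eqP [].
- have := hq.2 n.+1 isT; rewrite NegzE -invr_expz in h.
  by move/eqP: h; rewrite invr_eq1 => /eqP h /eqP [].
- have := hq.2 n.+1 isT; rewrite NegzE -invr_expz in h.
  by move/eqP: h; rewrite invr_eq1 => /eqP h /eqP [].
Qed.
Lemma gen_pow_inj (k l : int) : q ^ k = q ^ l -> k = l.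
Proof.
move=> h; apply/eqP; rewrite -subr_eq0; apply/eqP/gen_pow.
by rewrite expfzDr ?gen_neq0 // -invr_expz h mulfV // expfz_neq0 ?gen_neq0.
Qed.
Lemma gen_pown_inj (m n : nat) : q ^+ m = q ^+ n -> m = n.
Proof. by move=> h; have /gen_pow_inj [] : q ^ m%:Z = q ^ n%:Z. Qed.

End Generic.

(** Splits powers of q at the sums in their exponents. The powers that remain are then generalized
    to nonzero variables, and [field] sees a rational identity. *)
Ltac qpow q0 := rewrite ?(expfzDr _ _ q0) -?invr_expz -?exprnP ?expr1z ?expr0z.
Ltac qfield hq :=
  field; rewrite ?(gen_sub1 hq) ?(gen_sqr hq) ?(gen_sqr' hq) ?(gen_mul hq)
    ?(gen_mul' hq) ?(gen_add1 hq) ?(gen_quant hq) ?(gen_neq0 hq) ?oner_neq0.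

(** * The action of S_q on a family of eigenvectors of H *)

Section Family.
Variables (F : fieldType) (q : F) (hq : generic q).
Variables (V : lmodType (Sq q)) (z : F).
Local Notation W := (vsp V).
Hypothesis hC : forall v : W, op GC v = z *: v.
Hypothesis Yinj : injective (fun v : W => op GY v).

Let q0 := gen_neq0 hq.
Local Notation zeta := (z / (q - 1)).

Section EFamily.
Variables (mu h : F) (e : int -> nat -> W).
Hypotheses (mu0 : mu != 0) (h0 : h != 0).

(* With an inverse of Y, the relation [eF] below reads
     e k j = Y^k \prod_(i < j) (F Y^-2 - etau q^(2i)) (e 0 0) :
   [etau] is the value that makes each [e k j] an eigenvector of Y X - zeta. *)
Definition etau : F := mu^-1 / ((1 - q ^+ 2) * h).
(** The diagonal coefficient of E at an eigenvalue x of H, determined by [H_raise]. For nonzero x it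
    is q (x + zeta) (x + q zeta) / (x (q^2 - 1)); its zeros - zeta and - q zeta are what bounds
    highest weight modules from below. *)
Definition ediag (x : F) : F :=
  (q * x + (q ^+ 2 + q) * zeta + q ^+ 2 * zeta ^+ 2 / x) / (q ^+ 2 - 1).
(** The coefficient of [e (k - 2) j.-1] in E [e k j], up to q^k. It vanishes at j = 0; [elow_eq0]
    gives its other zeros. *)
Definition elow (j : nat) : F :=
  q ^+ 2 * (((q ^+ j) ^+ 2 - 1) / (q ^+ 2 - 1)) *
  (mu / (q - q^-1) +
   mu^-1 * zeta ^+ 2 / (1 - q ^+ 2) / h ^+ 2 * ((q ^+ j) ^+ 2 / q ^+ 2)).

Hypothesis eY : forall k j, op GY (e k j) = e (k + 1) j.
Hypothesis eF : forall k j,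
  op GF (e k j) = e (k + 2) j.+1 + (etau * (q ^+ j) ^+ 2) *: e (k + 2) j.
Hypothesis eK0 : op GK (e 0 0) = mu *: e 0 0.
Hypothesis eX0 : op GX (e 0 0) = (h + zeta) *: e (-1) 0.
Hypothesis eE0 : op GE (e 0 0) = ediag h *: e (- 2) 0.

Let eFs k j : e k j.+1 = op GF (e (k - 2) j) - (etau * (q ^+ j) ^+ 2) *: e k j.
Proof. by rewrite eF (_ : k - 2 + 2 = k) ?addrK //; lia. Qed.

Lemma eK k j : op GK (e k j) = (mu / q ^ k) *: e k j.
Proof.
elim: j k => [|j ih] k.
  elim/int_shift_ind: k => [|k ih|k ih].
  - by rewrite expr0z invr1 mulr1.
  - rewrite -eY opKY ih opZ scalerA; congr (_ *: _).
    have x0 := expfz_neq0 k q0; qpow q0; move: (q ^ k) x0 => x x0.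
    by qfield hq; rewrite x0.
  - apply: Yinj; rewrite opZ eY.
    have := opKY (e k 0); rewrite eY ih => /(congr1 (fun v => q *: v)).
    rewrite !scalerA mulfV // scale1r => <-; congr (_ *: _).
    have x0 := expfz_neq0 k q0; qpow q0; move: (q ^ k) x0 => x x0.
    by qfield hq; rewrite x0.
rewrite eFs opB opZ opKF !ih opZ !scalerA scalerBr !scalerA.
congr (_ *: _ - _ *: _); last by rewrite mulrC.
have x0 := expfz_neq0 k q0; qpow q0; move: (q ^ k) x0 => x x0.
by qfield hq; rewrite x0.
Qed.

Lemma eKi k j : op GKi (e k j) = (q ^ k / mu) *: e k j.
Proof.
rewrite (opKi_eigen _ (eK k j)) ?invf_div //.
by rewrite mulf_neq0 // invr_neq0 // expfz_neq0.
Qed.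

Lemma eX k j : op GX (e k j) = (h * q ^ k / (q ^+ j) ^+ 2 + zeta) *: e (k - 1) j.
Proof.
elim: j k => [|j ih] k.
  elim/int_shift_ind: k => [|k ih|k ih].
  - by rewrite expr0z expr0 eX0 expr1n sub0r divr1 mulr1.
  - rewrite -eY opXY hC ih opZ eY subrK (_ : k + 1 - 1 = k) ?addrK //.
    rewrite scalerA; vect (F : pzRingType).
    by qpow q0; rewrite expr0; move: (q ^ k) => x; qfield hq.
  - apply: Yinj; rewrite opZ eY subrK.
    have := opXY (e k 0); rewrite eY ih hC addrK.
    move=> /(congr1 (fun v => q^-1 *: (v + z *: e k 0))).
    rewrite subrK !scalerA mulVf // scale1r => <-; vect (F : pzRingType).
    by qpow q0; rewrite expr0; move: (q ^ k) => x; qfield hq.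
rewrite !eFs opB opZ opXF !ih !opZ eKi opZ eY.
have -> : k - 2 - 1 = k - 1 - 2 by lia.
have -> : k - 2 + 1 = k - 1 by lia.
vect (F : pzRingType); have x0 := expfz_neq0 k q0; have y0 := expf_neq0 j q0;
  qpow q0; rewrite /etau (exprS q j); move: (q ^ k) (q ^+ j) x0 y0 => x y x0 y0;
  by qfield hq; rewrite ?x0 ?y0 ?mu0 ?h0.
Qed.

Lemma eE k j : op GE (e k j) =
  ediag (h * q ^ k / (q ^+ j) ^+ 2) *: e (k - 2) j
  + (elow j / q ^ k) *: e (k - 2) j.-1.
Proof.
elim: j k => [|j ih] k.
  have -> : elow 0 = 0 by rewrite /elow expr0 expr1n subrr !(mul0r, mulr0).
  rewrite mul0r scale0r addr0.
  elim/int_shift_ind: k => [|k ih|k ih].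
  - by rewrite expr0z expr0 eE0 expr1n sub0r divr1 mulr1.
  - rewrite -eY opEY ih opZ eY eX (_ : k - 2 + 1 = k - 1); last by lia.
    rewrite (_ : k + 1 - 2 = k - 1); last by lia.
    vect (F : pzRingType); rewrite /ediag.
    have x0 := expfz_neq0 k q0; qpow q0; rewrite expr0.
    by move: (q ^ k) x0 => x x0; qfield hq; rewrite ?x0 ?h0.
  - apply: Yinj; rewrite opZ eY.
    have := opEY (e k 0); rewrite eY ih eX.
    pose a := h * q ^ k / (q ^+ 0) ^+ 2 + zeta.
    move=> /(congr1 (fun v => q *: (v - a *: e (k - 1) 0))); rewrite /a.
    rewrite [X in _ = q *: X]addrAC subrr add0r !scalerA mulfV // scale1r => <-.
    rewrite (_ : k - 2 + 1 = k - 1); last by lia.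
    rewrite (_ : k + 1 - 2 = k - 1); last by lia.
    vect (F : pzRingType); rewrite /ediag.
    have x0 := expfz_neq0 k q0; qpow q0; rewrite expr0.
    by move: (q ^ k) x0 => x x0; qfield hq; rewrite ?x0 ?h0.
rewrite eFs opB opZ opEF !ih opD !opZ eK eKi.
rewrite (eF (k - 2 - 2)) (_ : k - 2 - 2 + 2 = k - 2) /=; last by lia.
(* For j > 0 this is [eF] at j - 1. At j = 0 the truncated [j.-1] is harmless because
   [elow 0 = 0]. *)
have -> c : (elow j / c) *: op GF (e (k - 2 - 2) j.-1) = (elow j / c) *:
    (e (k - 2) j + (etau * ((q ^+ j) ^+ 2 / q ^+ 2)) *: e (k - 2) j.-1).
  case: j {ih} => [|j].
    by rewrite /elow expr0 expr1n subrr !(mul0r, mulr0) !scale0r.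
  rewrite eF (_ : k - 2 - 2 + 2 = k - 2) /=; last by lia.
  congr (_ *: (_ + _ *: _)); rewrite (exprS q j); have y0 := expf_neq0 j q0.
  by move: (q ^+ j) y0 => y y0; qfield hq.
have x0 := expfz_neq0 k q0; have y0 := expf_neq0 j q0.
vect (F : pzRingType); qpow q0; rewrite /etau /elow /ediag (exprS q j);
  move: (q ^ k) (q ^+ j) x0 y0 => x y x0 y0; 
  by qfield hq; rewrite ?x0 ?y0 ?mu0 ?h0.
Qed.

(** E is applied to the zero vector [e 2 d]: in its expansion only [elow d] times the nonzero vector
    [e 0 d.-1] is left. *)
Lemma elow0 d : (0 < d)%N -> (forall k, e k d = 0) -> e 0 d.-1 <> 0 ->
  elow d = 0.
Proof.
move=> d0 ed ne; have := eE 2 d; rewrite !ed op0 scaler0 add0r subrr.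
move/esym/eqP; rewrite scaler_eq0 mulf_eq0 invr_eq0 (negbTE (expfz_neq0 _ q0)).
by rewrite orbF => /orP [/eqP|/eqP].
Qed.

End EFamily.
End Family.

(** * The q-binomial theorem *)

Section QBinomial.
Variables (F : fieldType) (q : F).
Hypothesis hq : generic q.
Let q0 := gen_neq0 hq.

Lemma qnum_neq0 n : (0 < n)%N -> qnum q n != 0.
Proof.
move=> n0; rewrite mulf_neq0 ?invr_neq0 ?(gen_quant hq) //.
have hn : q ^+ n != 0 by rewrite expf_neq0.
apply/eqP => h; have : q ^+ n * (q ^+ n - q ^- n) = 0 by rewrite h mulr0.
rewrite mulrBr mulfV // -exprD => /eqP; rewrite subr_eq0 => /eqP h2.
by case: hq => _ /(_ (n + n)%N); rewrite h2 addn_gt0 n0 eqxx => /(_ isT).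
Qed.

Lemma qbinom_gt m i : (m < i)%N -> qbinom q m i = 0.
Proof.
move=> h; rewrite /qbinom (bigD1 (Ordinal h)) //= subnn /qnum expr0 invr1.
by rewrite subrr !mul0r.
Qed.

Lemma qbinom0 m : qbinom q m 0 = 1.
Proof. by rewrite /qbinom !big_ord0 divr1. Qed.

Lemma qbinomnn m : qbinom q m m = 1.
Proof.
rewrite /qbinom (reindex_inj rev_ord_inj) /=.
rewrite (eq_bigr (fun j : 'I_m => qnum q j.+1)) ?divff //.
  by apply/prodf_neq0 => j _; apply: qnum_neq0.
by move=> i _; congr (qnum q _); have := ltn_ord i; lia.
Qed.

Lemma qbinom_pascal m i : (i <= m)%N ->
  qbinom q m.+1 i.+1 =
  (q ^+ (m - i))^-1 * qbinom q m i + q ^+ i.+1 * qbinom q m i.+1.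
Proof.
move=> im; rewrite /qbinom [in RHS]big_ord_recr /= big_ord_recl /=.
rewrite [X in _ / X]big_ord_recr /= [in RHS]big_ord_recr /=.
rewrite (eq_bigr (fun j : 'I_i => qnum q (m - j))) //.
set P := \prod_(j < i) qnum q (m - j); set D := \prod_(j < i) qnum q j.+1.
have D0 : D != 0 by apply/prodf_neq0 => j _; apply: qnum_neq0.
have n0 : qnum q i.+1 != 0 by exact: qnum_neq0.
rewrite subn0.
have -> : qnum q m.+1 = (q ^+ (m - i))^-1 * qnum q i.+1
                        + q ^+ i.+1 * qnum q (m - i).
  rewrite -[m in LHS](subnK im) /qnum -addnS exprD.
  have x0 := expf_neq0 (m - i) q0; have y0 := expf_neq0 i.+1 q0.
  move: (q ^+ (m - i)) (q ^+ i.+1) x0 y0 => x y x0 y0.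
  by qfield hq; rewrite ?x0 ?y0.
by field; rewrite D0 n0 expf_neq0.
Qed.

(** With F Y^-2 in place of ['X] and a = tau, this is the operator that produces [e k d] from
    [v k 0]. *)
Definition newton (a : F) (d : nat) : {poly F} :=
  \prod_(i < d) ('X - (a * (q ^+ i) ^+ 2)%:P).

Lemma newtonS a d :
  newton a d.+1 = newton a d * ('X - (a * (q ^+ d) ^+ 2)%:P).
Proof. by rewrite /newton big_ord_recr. Qed.

(** The q-binomial theorem, by induction on d with [qbinom_pascal]. As the q-binomials are the
    symmetric ones, the power of q is balanced at d - 1, the mean of the exponents 2 i for i < d. *)
Lemma newton_coef a d i :
  (newton a d)`_i = (- (a * q ^+ d.-1)) ^+ (d - i) * qbinom q d i.
Proof.
elim: d i => [|d ih] i.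
  rewrite /newton big_ord0 coef1; case: i => [|i]; first by rewrite qbinom0 mulr1.
  by rewrite qbinom_gt ?mulr0.
rewrite newtonS mulrBr coefB coefMX coefMC !ih /=.
case: i => [|i] /=.
  rewrite !qbinom0 !subn0; case: d {ih} => [|d] /=.
    by rewrite !expr0 expr1n !mulr1 expr1 sub0r mul1r.
  rewrite sub0r !mulr1 (exprS q d).
  have -> : - (a * (q * q ^+ d)) = q * - (a * q ^+ d) by ring.
  rewrite [in RHS]exprMn !(exprS _ d.+1) (exprS q d).
  by move: (_ ^+ d.+1) => A; ring.
have [im|im] := leqP i d; last first.
  by rewrite subSS !qbinom_gt ?mulr0 ?mul0r ?subr0 ?mulr0 //; lia.
rewrite subSS qbinom_pascal //.
have [->|ni] := eqVneq i d.
  by rewrite subnn (qbinom_gt (ltnSn d)) !(mulr0, mul0r, subr0, addr0) expr0 invr1 !mul1r.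
have {im ni} lt : (i < d)%N by rewrite ltn_neqAle ni.
case: d lt {ih} => // d lt /=.
have -> : (d.+1 - i.+1 = d - i)%N by [].
have -> : (d.+1 - i = (d - i).+1)%N by rewrite subSn.
have -> : q ^+ i.+1 = q ^+ d.+1 / q ^+ (d - i).
  apply: (canRL (mulfK _)); first by rewrite expf_neq0.
  by rewrite -exprD; congr (_ ^+ _); lia.
have -> : - (a * q ^+ d.+1) = - (a * q ^+ d) * q by rewrite exprSr; ring.
rewrite [in RHS]exprMn (exprS q d) (exprS q (d - i)) (exprS _ (d - i)).
have x0 := expf_neq0 (d - i) q0; move: (q ^+ (d - i)) x0 => x x0.
by move: (_ ^+ (d - i)) => A; field; rewrite x0.
Qed.

End QBinomial.

(** The relation [eF] of the previous sections read as a recursion on j. Passing from k to k - 2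
    plays the part of Y^-2, so the definition makes sense without an inverse of Y. *)
Fixpoint efam (F : fieldType) (q : F) (V : lmodType (Sq q)) (tau : F)
    (v : int -> nat -> vsp V) (k : int) (j : nat) : vsp V :=
  if j is j'.+1 then
    op GF (efam tau v (k - 2) j') - (tau * (q ^+ j') ^+ 2) *: efam tau v k j'
  else v k 0%N.

Section Efam.
Variables (F : fieldType) (q : F) (V : lmodType (Sq q)) (tau : F).
Variable v : int -> nat -> vsp V.

Lemma efamS k j : efam tau v k j.+1 =
  op GF (efam tau v (k - 2) j) - (tau * (q ^+ j) ^+ 2) *: efam tau v k j.
Proof. by []. Qed.

Lemma efam_opF k j : op GF (efam tau v k j) =
  efam tau v (k + 2) j.+1 + (tau * (q ^+ j) ^+ 2) *: efam tau v (k + 2) j.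
Proof. by rewrite efamS subrK addrK. Qed.

Lemma efam_opY : (forall k l, op GY (v k l) = v (k + 1) l) ->
  forall k j, op GY (efam tau v k j) = efam tau v (k + 1) j.
Proof.
move=> vY k j; elim: j k => [|j ih] k; first exact: vY.
by rewrite !efamS !opL -opFY !ih; have -> : k - 2 + 1 = k + 1 - 2 by lia.
Qed.

End Efam.

(** A - a l maps [v l] to a multiple of [v l.-1], so the factors for l, l - 1, ..., 0 bring it down
    to zero; [c 0 = 0] ends the chain. *)
Lemma kill_triangular (F : fieldType) (V : lmodType F) (A : {linear V -> V})
    (v : nat -> V) (a c : nat -> F) (m : nat) :
  (forall l, (l < m)%N -> A (v l) = a l *: v l + c l *: v l.-1) -> c 0%N = 0 ->
  forall n l, (l < n)%N -> (l < m)%N -> kill A (mkseq a n) (v l) = 0.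
Proof.
move=> hA c0 n l ln; rewrite -(subnKC ln) /mkseq iotaD map_cat => lm.
apply: kill0_cat; elim: l {n ln} lm => [|l ih] lm.
  by rewrite /= hA // c0 scale0r addr0 subrr.
rewrite -addn1 iotaD map_cat kill_cat.
have -> : kill A [seq a i | i <- iota (0 + l.+1) 1] (v l.+1) =
  A (v l.+1) - a l.+1 *: v l.+1 by [].
rewrite hA // addrAC subrr add0r killZ.
by rewrite (ih (ltnW lm) : kill A _ (v l.+1.-1) = 0) scaler0.
Qed.

(** * The action on the vectors v k l and their independence *)

Section VFamily.
Variables (F : fieldType) (q : F) (hq : generic q).
Variables (V : lmodType (Sq q)) (z b lam : F) (v : int -> nat -> vsp V).
Local Notation W := (vsp V).
Hypotheses (z0 : z != 0) (b0 : b != 0) (lam0 : lam != 0).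
Hypothesis hC : forall v : W, op GC v = z *: v.
Hypothesis Yinj : injective (fun v : W => op GY v).

Let q0 := gen_neq0 hq.
Local Notation zeta := (z / (q - 1)).

Hypothesis vY : forall k l, op GY (v k l) = v (k + 1) l.
Hypothesis vF : forall k l, op GF (v k l) = v k l.+1.
Hypothesis vK0 : op GK (v 0 0) = (lam / b) *: v 0 0.
Hypothesis vX0 : op GX (v 0 0) = (zeta * (1 - b)) *: v (-1) 0.
Hypothesis vE0 : op GE (v 0 0) =
  ((q + q ^+ 2 - b^-1 * q ^+ 2 - b * q) / (q ^+ 2 - 1) * zeta) *: v (- 2) 0.

Let zeta0 : zeta != 0.
Proof. by rewrite mulf_neq0 // invr_neq0 // gen_sub1. Qed.

(** The values of K, X and E at [v 0 0] determine these operators on all [v k l]: the relations with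
    Y move k up, injectivity of Y moves k down, and the relations with F raise l. The same pattern
    proves [vX] and [vE]. *)
Lemma vK k l : op GK (v k l) = (lam * b^-1 * q ^ (- k - 2 * l%:Z)) *: v k l.
Proof.
elim: l k => [|l ih] k.
  rewrite mulr0 subr0; elim/int_shift_ind: k => [|k ih|k ih].
  - by rewrite oppr0 expr0z mulr1.
  - rewrite -vY opKY ih opZ scalerA opprD; congr (_ *: _).
    by qpow q0; rewrite mulrC !mulrA.
  - apply: Yinj; rewrite opZ vY.
    have := opKY (v k 0); rewrite vY ih => /(congr1 (fun v => q *: v)).
    rewrite !scalerA mulfV // scale1r => <-; congr (_ *: _).
    by rewrite opprD; qpow q0; rewrite mulrC -!mulrA mulVf ?mulr1.
rewrite -vF opKF ih opZ scalerA; congr (_ *: _).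
have -> : - k - 2 * l.+1%:Z = - k - 2 * l%:Z - 2 by lia.
by qpow q0; rewrite mulrC !mulrA.
Qed.

Lemma vKi k l :
  op GKi (v k l) = (lam^-1 * b * (q ^ k * (q ^+ l) ^+ 2)) *: v k l.
Proof.
rewrite (opKi_eigen _ (vK k l)); last first.
  by rewrite !mulf_neq0 ?invr_neq0 // expfz_neq0.
congr (_ *: _); rewrite !invfM invrK; congr (_ * _).
rewrite invr_expz opprB opprK addrC; qpow q0; congr (_ * _).
by rewrite -exprM mulnC.
Qed.

Lemma vX k l : op GX (v k l) =
  (- z * ((b * q ^ k - 1) / (q - 1))) *: v (k - 1) l
  - (lam^-1 * b * q ^ (k + l%:Z - 1) * qnum q l) *: v (k + 1) l.-1.
Proof.
elim: l k => [|l ih] k.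
  rewrite (_ : qnum q 0 = 0) ?mulr0 ?scale0r ?subr0; last first.
    by rewrite /qnum expr0 invr1 subrr mul0r.
  elim/int_shift_ind: k => [|k ih|k ih].
  - rewrite expr0z vX0 sub0r; congr (_ *: _); by qfield hq.
  - rewrite -vY opXY hC ih opZ vY subrK addrK.
    vect (F : pzRingType).
    by qpow q0; move: (q ^ k) => x; qfield hq.
  - apply: Yinj; rewrite opZ vY subrK.
    have := opXY (v k 0); rewrite vY ih hC addrK.
    move=> /(congr1 (fun w => q^-1 *: (w + z *: v k 0))).
    rewrite subrK !scalerA mulVf // scale1r => <-; vect (F : pzRingType).
    by qpow q0; move: (q ^ k) => x; qfield hq.
rewrite -vF opXF ih !opL !vF vKi opZ vY /=.
(* [l.-1.+1] differs from [l] only at l = 0, where the coefficient contains [qnum q 0 = 0]. *)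
have -> : (lam^-1 * b * q ^ (k + l%:Z - 1) * qnum q l) *: v (k + 1) l.-1.+1 =
  (lam^-1 * b * q ^ (k + l%:Z - 1) * qnum q l) *: v (k + 1) l.
  case: l {ih} => // ; rewrite /qnum expr0 invr1 subrr mul0r mulr0.
  by rewrite !scale0r.
have x0 := expfz_neq0 k q0; have y0 := expf_neq0 l q0.
have -> : k + l.+1%:Z - 1 = k + l%:Z by lia.
vect (F : pzRingType); rewrite /qnum ?(exprS q l); qpow q0;
  move: (q ^ k) (q ^+ l) x0 y0 => x y x0 y0;
  by qfield hq; rewrite ?x0 ?y0 ?lam0.
Qed.

Lemma vE k l : op GE (v k l) =
  ((lam * b^-1 * q ^ (1 - k - l%:Z) - lam^-1 * b * q ^ (k + l%:Z - 1))
     / (q - q^-1) * qnum q l) *: v k l.-1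
  - ((q + q ^+ 2 - b^-1 * q ^ (2 - k) - b * q ^ (k + 1))
       / ((1 - q ^+ 2) * (q - 1)) * z) *: v (k - 2) l.
Proof.
elim: l k => [|l ih] k.
  rewrite (_ : qnum q 0 = 0) ?mulr0 ?scale0r ?sub0r; last first.
    by rewrite /qnum expr0 invr1 subrr mul0r.
  elim/int_shift_ind: k => [|k ih|k ih].
  - rewrite vE0 sub0r oppr0 addr0 add0r expr1z -exprnP -scaleNr.
    by congr (_ *: _); qfield hq; rewrite b0.
  - rewrite -vY opEY ih vX (_ : qnum q 0 = 0) ?mulr0 ?scale0r ?subr0; last first.
      by rewrite /qnum expr0 invr1 subrr mul0r.
    rewrite !opL vY (_ : k - 2 + 1 = k - 1); last by lia.
    rewrite (_ : k + 1 - 2 = k - 1); last by lia.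
    rewrite opprD; vect (F : pzRingType).
    have x0 := expfz_neq0 k q0; qpow q0.
    by move: (q ^ k) x0 => x x0; qfield hq; rewrite ?x0 ?b0.
  - apply: Yinj; rewrite !opL vY.
    have := opEY (v k 0); rewrite vY ih vX (_ : qnum q 0 = 0) ?mulr0 ?scale0r ?subr0; last first.
      by rewrite /qnum expr0 invr1 subrr mul0r.
    set X := _ *: v (k - 1) 0.
    move=> /(congr1 (fun w => q *: (w - X))).
    rewrite [X in _ = q *: X]addrAC subrr add0r !scalerA mulfV // scale1r => <-.
    rewrite /X (_ : k - 2 + 1 = k - 1); last by lia.
    rewrite (_ : k + 1 - 2 = k - 1); last by lia.
    rewrite opprD; vect (F : pzRingType).
    have x0 := expfz_neq0 k q0; qpow q0.
    by move: (q ^ k) x0 => x x0; qfield hq; rewrite ?x0 ?b0.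
rewrite -vF opEF ih !opL !vF vK vKi /=.
have -> : forall c, (c * qnum q l) *: v k l.-1.+1 = (c * qnum q l) *: v k l.
  case: l {ih} => // c; rewrite /qnum expr0 invr1 subrr mul0r mulr0.
  by rewrite !scale0r.
have x0 := expfz_neq0 k q0; have y0 := expf_neq0 l q0.
have -> : 1 - k - l.+1%:Z = - k - l%:Z by lia.
have -> : k + l.+1%:Z - 1 = k + l%:Z by lia.
have -> : - k - 2 * l%:Z = - k - l%:Z - l%:Z by lia.
vect (F : pzRingType); rewrite /qnum ?(exprS q l); qpow q0;
  move: (q ^ k) (q ^+ l) x0 y0 => x y x0 y0;
  by qfield hq; rewrite ?x0 ?y0 ?lam0 ?b0.
Qed.
(** [mu] and [h] are the eigenvalues of K and of H on [v 0 0]; they are the parameters of the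
    diagonalizing family [e]. *)
Let mu := lam / b.
Let h := - (zeta * b).
Let tau := etau q mu h.
Let e := efam tau v.

Let mu0 : mu != 0. Proof. by rewrite mulf_neq0 ?invr_neq0. Qed.
Let h0 : h != 0. Proof. by rewrite oppr_eq0 mulf_neq0. Qed.
Let eY : forall k j, op GY (e k j) = e (k + 1) j := efam_opY tau vY.
Let eF k j : op GF (e k j) = e (k + 2) j.+1 + (tau * (q ^+ j) ^+ 2) *: e (k + 2) j
  := efam_opF tau v k j.

(** tau depends on mu and h only through mu h = - zeta lam, in which b cancels. This is why the
    formula for F is free of b. *)
Lemma efam_tauE : tau = (lam * z * (q + 1))^-1.
Proof.
by rewrite /tau /etau /mu /h; qfield hq; rewrite oppr_eq0 mulf_neq0 ?lam0 ?z0 ?b0.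
Qed.

(** As F raises l and k - 2 stands for Y^-2, one step of the recursion is multiplication by
    ['X - tau q^(2j)] on the coefficients. *)
Lemma efam_expand k j : e k j =
  \sum_(i < j.+1) (newton q tau j)`_i *: v (k - 2 * i%:Z) i.
Proof.
elim: j k => [|j ih] k.
  by rewrite big_ord1 /newton big_ord0 coef1 scale1r /= mulr0 subr0.
rewrite [e _ _]efamS -!/(e _ _) !ih newtonS mulrBr.
rewrite (eq_bigr (fun i : 'I_j.+2 =>
  (newton q tau j * 'X)`_i *: v (k - 2 * i%:Z) i -
  (tau * (q ^+ j) ^+ 2) *: ((newton q tau j)`_i *: v (k - 2 * i%:Z) i)));
  last first.
  move=> i _; rewrite coefB coefMC scalerBl scalerA; congr (_ - _ *: _).
  exact: mulrC.
rewrite big_split /= sumrN -scaler_sumr; congr (_ - _ *: _).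
  rewrite [RHS]big_ord_recl coefMX scale0r add0r op_sum.
  apply: eq_bigr => i _; rewrite coefMX /= opZ vF; congr (_ *: v _ _).
  by rewrite /bump /=; lia.
rewrite [RHS]big_ord_recr /= newton_coef // qbinom_gt // mulr0 scale0r.
by rewrite addr0.
Qed.

Section Action.
Variable d : nat.
Hypotheses (d0 : (0 < d)%N) (ed : forall k, e k d = 0).

(** The zero vector is expanded at the index k + 2 d, where its leading term is [v k d], that is F
    [v k d.-1]. *)
Lemma vF_last k : op GF (v k d.-1) =
  - \sum_(i < d) ((- q ^+ d.-1 / (lam * z * (q + 1))) ^+ (d - i) * qbinom q d i)
      *: v (k + 2 * d%:Z - 2 * i%:Z) i.
Proof.
have := efam_expand (k + 2 * d%:Z) d; rewrite ed big_ord_recr /=.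
rewrite newton_coef // subnn expr0 mul1r addrK vF prednK //.
rewrite qbinomnn //.
rewrite scale1r => /esym/eqP; rewrite addrC addr_eq0 => /eqP ->; congr (- _).
apply: eq_bigr => i _; rewrite newton_coef // efam_tauE.
by congr ((_ ^+ _ * _) *: _); rewrite mulrC mulNr.
Qed.

Lemma v_basis_action : basis_action b z lam d (v : int -> nat -> V).
Proof.
move=> k l ld; split; split.
- exact: vK.
- exact: hC.
- exact: vY.
- case: ifP => hl; first exact: vF.
  have -> : l = d.-1 by lia.
  exact: vF_last.
- exact: vX.
- exact: vE.
Qed.

End Action.

Definition Hop (w : W) : W := op GY (op GX w) - zeta *: w.
Fact Hop_linear : linear Hop.
Proof. by move=> c u w; rewrite /Hop !opL; vect (F : pzRingType); ring. Qed.
HB.instance Definition _ :=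
  GRing.isLinear.Build F W W *:%R Hop Hop_linear.

Lemma Hop_e k j : Hop (e k j) = (h * q ^ k / (q ^+ j) ^+ 2) *: e k j.
Proof.
rewrite /Hop (eX hq hC Yinj mu0 h0 eY eF) //.
- by rewrite opZ eY subrK; vect (F : pzRingType); ring.
- by rewrite vX0; congr (_ *: _); rewrite /h; ring.
Qed.

Lemma Hop_v k l : Hop (v k l) = (h * q ^ k) *: v k l -
  (lam^-1 * b * q ^ (k + l%:Z - 1) * qnum q l) *: v (k + 2) l.-1.
Proof.
rewrite /Hop vX !opL !vY subrK (_ : k + 1 + 1 = k + 2); last by lia.
vect (F : pzRingType); rewrite /h; by qfield hq; rewrite ?lam0.
Qed.

(** K separates the vectors by k + 2 l. Among those with equal k + 2 l, H is triangular with
    distinct diagonal entries, and [v] differs from the eigenvector [e] by terms with smaller l. *)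
Lemma v_free d : (forall j, (j < d)%N -> e 0 j <> 0) ->
  is_free (fun kl : int * 'I_d => v kl.1 kl.2).
Proof.
move=> ne s c us hs.
pose wt (i : int * 'I_d) := i.1 + 2 * (i.2 : nat)%:Z.
(* The induction is on d - l: coefficients with larger l vanish first. *)
suff H m (i : int * 'I_d) : (d - i.2 <= m)%N -> i \in s -> c i = 0 
  by move=> i; apply: H (leqnn _).
elim: m i => [|m ih] i0; first by have := ltn_ord i0.2; lia.
move=> hm hi0.
pose eK1 (n : int) := lam * b^-1 * q ^ (- n).
pose s1 := [seq eK1 (wt i) | i <- s & wt i != wt i0].
have Kv (i : int * 'I_d) : op GK (v i.1 i.2) = eK1 (wt i) *: v i.1 i.2.
  by rewrite vK /eK1 /wt opprD.
pose a l := h * q ^ (wt i0 - 2 * l%:Z).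
pose s2 := mkseq a i0.2.
pose r l := v (wt i0 - 2 * l%:Z) l.
have Hr l : Hop (r l) = a l *: r l +
    - (lam^-1 * b * q ^ (wt i0 - 2 * l%:Z + l%:Z - 1) * qnum q l) *: r l.-1.
  rewrite /r Hop_v scaleNr; congr (_ - _); case: l => [|l].
    by rewrite /qnum expr0 invr1 subrr mul0r mulr0 !scale0r.
  by congr (_ *: v _ _) => /=; lia.
have rn0 : qnum q 0 = 0 by rewrite /qnum expr0 invr1 subrr mul0r.
have Hk n l : (l < n)%N -> kill Hop (mkseq a n) (r l) = 0.
  move=> ln; apply: (kill_triangular (fun l _ => Hr l)) (ln) (ln).
  by rewrite rn0 mulr0 oppr0.
(* [s1] removes the other weights and [s2] the terms with smaller l; those with larger l are zero by
   induction. *)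
have : kill Hop s2 (kill (@op _ _ V GK) s1
    (\sum_(i <- s) c i *: v i.1 i.2)) = 0 by rewrite hs !kill0.
rewrite !kill_sum (bigD1_seq i0) //= big1_seq ?addr0; last first.
  move=> i /andP [ni hi]; rewrite !killZ.
  have [wi|wi] := eqVneq (wt i) (wt i0); last first.
    rewrite (kill_eigen0 (Kv i)) ?kill0 ?scaler0 //.
    by apply: map_f; rewrite mem_filter wi.
  have [li|li|li] := ltngtP i.2 i0.2.
  - rewrite (kill_eigen _ (Kv i)) killZ.
    have -> : v i.1 i.2 = r i.2 by rewrite /r -wi /wt addrK.
    by rewrite Hk // !scaler0.
  - have -> : c i = 0.
      apply: (ih i _ hi); rewrite -ltnS; apply: leq_trans hm.
      exact: ltn_sub2l (ltn_trans li (ltn_ord _)) li.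
    exact: scale0r.
  - case/negP: ni; apply/eqP; move: wi; rewrite /wt li => /addIr e1.
    rewrite (surjective_pairing i) (surjective_pairing i0) e1.
    by congr pair; apply: val_inj.
rewrite !killZ (kill_eigen _ (Kv i0)) killZ scalerA.
have -> : v i0.1 i0.2 = r i0.2 by rewrite /r /wt addrK.
(* The polynomial [newton] is monic and its lower terms are annihilated by [s2], so [v] may be
   replaced by the eigenvector [e]. *)
have -> : kill Hop s2 (r i0.2) = kill Hop s2 (e (wt i0) i0.2).
  rewrite efam_expand kill_sum big_ord_recr /= big1 ?add0r.
    by rewrite killZ newton_coef // subnn expr0 mul1r qbinomnn // scale1r.
  by move=> i _; rewrite killZ (Hk i0.2 i) ?scaler0.
rewrite (kill_eigen _ (Hop_e (wt i0) i0.2)) scalerA => /eqP.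
rewrite scaler_eq0 !mulf_eq0 => /orP [/orP [/orP [/eqP //|]|]|].
- rewrite prodf_seq_eq0 => /hasP [x /mapP [i hi ->]] /=.
  rewrite subr_eq0 => /eqP /(mulfI _) H; exfalso.
  move: hi; rewrite mem_filter => /andP [/eqP []].
  by have /(gen_pow_inj hq) /oppr_inj -> := H (mulf_neq0 lam0 (invr_neq0 b0)).
- rewrite prodf_seq_eq0 => /hasP [x /mapP [l hl ->]] /=.
  rewrite subr_eq0 /a; move: (wt i0) => n; qpow q0.
  rewrite -!mulrA => /eqP /(mulfI h0) /(mulfI (expfz_neq0 _ q0)) /invr_inj.
  rewrite -exprM => /(gen_pown_inj hq) el; move: hl; rewrite mem_iota => hl.
  by exfalso; move: el hl; move: (nat_of_ord i0.2) => j; lia.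
- suff /eqP : e (wt i0) i0.2 <> 0 by move=> /negbTE ->.
  elim/int_shift_ind: (wt i0) => [|k hk|k hk].
  + by apply: ne.
  + by rewrite -eY => h1; apply: hk; apply: Yinj; rewrite h1 op0.
  + by move=> h1; apply: hk; rewrite -eY h1 op0.
Qed.
End VFamily.

(** * Modules with a given action on a basis *)

Section BasisAction.
Variables (F : fieldType) (q : F) (hq : generic q).
Let q0 := gen_neq0 hq.

Lemma qnum0 : qnum q 0 = 0.
Proof. by rewrite /qnum expr0 invr1 subrr mul0r. Qed.

Definition fam (V : Type) (d : nat) (v : int -> nat -> V) (kl : int * 'I_d) : V :=
  v kl.1 kl.2.

Section Span.
Variables (V : lmodType (Sq q)) (b z lam : F) (d : nat) (v : int -> nat -> vsp V).
Hypotheses (b0 : b != 0) (lam0 : lam != 0) (d0 : (0 < d)%N).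
Hypothesis va : basis_action b z lam d (v : int -> nat -> V).
Local Notation U := (in_span (@fam (vsp V) d v)).

Lemma fam_in_span k l : (l < d)%N -> U (v k l).
Proof. by move=> ld; exact: (in_span_base (@fam (vsp V) d v) (k, Ordinal ld)). Qed.

Lemma span_op g (u : vsp V) : U u -> U (op g u).
Proof.
have [U0 UD UZ] := in_span_submodule (@fam (vsp V) d v).
case=> s [c ->]; rewrite op_sum; apply: submodule_sum.
  exact: in_span_submodule.
move=> [k l] _; rewrite opZ /fam /=; apply: (UZ).
have [[vK vC vY] [vF vX vE]] := va k (ltn_ord l).
have UB : forall u w, U u -> U w -> U (u - w).
  by apply: submodule_ext; exact: in_span_submodule.
have ll : (l.-1 < d)%N by exact: leq_ltn_trans (leq_pred l) (ltn_ord l).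
case: g.
- rewrite [op _ _]vC; exact: UZ (fam_in_span _ (ltn_ord l)).
- rewrite [op _ _]vE; apply: (UB); apply: (UZ); exact: fam_in_span.
- rewrite [op _ _]vF; case: ifP => hl; first by apply: fam_in_span; lia.
  rewrite -[- _]add0r; apply: (UB) => //.
  apply: (@submodule_sum _ (vsp V) U); first exact: in_span_submodule.
  by move=> i _; apply: (UZ); apply: fam_in_span.
- rewrite [op _ _]vK; exact: UZ (fam_in_span _ (ltn_ord l)).
- rewrite (opKi_eigen _ (vK : op GK (v k l) = _ *: v k l)).
    exact: UZ (fam_in_span _ (ltn_ord l)).
  by rewrite !mulf_neq0 ?invr_neq0 ?expfz_neq0.
- rewrite [op _ _]vX; apply: (UB); apply: (UZ); exact: fam_in_span.
- rewrite [op _ _]vY; exact: fam_in_span.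
Qed.

Lemma span_submodule : submodule (U : V -> Prop).
Proof.
have [U0 UD UZ] := in_span_submodule (@fam (vsp V) d v).
by apply: (@submodule_gen _ _ V U) => // g u; exact: span_op.
Qed.

End Span.

Section Isomorphism.
Variables (V V' : lmodType (Sq q)) (b z lam : F) (d : nat).
Variables (v : int -> nat -> vsp V) (v' : int -> nat -> vsp V').
Hypotheses (b0 : b != 0) (lam0 : lam != 0) (d0 : (0 < d)%N).
Hypothesis va : basis_action b z lam d (v : int -> nat -> V).
Hypothesis va' : basis_action b z lam d (v' : int -> nat -> V').

Let P : lmodType (Sq q) := (V * V')%type.
Let vv (k : int) (l : nat) : P := (v k l, v' k l).

(** The span of these pairs in the product is the graph of the isomorphism to be built. *)
Lemma basis_action_pair : basis_action b z lam d vv.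
Proof using va va'.
move=> k l ld; have [[vK vC vY] [vF vX vE]] := va k ld.
have [[vK' vC' vY'] [vF' vX' vE']] := va' k ld.
have pE g : sgenE q g *: vv k l = (sgenE q g *: (v k l : V), sgenE q g *: (v' k l : V')).
  by [].
split; split; rewrite pE.
- by rewrite vK vK'.
- by rewrite vC vC'.
- by rewrite vY vY'.
- rewrite vF vF'; case: ifP => // _; rewrite /cact.
  apply: injective_projections => /=.
    by rewrite (raddf_sum fst).
  by rewrite (raddf_sum snd).
- by rewrite vX vX'.
- by rewrite vE vE'.
Qed.

Let G (x : P) : Prop := in_span (@fam (vsp P) d vv) x.

Lemma span_graph (s : seq (int * 'I_d)) (c : int * 'I_d -> F) :
  G (\sum_(i <- s) c i *: fam v i, \sum_(i <- s) c i *: fam v' i).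
Proof.
exists s, c; apply: injective_projections => /=.
  by rewrite (raddf_sum fst).
by rewrite (raddf_sum snd).
Qed.

Lemma graph_fun y : is_free (@fam (vsp V) d v) -> G (0, y) -> y = 0.
Proof.
move=> hfree /in_span_uniq [s [c [us e]]].
have e1 : \sum_(i <- s) c i *: fam v i = 0.
  by have /= := congr1 fst e; rewrite (raddf_sum fst).
have /= -> := congr1 snd e; rewrite (raddf_sum snd) /= big1_seq // => i /andP [_ hi].
by rewrite (hfree s c us e1 i hi); exact: (scale0r (v' i.1 i.2)).
Qed.

Lemma graph_fun' x : is_free (@fam (vsp V') d v') -> G (x, 0) -> x = 0.
Proof.
move=> hfree /in_span_uniq [s [c [us e]]].
have e1 : \sum_(i <- s) c i *: fam v' i = 0.
  by have /= := congr1 snd e; rewrite (raddf_sum snd).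
have /= -> := congr1 fst e; rewrite (raddf_sum fst) /= big1_seq // => i /andP [_ hi].
by rewrite (hfree s c us e1 i hi); exact: (scale0r (v i.1 i.2)).
Qed.

End Isomorphism.

(** The span of the pairs is a submodule of the product. Spanning on each side makes it total in
    both directions and freeness makes it single-valued, so it is the graph of a bijection;
    linearity over [Sq q] is its being a submodule. *)
Lemma isomorphic_of_basis (V V' : lmodType (Sq q)) (b z lam : F) (d : nat)
    (v : int -> nat -> vsp V) (v' : int -> nat -> vsp V') :
  b != 0 -> lam != 0 -> (0 < d)%N ->
  basis_action b z lam d (v : int -> nat -> V) ->
  basis_action b z lam d (v' : int -> nat -> V') ->
  (forall w, in_span (@fam (vsp V) d v) w) -> is_free (@fam (vsp V) d v) ->
  (forall w, in_span (@fam (vsp V') d v') w) -> is_free (@fam (vsp V') d v') ->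
  isomorphic V V'.
Proof.
move=> b0 lam0 d0 va va' sp fr sp' fr'.
pose P : lmodType (Sq q) := (V * V')%type.
pose vv (k : int) (l : nat) : vsp P := (v k l, v' k l).
pose G (x : P) : Prop := in_span (@fam (vsp P) d vv) x.
have [G0 GD GZ] : submodule G.
  exact: (span_submodule b0 lam0 d0 (basis_action_pair va va')).
have GB x y : G x -> G y -> G (x - y) by apply: submodule_ext; split.
have ex x : exists y, G (x, y).
  by case: (sp x) => s [c ->]; eexists; apply: span_graph.
have ex' y : exists x, G (x, y).
  by case: (sp' y) => s [c ->]; eexists; apply: span_graph.
have un x y y' : G (x, y) -> G (x, y') -> y = y'.
  move=> h h'; have /= := GB _ _ h h'.
  rewrite [_ - _](_ : _ = (0, y - y')); last by congr pair; exact: subrr.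
  by move/(graph_fun fr)/eqP; rewrite subr_eq0 => /eqP.
have un' x x' y : G (x, y) -> G (x', y) -> x = x'.
  move=> h h'; have /= := GB _ _ h h'.
  rewrite [_ - _](_ : _ = (x - x', 0)); last by congr pair; exact: subrr.
  by move/(graph_fun' fr')/eqP; rewrite subr_eq0 => /eqP.
have [f hf] := choice ex; have [g hg] := choice ex'.
have fl : linear (f : V -> V').
  move=> a x y; apply: (un (a *: x + y)); first exact: hf.
  exact: (GD (a *: x, a *: (f x : V')) (y, f y) (GZ a (x, f x) (hf x)) (hf y)).
pose fL := GRing.isLinear.Build (Sq q) V V' *:%R f fl.
pose fl' : {linear V -> V'} := HB.pack f fL.
exists fl'; exists g => [x|y] /=.
  by apply: (un' _ _ (f x)).
by apply: (un (g y)).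
Qed.

(** All coefficients depend on b and k only through b q^k. *)
Lemma basis_action_shift (V : lmodType (Sq q)) (b z lam : F) (d : nat)
    (v : int -> nat -> V) (m : int) : b != 0 -> lam != 0 ->
  basis_action b z lam d v ->
  basis_action (b * q ^ m) z lam d (fun k l => v (k + m) l).
Proof.
move=> b0 lam0 va k l ld; have [[vK vC vY] [vF vX vE]] := va (k + m) l ld.
have m0 := expfz_neq0 m q0.
have k0 := expfz_neq0 k q0; have l0 := expf_neq0 l q0.
split; split=> //.
- rewrite vK; congr (cact _ _); rewrite opprD; move: (2 * l%:Z) => r.
  have r0 := expfz_neq0 r q0; qpow q0; move: (q ^ k) (q ^ m) (q ^ r) k0 m0 r0.
  by move=> x y t x0 y0 t0; qfield hq; rewrite ?x0 ?y0 ?t0 ?b0.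
- by rewrite vY addrAC.
- rewrite vF; case: ifP => // _; congr (- _); apply: eq_bigr => i _.
  by congr (cact _ (v _ _)); lia.
- rewrite vX (_ : k + m - 1 = k - 1 + m) ?(addrAC k m 1); last by lia.
  congr (cact _ _ - cact _ _).
    by qpow q0; move: (q ^ k) (q ^ m) => x y; qfield hq.
  by qpow q0; move: (q ^ k) (q ^ m) => x y; qfield hq; rewrite ?lam0.
- rewrite vE (_ : k + m - 2 = k - 2 + m); last by lia.
  rewrite !(addrAC k m) opprD.
  congr (cact _ _ - cact _ _); qpow q0; move: (q ^ k) (q ^ m) (q ^+ l) k0 m0 l0;
  by move=> x y t x0 y0 t0; qfield hq; rewrite ?x0 ?y0 ?t0 ?b0 ?lam0.
Qed.

(** * Recovering the parameters from the module *)

Section Recovery.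
Variables (V : lmodType (Sq q)) (b z lam : F) (d : nat) (v : int -> nat -> vsp V).
Hypotheses (b0 : b != 0) (z0 : z != 0) (lam0 : lam != 0) (d0 : (0 < d)%N).
Hypothesis va : basis_action b z lam d (v : int -> nat -> V).
Hypothesis sp : forall w, in_span (@fam (vsp V) d v) w.
Local Notation zeta := (z / (q - 1)).

(* K (Y X - zeta) has on V the eigenvalues - zeta lam q^(-2l), l < d, which recover
   lam. *)
Definition KHop (z' : F) (w : vsp V) : vsp V := op GK (Hop z' w).
Fact KHop_linear z' : linear (KHop z').
Proof. by move=> c u w; rewrite /KHop linearP !opL. Qed.
HB.instance Definition _ z' :=
  GRing.isLinear.Build F (vsp V) (vsp V) *:%R (KHop z') (KHop_linear z').

Let aK k l : (l < d)%N ->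
  op GK (v k l) = (lam * b^-1 * q ^ (- k - 2 * l%:Z)) *: v k l.
Proof. by move=> ld; have [[]] := va k ld. Qed.
Let aY k l : (l < d)%N -> op GY (v k l) = v (k + 1) l.
Proof. by move=> ld; have [[]] := va k ld. Qed.
Let aX k l : (l < d)%N -> op GX (v k l) =
  (- z * ((b * q ^ k - 1) / (q - 1))) *: v (k - 1) l
  - (lam^-1 * b * q ^ (k + l%:Z - 1) * qnum q l) *: v (k + 1) l.-1.
Proof. by move=> ld; have [_ []] := va k ld. Qed.

Lemma KHop_v k l : (l < d)%N -> KHop z (v k l) =
  (- (zeta * lam) / (q ^+ l) ^+ 2) *: v k l
  + (- (q ^ (k + l%:Z - 1) * q ^ (- (k + 2) - 2 * l.-1%:Z)) * qnum q l)
    *: v (k + 2) l.-1.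
Proof.
move=> ld; have ll := leq_ltn_trans (leq_pred l) ld.
rewrite /KHop /Hop aX // !(opB, opZ) !aY // subrK (_ : k + 1 + 1 = k + 2);
  last by lia.
rewrite !aK //.
have -> : q ^ (- k - 2 * l%:Z) = (q ^ k)^-1 / (q ^+ l) ^+ 2.
  by rewrite expfzDr // -!invr_expz -exprM mulnC.
set c := q ^ (- (k + 2) - _); set c' := q ^ (k + _ - _).
have k0 := expfz_neq0 k q0; have l0 := expf_neq0 l q0.
vect (F : pzRingType); move: (q ^ k) (q ^+ l) k0 l0 => x y x0 y0;
  by qfield hq; rewrite ?x0 ?y0 ?lam0 ?b0.
Qed.

Lemma KHop_kill (w : vsp V) :
  kill (KHop z) (mkseq (fun l => - (zeta * lam) / (q ^+ l) ^+ 2) d) w = 0.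
Proof.
have [s [c ->]] := sp w; rewrite kill_sum big1 // => [[k l]] _.
(* Fixing n = k + 2 l singles out a chain [r 0], ..., [r d.-1] of equal weight, on which the
   operator is triangular. *)
rewrite killZ /fam /=; pose n := k + 2 * (l : nat)%:Z.
pose r j := v (n - 2 * j%:Z) j.
have -> : v k l = r l by rewrite /r /n addrK.
rewrite [kill _ _ _](_ : _ = 0) ?scaler0 //.
apply: (@kill_triangular _ _ _ r _ (fun l => - (q ^ (n - 2 * l%:Z + l%:Z - 1) *
  q ^ (- (n - 2 * l%:Z + 2) - 2 * l.-1%:Z)) * qnum q l) d) => //.
  move=> j jd; rewrite /r [LHS]KHop_v //; congr (_ + _).
  case: j {jd} => [|j]; first by rewrite qnum0 mulr0 !scale0r.
  by congr (_ *: v _ _) => /=; lia.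
by rewrite qnum0 mulr0.
Qed.

Lemma K_kill (w : vsp V) : exists s : seq int,
  kill (@op _ _ V GK) [seq lam * b^-1 * q ^ (- n) | n <- s] w = 0.
Proof.
have [s [c ->]] := sp w.
exists [seq i.1 + 2 * (i.2 : nat)%:Z | i : int * 'I_d <- s].
rewrite kill_sum big1_seq // => [[k l]] /andP [_ hi].
rewrite killZ /fam /= (kill_eigen0 (aK k (ltn_ord l))) ?scaler0 //.
apply/mapP; exists (k + 2 * (l : nat)%:Z); first exact: map_f hi.
by rewrite opprD.
Qed.

Lemma C_scalar (w : vsp V) : op GC w = z *: w.
Proof.
have [s [c ->]] := sp w; rewrite op_sum scaler_sumr.
apply: eq_bigr => [[k l]] _; rewrite opZ scalerA mulrC -scalerA.
by congr (_ *: _); have [[_ vC _] _] := va k (ltn_ord l).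
Qed.

End Recovery.

(** The image of [v 0 0] is a common eigenvector of C, K and K H. Products of factors that
    annihilate vectors of V' force its eigenvalues into the lists known for V'. In K H the parameter
    b cancels, so lam is seen apart from b. *)
Lemma params_of_morphism (V V' : lmodType (Sq q)) (b b' z z' lam lam' : F)
    (d d' : nat) (v : int -> nat -> V) (v' : int -> nat -> V')
    (f : {linear V -> V'}) :
  b != 0 -> b' != 0 -> z' != 0 -> lam != 0 -> lam' != 0 ->
  (0 < d)%N -> (0 < d')%N ->
  basis_action b z lam d v -> basis_action b' z' lam' d' v' ->
  (forall w, in_span (@fam (vsp V') d' v') w) -> f (v 0 0) <> 0 ->
  [/\ z = z', exists l : nat, lam = lam' / (q ^+ l) ^+ 2
    & exists n : int, lam / b = lam' / b' * q ^ n].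
Proof.
move=> b0 b0' z0' lam0 lam0' d0 d0' va va' sp' f0.
have [[vK vC vY] [vF vX vE]] := va 0 0 d0.
have [[_ _ vY'] _] := va (-1) 0 d0.
pose w : vsp V' := f (v 0 0).
have w0 : w != 0 by apply/eqP.
have fop g u : op g (f u : vsp V') = f (op g (u : vsp V)).
  by rewrite /op linearZ.
have fsc c u : f (c *: (u : vsp V)) = c *: (f u : vsp V').
  by rewrite vscaleE linearZ.
have wC : op GC w = z *: w by rewrite /w fop [op _ _]vC -fsc.
have zz : z = z'.
  move: wC; rewrite (C_scalar va' sp') => /eqP; rewrite -subr_eq0 -scalerBl.
  by rewrite scaler_eq0 (negbTE w0) orbF subr_eq0 => /eqP.
have wK : op GK w = (lam / b) *: w.
  by rewrite /w fop [op _ _]vK -fsc mulr0 subr0 oppr0 expr0z mulr1.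
have wX : op GY (op GX w) = (z / (q - 1) * (1 - b)) *: w.
  rewrite /w !fop [op GX _]vX qnum0 mulr0.
  have -> u : cact 0 u = 0 :> V by rewrite /cact rmorph0 scale0r.
  rewrite subr0 [op GY _](_ : _ = (- z * ((b * q ^ 0 - 1) / (q - 1))) *: (v 0 0 : vsp V)).
    by rewrite fsc expr0z; congr (_ *: _); qfield hq.
  by rewrite [cact _ _]/(_ *: (v (0 - 1) 0 : vsp V)) opZ sub0r [op GY _]vY' addNr.
have wA : KHop z' w = (- (z / (q - 1)) * lam) *: w.
  rewrite /KHop /Hop wX -zz opB !opZ wK.
  by vect (F : pzRingType); qfield hq; rewrite b0.
split=> //.
  have := KHop_kill b0' z0' lam0' d0' va' sp' w; rewrite (kill_eigen _ wA) => /eqP.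
  rewrite scaler_eq0 (negbTE w0) orbF prodf_seq_eq0 => /hasP [x /mapP [l _ ->]] /=.
  rewrite subr_eq0 zz -(mulNr _ lam') -(mulrA _ lam') => /eqP h; exists l.
  apply: mulfI h; by rewrite oppr_eq0 mulf_neq0 ?invr_neq0 ?gen_sub1.
have [s] := K_kill va' sp' w; rewrite (kill_eigen _ wK) => /eqP.
rewrite scaler_eq0 (negbTE w0) orbF prodf_seq_eq0 => /hasP [x /mapP [n _ ->]] /=.
by rewrite subr_eq0 => /eqP h; exists (- n).
Qed.

End BasisAction.

(** * The ring of additive endomorphisms *)

(** A module over a presented ring is given by a ring morphism to this ring, and [plift] supplies
    such morphisms. Additive maps suffice since the scalars of F are elements of [Sq q] and act
    through [escal]. *)
Record endo (V : zmodType) := Endo {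
  endo_fun :> V -> V;
  endo_add : forall u v, endo_fun (u + v) = endo_fun u + endo_fun v }.

HB.instance Definition _ (V : zmodType) := gen_eqMixin (endo V).
HB.instance Definition _ (V : zmodType) := gen_choiceMixin (endo V).

Section EndoRing.
Variable V : zmodType.
Implicit Types f g h : endo V.

Lemma endo_ext f g : (forall v, f v = g v) -> f = g.
Proof.
case: f g => [f hf] [g hg] /= h.
have e : f = g by apply: funext.
by case: _ / e hg => hg; rewrite (Prop_irrelevance hf hg).
Qed.

Program Definition endo_sum f g := @Endo V (fun v => f v + g v) _.
Next Obligation. by rewrite !endo_add addrACA. Qed.
Program Definition endo_opp f := @Endo V (fun v => - f v) _.
Next Obligation. by rewrite endo_add opprD. Qed.
Program Definition endo_zero := @Endo V (fun=> 0) _.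
Next Obligation. by rewrite addr0. Qed.
Program Definition endo_one := @Endo V id _.
Program Definition endo_mul f g := @Endo V (fun v => f (g v)) _.
Next Obligation. by rewrite !endo_add. Qed.

Fact endo_addA : associative endo_sum.
Proof. by move=> f g h; apply: endo_ext => v /=; rewrite addrA. Qed.
Fact endo_addC : commutative endo_sum.
Proof. by move=> f g; apply: endo_ext => v /=; rewrite addrC. Qed.
Fact endo_add0 : left_id endo_zero endo_sum.
Proof. by move=> f; apply: endo_ext => v /=; rewrite add0r. Qed.
Fact endo_addN : left_inverse endo_zero endo_opp endo_sum.
Proof. by move=> f; apply: endo_ext => v /=; rewrite addNr. Qed.
HB.instance Definition _ :=
  GRing.isZmodule.Build (endo V) endo_addA endo_addC endo_add0 endo_addN.

Fact endo_mulA : associative endo_mul.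
Proof. by move=> f g h; apply: endo_ext. Qed.
Fact endo_mul1l : left_id endo_one endo_mul.
Proof. by move=> f; apply: endo_ext. Qed.
Fact endo_mul1r : right_id endo_one endo_mul.
Proof. by move=> f; apply: endo_ext. Qed.
Fact endo_mulDl : left_distributive endo_mul +%R.
Proof. by move=> f g h; apply: endo_ext. Qed.
Fact endo_mulDr : right_distributive endo_mul +%R.
Proof. by move=> f g h; apply: endo_ext => v /=; rewrite endo_add. Qed.
HB.instance Definition _ := GRing.Zmodule_isPzRing.Build (endo V)
  endo_mulA endo_mul1l endo_mul1r endo_mulDl endo_mulDr.

Definition emod : Type := V.
HB.instance Definition _ := GRing.Zmodule.copy emod V.
Let escale f (v : emod) : emod := f v.
Fact escaleA f g v : escale f (escale g v) = escale (f * g) v.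
Proof. by []. Qed.
Fact escale1 : left_id 1 escale. Proof. by []. Qed.
Fact escaleDr : right_distributive escale +%R.
Proof. by move=> f u v; exact: (@endo_add V f u v). Qed.
Fact escaleDl v : {morph escale^~ v : f g / f + g}.
Proof. by []. Qed.
HB.instance Definition _ := GRing.Zmodule_isLmodule.Build (endo V) emod
  escaleA escale1 escaleDr escaleDl.

End EndoRing.

Section ScalarEndo.
Variables (F : pzRingType) (V : lmodType F).
Definition escal (c : F) : endo V := Endo (scalerDr c).
Fact escal_nmod_morphism : nmod_morphism escal.
Proof.
split=> [|a b]; apply: endo_ext => v /=; first by rewrite scale0r.
by rewrite scalerDl.
Qed.
HB.instance Definition _ :=
  GRing.isNmodMorphism.Build F (endo V) escal escal_nmod_morphism.
Fact escal_monoid_morphism : monoid_morphism escal.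
Proof.
split=> [|a b]; apply: endo_ext => v /=; first by rewrite scale1r.
by rewrite scalerA.
Qed.
HB.instance Definition _ :=
  GRing.isMonoidMorphism.Build F (endo V) escal escal_monoid_morphism.
End ScalarEndo.

(** * A model on which Y is invertible *)

Section Model.
Variables (F : fieldType) (q : F) (hq : generic q).
Variables (z mu h : F) (d : nat).
Hypotheses (mu0 : mu != 0) (h0 : h != 0) (d0 : (0 < d)%N).
Hypothesis ld : elow q z mu h d = 0.
Let q0 := gen_neq0 hq.
Local Notation zeta := (z / (q - 1)).

(* [f k j] is the coefficient of [f] on the vector [e k j] of an e-family with
   [elow d = 0]; [model_op] is the action in these coordinates. *)
Definition mspace : Type := int -> nat -> F.
HB.instance Definition _ := GRing.Lmodule.copy mspace (int -> nat -> F^o).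
Implicit Type f : mspace.

Definition model_op (g : sgen) (f : mspace) : mspace := fun k j =>
  match g with
  | GC => z * f k j
  | GK => mu / q ^ k * f k j
  | GKi => q ^ k / mu * f k j
  | GY => f (k - 1) j
  | GX => (h * q ^ (k + 1) / (q ^+ j) ^+ 2 + zeta) * f (k + 1) j
  | GF => (j != d)%:R * (if j is j'.+1 then f (k - 2) j' else 0)
          + etau q mu h * (q ^+ j) ^+ 2 * f (k - 2) j
  | GE => ediag q z (h * q ^ (k + 2) / (q ^+ j) ^+ 2) * f (k + 2) j
          + elow q z mu h j.+1 / q ^ (k + 2) * f (k + 2) j.+1
  end.

Lemma mspaceD f (f' : mspace) k j : (f + f') k j = f k j + f' k j :> F.
Proof. by []. Qed.
Lemma mspaceZ c f k j : (c *: f) k j = c * f k j :> F.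
Proof. by []. Qed.

Fact model_op_add g (f f' : mspace) :
  model_op g (f + f') = model_op g f + model_op g f'.
Proof.
apply: funext => k; apply: funext => j; rewrite mspaceD.
case: g; rewrite /model_op ?mspaceD; try by ring.
by case: j => [|j]; rewrite ?mspaceD; ring.
Qed.

Definition model_endo g : endo mspace := Endo (model_op_add g).

(** The factor [j != d] in F cuts the step from d - 1 to d, and [elow d = 0] cuts the step of E from
    d to d - 1. The two cuts together are compatible with the relation for E F - F E. *)
Fact model_rel s t : Sq_rel q s t ->
  peval (@escal F mspace) model_endo s = peval (@escal F mspace) model_endo t.
Proof.
move=> st; apply: endo_ext => f; apply: funext => k; apply: funext => j.
have k0 := expfz_neq0 k q0; have l0 := expf_neq0 j q0.
have i0 : k + 1 - 1 = k by lia.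
have i1 : k - 1 + 1 = k by lia.
have i2 : k + 2 - 1 = k + 1 by lia.
have i3 : k - 1 + 2 = k + 1 by lia.
have i4 : k + 1 + 2 = k + 3 by lia.
have i5 : k + 2 + 1 = k + 3 by lia.
have i6 : k - 2 + 1 = k - 1 by lia.
have i7 : k + 1 - 2 = k - 1 by lia.
have i8 : k + 2 - 2 = k by lia.
have i9 : k - 2 + 2 = k by lia.
have i10 : k - 1 - 2 = k - 3 by lia.
have i11 : k - 2 - 1 = k - 3 by lia.
case: st => [c g|g||||||||||||] /=; rewrite ?mspaceD ?mspaceZ.
- case: g; rewrite /model_op ?mspaceZ; try by ring.
  by case: j {l0} => [|j]; rewrite ?mspaceZ; ring.
- case: g => /=; try by ring.
  by case: j {l0} => [|j]; ring.
all: rewrite /model_op ?mspaceD ?mspaceZ.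
all: rewrite ?(i0, i1, i2, i3, i4, i5, i6, i7, i8, i9, i10, i11).
all: try by rewrite /etau /ediag; try move: (elow _ _ _ _ _) => c; qpow q0;
  rewrite ?(exprS q j); move: (q ^ k) (q ^+ j) k0 l0 => x y x0 y0;
  qfield hq; rewrite ?x0 ?y0 ?mu0 ?h0.
all: try by move: ((j != d)%:R : F) => sg; case: j l0 => [|j] l0; rewrite /etau; qpow q0;
  [ rewrite ?expr0; move: (q ^ k) k0 => x x0;
    qfield hq; rewrite ?x0 ?mu0 ?h0
  | rewrite ?(exprS q j); move: (q ^ k) (q ^+ j) k0 (expf_neq0 j q0) => x y x0 y0;
    qfield hq; rewrite ?x0 ?y0 ?mu0 ?h0].
(* Only the relation between E and F is left. Next to [elow j.+1] the cut may be dropped, both being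
   trivial at j + 1 = d. *)
have low (c : F) : elow q z mu h j.+1 * c * (j.+1 != d)%:R = elow q z mu h j.+1 * c.
  by case: (eqVneq j.+1 d) => [->|_]; rewrite ?ld ?mul0r ?mulr1.
have e1 : elow q z mu h j.+1 / q ^ (k + 2) *
    ((j.+1 != d)%:R * f k j + etau q mu h * (q ^+ j.+1) ^+ 2 * f k j.+1) =
  elow q z mu h j.+1 / q ^ (k + 2) *
    (f k j + etau q mu h * (q ^+ j.+1) ^+ 2 * f k j.+1).
  by rewrite mulrDr mulrA low; ring.
rewrite e1; clear e1 low; case: j l0 => [|j] l0.
  rewrite mulr0 /etau /ediag /elow; qpow q0.
  by move: (q ^ k) k0 => x x0; qfield hq; rewrite ?x0 ?mu0 ?h0.
have low (c : F) : (j.+1 != d)%:R * (elow q z mu h j.+1 / q ^ k * c) =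
   elow q z mu h j.+1 / q ^ k * c.
  by case: (eqVneq j.+1 d) => [->|_]; rewrite ?ld ?mul0r ?mulr0 ?mul1r.
rewrite [in X in _ + -1 * X]mulrDr low; move: ((j.+1 != d)%:R : F) => sg.
rewrite /etau /ediag /elow; qpow q0; rewrite !(exprS q j.+1) !(exprS q j).
have {}l0 := expf_neq0 j q0; move: (q ^ k) (q ^+ j) k0 l0 => x y x0 y0.
by qfield hq; rewrite ?x0 ?y0 ?mu0 ?h0.
Qed.

Definition model : lmodType (Sq q) := restr (plift model_rel) (emod mspace).

Lemma model_opE g (f : model) : sgenE q g *: f = model_op g f.
Proof. by rewrite -[LHS]/(plift model_rel (sgenE q g) f) plift_gen. Qed.

Lemma model_scalE c (f : model) : scal q c *: f = c *: (f : mspace).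
Proof. by rewrite -[LHS]/(plift model_rel (scal q c) f) plift_in. Qed.

Definition model_yinv (f : mspace) : mspace := fun k j => f (k + 1) j.
Fact model_yinv_add f f' : model_yinv (f + f') = model_yinv f + model_yinv f'.
Proof. by []. Qed.

Fact model_loc_rel s t : loc_rel (sgenE q GY) s t ->
  peval (plift model_rel) (fun=> Endo model_yinv_add) s =
  peval (plift model_rel) (fun=> Endo model_yinv_add) t.
Proof.
case=> /=; rewrite rmorph1 plift_gen; apply: endo_ext => f;
  apply: funext => k; apply: funext => j; rewrite /= /model_yinv.
  by rewrite subrK.
by rewrite /model_op addrK.
Qed.

Definition model_loc : lmodType (SqY q) := restr (plift model_loc_rel) (emod mspace).

Lemma model_locE (a : Sq q) (f : model) :
  SqY_in q a *: (f : model_loc) = a *: f.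
Proof. by rewrite -[LHS]/(plift model_loc_rel (SqY_in q a) f) plift_in. Qed.

Lemma model_loc_inv (f : model_loc) : Yinv q *: f = model_yinv f.
Proof. by rewrite -[LHS]/(plift model_loc_rel (Yinv q) f) plift_gen. Qed.

End Model.

(** * The simple highest weight module N(lam, z) *)

Section QuotientLift.
Variables (S : pzRingType) (V W : lmodType S) (P : V -> Prop) (f : {linear V -> W}).
Hypothesis fP : forall v, P v -> f v = 0.

Lemma msubspan_ker v : msubspan P v -> f v = 0.
Proof.
move=> /(_ (fun v => f v = 0)); apply=> //.
split=> [|u w hu hw|a u hu]; first exact: linear0.
  by rewrite linearD hu hw addr0.
by rewrite linearZ_LR hu scaler0.
Qed.

Definition qlift (fP : forall v, P v -> f v = 0) (x : qmod P) : W := f (repr x).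

Lemma qliftE v : qlift fP (qmod_pi P v) = f v.
Proof.
apply/eqP; rewrite -subr_eq0 -linearB; apply/eqP/msubspan_ker.
by apply/qmod_eq; rewrite reprK.
Qed.

Fact qlift_linear : linear (qlift fP).
Proof.
move=> a; elim/qmod_ind=> u; elim/qmod_ind=> v.
rewrite -![\pi_(qmod P) _]/(qmod_pi P _) -linearZ_LR -linearD !qliftE.
by rewrite linearP.
Qed.
HB.instance Definition _ :=
  GRing.isLinear.Build S (qmod P) W *:%R (qlift fP) qlift_linear.

End QuotientLift.

Section HighestWeight.
Variables (F : fieldType) (q : F) (hq : generic q).
Variables (V : lmodType (Sq q)) (lam z : F) (w : vsp V).
Hypotheses (lam0 : lam != 0).
Hypotheses (wE : op GE w = 0) (wX : op GX w = 0) (wK : op GK w = lam *: w).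
Hypothesis wC : op GC w = z *: w.
Let q0 := gen_neq0 hq.

Definition pbw (i : nat * nat) : vsp V :=
  iter i.1 (@op _ _ V GY) (iter i.2 (@op _ _ V GF) w).
Local Notation D := (in_span pbw).

Let D0 : D 0. Proof. by have [] := in_span_submodule pbw. Qed.
Let DD u v : D u -> D v -> D (u + v).
Proof. by have [_ h _] := in_span_submodule pbw; exact: h. Qed.
Let DZ c u : D u -> D (c *: u).
Proof. by have [_ _ h] := in_span_submodule pbw; exact: h. Qed.
Let DB u v : D u -> D v -> D (u - v).
Proof. by apply: submodule_ext; exact: in_span_submodule. Qed.

Let Dop g : (forall i, D (op g (pbw i))) -> forall u, D u -> D (op g u).
Proof.
move=> h u [s [c ->]]; rewrite op_sum.
by elim/big_ind: _ => // i _; rewrite opZ; apply: (DZ).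
Qed.

Lemma pbw_K i : op GK (pbw i) = (lam * q ^ (- (i.1 + 2 * i.2)%N%:Z)) *: pbw i.
Proof.
case: i => k l; rewrite /pbw /=; elim: k => [|k ih] /=.
  elim: l => [|l ih] /=; first by rewrite muln0 oppr0 expr0z mulr1.
  rewrite opKF ih opZ scalerA; congr (_ *: _).
  have -> : (0 + 2 * l.+1 = (0 + 2 * l) + 2)%N by lia.
  rewrite mulrCA; congr (_ * _); move: (0 + 2 * l)%N => n.
  by rewrite PoszD opprD expfzDr // mulrC -(invr_expz q (Posz 2)).
rewrite opKY ih opZ scalerA; congr (_ *: _).
have -> : (k.+1 + 2 * l = (k + 2 * l) + 1)%N by lia.
rewrite mulrCA; congr (_ * _); move: (k + 2 * l)%N => n.
by rewrite PoszD opprD expfzDr // mulrC -(invr_expz q (Posz 1)) expr1z.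
Qed.

Let DK u : D u -> D (op GK u).
Proof. by apply: Dop => i; rewrite pbw_K; apply: DZ; apply: in_span_base. Qed.
Let DKi u : D u -> D (op GKi u).
Proof.
apply: Dop => i; rewrite (opKi_eigen _ (pbw_K i)).
  by apply: DZ; apply: in_span_base.
by rewrite mulf_neq0 // expfz_neq0.
Qed.
Let DY u : D u -> D (op GY u).
Proof. by apply: Dop => [[k l]]; exact: (in_span_base pbw (k.+1, l)). Qed.
Let DF u : D u -> D (op GF u).
Proof.
apply: Dop => [[k l]]; rewrite [op GF _](_ : _ = pbw (k, l.+1)).
  exact: in_span_base.
by rewrite /pbw /=; elim: k => //= k <-; rewrite opFY.
Qed.
Let DC u : D u -> D (op GC u).
Proof.
apply: Dop => [[k l]]; rewrite [op GC _](_ : _ = z *: pbw (k, l)).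
  by apply: DZ; apply: in_span_base.
rewrite /pbw /=; elim: k => [|k ih] /=; last by rewrite opCC ih opZ.
by elim: l => [|l ih] //=; rewrite opCC ih opZ.
Qed.
Let DX u : D u -> D (op GX u).
Proof.
apply: Dop => [[k l]]; rewrite /pbw /=; elim: k => [|k ih] /=.
  elim: l => [|l ih] /=; first by rewrite wX.
  rewrite opXF; apply: (DB); first exact: DF.
  by apply: DY; apply: DKi; exact: (in_span_base pbw (0%N, l)).
rewrite opXY; apply: (DB); first by apply: DZ; exact: DY.
by apply: DC; exact: (in_span_base pbw (k, l)).
Qed.
Let DE u : D u -> D (op GE u).
Proof.
apply: Dop => [[k l]]; rewrite /pbw /=; elim: k => [|k ih] /=.
  elim: l => [|l ih] /=; first by rewrite wE.
  rewrite opEF; apply: (DD); first exact: DF.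
  have h := in_span_base pbw (0%N, l).
  by apply: DZ; apply: DB; [exact: DK|exact: DKi].
rewrite opEY; apply: (DD); last by apply: DZ; exact: DY.
by apply: DX; exact: (in_span_base pbw (k, l)).
Qed.

(** E and X are moved to the right through Y and F until they reach [w], which they kill; the
    commutators involve only operators already known to preserve the span. *)
Lemma pbw_submodule : submodule (D : V -> Prop).
Proof.
apply: (@submodule_gen _ _ V D) => // g u hu.
case: g; [exact: DC|exact: DE|exact: DF|exact: DK|exact: DKi|exact: DX|exact: DY].
Qed.

(* The condition on [x - c *: w] says that it has no component of weight [lam]. *)
Definition top_component (x : vsp V) : Prop := exists c (s : seq int),
  0 \notin s /\ kill (@op _ _ V GK) [seq lam * q ^ (- n) | n <- s] (x - c *: w) = 0.

(** Every monomial other than [w] has weight lam q^(-n) with n > 0 and is annihilated by the factor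
    for n. *)
Lemma pbw_top x : D x -> top_component x.
Proof.
have hD u v : top_component u -> top_component v -> top_component (u + v).
  move=> [c [s [hs e]]] [c' [s' [hs' e']]]; exists (c + c'), (s ++ s').
  rewrite mem_cat negb_or hs hs'; split=> //.
  rewrite scalerDl opprD addrACA map_cat killD.
  by rewrite (kill0_cat _ e) kill_cat e' kill0 addr0.
have ht a i : (0 < i.1 + 2 * i.2)%N -> top_component (a *: pbw i).
  move=> hi; exists 0, [:: (i.1 + 2 * i.2)%N%:Z].
  split; first by rewrite inE /= eq_sym; case: (_ + _)%N hi.
  rewrite scale0r subr0.
  apply: (@kill_eigen0 _ _ (@op _ _ V GK) _ (lam * q ^ (- (i.1 + 2 * i.2)%N%:Z))).
    by rewrite /= opZ pbw_K !scalerA mulrC.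
  exact: mem_head.
case=> s [c ->]; elim/big_ind: _ => //.
  by exists 0, [::]; split=> //; rewrite scale0r subr0.
move=> [[|k] [|l]] _; [|by apply: ht => /=; lia ..].
by exists (c (0%N, 0%N)), [::]; split=> //=; rewrite subrr.
Qed.

End HighestWeight.

(** [elow] is a multiple of the difference of the two sides; the multiplier contains q^(2j) - 1,
    which is nonzero for j > 0. *)
Lemma elow_eq0 (F : fieldType) (q : F) (hq : generic q) (z mu h : F) (j : nat) :
  mu != 0 -> h != 0 -> (0 < j)%N ->
  elow q z mu h j = 0 <->
  (mu * h) ^+ 2 = (z / (q - 1)) ^+ 2 * q ^ (2 * j%:Z - 3).
Proof.
move=> mu0 h0 j0; have q0 := gen_neq0 hq.
have -> : q ^ (2 * j%:Z - 3) = (q ^+ j) ^+ 2 / q ^+ 3.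
  rewrite expfzDr // -exprM mulnC -(invr_expz q (Posz 3)).
  by congr (q ^ _ * _); lia.
set x := q ^+ j.
have x1 : x ^+ 2 - 1 != 0.
  rewrite subr_eq0 /x -exprM; case: hq => _ /(_ (j * 2)%N); apply.
  by rewrite muln_gt0 j0.
have -> : elow q z mu h j = (x ^+ 2 - 1) * q ^+ 3 / ((1 - q ^+ 2) ^+ 2 * mu * h ^+ 2)
    * ((mu * h) ^+ 2 - (z / (q - 1)) ^+ 2 * (x ^+ 2 / q ^+ 3)).
  by rewrite /elow -/x; move: x x1 => x x1; qfield hq; rewrite ?mu0 ?h0.
split=> [/eqP|->]; last by rewrite subrr mulr0.
rewrite mulf_eq0 subr_eq0 => /orP [|/eqP //].
by rewrite !(mulf_eq0, invr_eq0, expf_eq0) /= (negbTE x1) (negbTE q0)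
  (negbTE (gen_sqr' hq)) (negbTE mu0) (negbTE h0).
Qed.

(** * The simple quotient N(lam, z) inside the model *)

Section SimpleQuotient.
Variables (F : fieldType) (q : F) (hq : generic q) (z lam : F) (d : nat).
Hypotheses (z0 : z != 0) (lam0 : lam != 0) (d0 : (0 < d)%N).
Hypothesis hlam : lam ^+ 2 = q ^ (2 * d%:Z - 3).
Let q0 := gen_neq0 hq.
Local Notation zeta := (z / (q - 1)).

Let zeta0 : zeta != 0.
Proof. by rewrite mulf_neq0 // invr_neq0 // gen_sub1. Qed.
Fact Nh_neq0 : - zeta != 0. Proof. by rewrite oppr_eq0. Qed.
Local Notation h0 := Nh_neq0.
Fact Nlow : elow q z lam (- zeta) d = 0.
Proof. by apply/(elow_eq0 hq z lam0 h0 d0); rewrite exprMn sqrrN hlam mulrC. Qed.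

Let low_neq0 j : (0 < j < d)%N -> elow q z lam (- zeta) j != 0.
Proof.
move=> /andP [j0 jd]; apply/eqP => /(elow_eq0 hq z lam0 h0 j0).
rewrite exprMn sqrrN hlam mulrC => /(mulfI (expf_neq0 2 zeta0)).
by move/(gen_pow_inj hq) => e; lia.
Qed.

(** The model at mu = lam and h = - zeta, the value for which X and E kill the vector at (0, 0). *)
Definition Nmodel : lmodType (Sq q) := model hq lam0 h0 d0 Nlow.
Local Notation M := Nmodel.

Definition delta (k : int) (j : nat) : mspace F :=
  fun k' j' => ((k' == k) && (j' == j))%:R.
Definition edelta k j : mspace F := if (j < d)%N then delta k j else 0.

Lemma Nmodel_op g (f : vsp M) k j :
  op g f k j = model_op q z lam (- zeta) d g f k j.
Proof. by rewrite [op g f]model_opE. Qed.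

Lemma Nmodel_scale c (f : vsp M) k j : (c *: f) k j = c * f k j.
Proof. by rewrite [c *: f]model_scalE. Qed.

Let E00 : vsp M := delta 0 0.

Let E00_K : op GK E00 = lam *: E00.
Proof.
apply: funext => k; apply: funext => j; rewrite Nmodel_scale Nmodel_op /= /E00 /delta.
by have [->|_] := eqVneq k 0; rewrite ?mulr0 // expr0z divr1.
Qed.
Let E00_C : op GC E00 = z *: E00.
Proof. by apply: funext => k; apply: funext => j; rewrite Nmodel_scale Nmodel_op. Qed.
Let E00_X : op GX E00 = 0.
Proof.
apply: funext => k; apply: funext => j; rewrite Nmodel_op /= /E00 /delta.
have [->|_] := eqVneq (k + 1) 0; last by rewrite mulr0.
have [->|_] := eqVneq j 0%N; last by rewrite mulr0.
by rewrite expr0z expr0 expr1n divr1 !mulr1 addNr ?mul0r.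
Qed.
Let E00_E : op GE E00 = 0.
Proof.
apply: funext => k; apply: funext => j; rewrite Nmodel_op /= /E00 /delta.
have [->|_] := eqVneq (k + 2) 0; last by rewrite !mulr0 addr0.
have [->|_] := eqVneq j 0%N; last by rewrite !mulr0 addr0.
rewrite mulr0 addr0 mulr1 expr0z expr0 expr1n divr1 mulr1 /ediag.
by qfield hq; rewrite oppr_eq0 z0.
Qed.

Let E00_neq0 : E00 <> 0.
Proof.
move=> /(congr1 (fun f : mspace F => f 0 0%N)); rewrite /E00 /delta eqxx /=.
by move/eqP; rewrite oner_eq0.
Qed.

(** A submodule containing the image of N(lam, z). Its edge k = 2 j is not crossed: on the vector at
    (k, j) H has the eigenvalue - zeta q^(k - 2j), so X vanishes at k = 2 j, and [ediag] vanishes at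
    k = 2 j and k = 2 j + 1. The upper bound n makes descents by X terminate. *)
Definition bounded (f : vsp M) := exists n : nat, forall (k : int) (j : nat),
  f k j <> 0 -> [/\ 2 * j%:Z <= k, k <= n%:Z & (j < d)%N].

Lemma bounded_submodule : submodule (bounded : M -> Prop).
Proof.
apply: (@submodule_gen _ _ M bounded).
- by exists 0%N => k j [].
- move=> u v [n hn] [m hm]; exists (n + m)%N => k j huv.
  have [e|/eqP e] := eqVneq (u k j) 0.
    by case: (hm k j) => [e'|h1 h2 h3]; [|split=> //; lia];
      apply: huv; rewrite -[RHS](addr0 0) -{1}e -e'.
  by case: (hn k j e) => h1 h2 h3; split=> //; lia.
- move=> c u [n hn]; exists n => k j; rewrite Nmodel_scale => h.
  by apply: hn => e; apply: h; rewrite e mulr0.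
move=> g u [n hn]; exists (n + 2)%N => k j; rewrite Nmodel_op.
have hu i l : u i l = 0 \/ [/\ 2 * l%:Z <= i, i <= n%:Z & (l < d)%N].
  by have [|/eqP h] := eqVneq (u i l) 0; [left|right; exact: hn].
have pw : q ^ (2 * j%:Z) = (q ^+ j) ^+ 2 by rewrite -exprM mulnC.
have p0 : (q ^+ j) ^+ 2 != 0 by rewrite !expf_neq0.
case: g => /=.
- by case: (hu k j) => [->|[h1 h2 h3] _]; [rewrite mulr0|split=> //; lia].
- case: (hu (k + 2) j.+1) => [->|[h1 h2 h3] _]; last by split; lia.
  rewrite mulr0 addr0; case: (hu (k + 2) j) => [->|[h1 h2 h3]].
    by rewrite mulr0.
  have [hk|hk] : 2 * j%:Z <= k \/ k + 2 = 2 * j%:Z \/ k + 2 = 2 * j%:Z + 1 by lia.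
    by move=> _; split=> //; lia.
  rewrite (_ : ediag _ _ _ = 0) ?mul0r //; rewrite /ediag.
  case: hk => ->; rewrite ?expfzDr // pw ?expr1z; move: ((q ^+ j) ^+ 2) p0 => x x0.
    by qfield hq; rewrite oppr_eq0 x0 z0.
  by qfield hq; rewrite oppr_eq0 x0 z0.
- case: (hu (k - 2) j) => [->|[h1 h2 h3] _]; last by split=> //; lia.
  rewrite mulr0 addr0; have [->|jd] := eqVneq j d; first by rewrite mul0r.
  case: j {pw p0} jd => [|j] jd; first by rewrite mulr0.
  case: (hu (k - 2) j) => [->|[h1 h2 h3] _]; first by rewrite mulr0.
  by split=> //; lia.
- by case: (hu k j) => [->|[h1 h2 h3] _]; [rewrite mulr0|split=> //; lia].
- by case: (hu k j) => [->|[h1 h2 h3] _]; [rewrite mulr0|split=> //; lia].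
- case: (hu (k + 1) j) => [->|[h1 h2 h3]]; first by rewrite mulr0.
  have [hk|->] : 2 * j%:Z <= k \/ k + 1 = 2 * j%:Z by lia.
    by move=> _; split=> //; lia.
  by rewrite pw mulfK // addNr mul0r.
- by case: (hu (k - 1) j) => [->|[h1 h2 h3] _] //; split=> //; lia.
Qed.

Lemma model_X_ker (f : vsp M) : bounded f -> op GX f = 0 ->
  forall k j, f k j <> 0 -> k = 2 * j%:Z.
Proof.
move=> [n hn] fX k j h; case: (hn k j h) => h1 h2 h3.
have := congr1 (fun g : mspace F => g (k - 1) j) fX.
rewrite [LHS]Nmodel_op /= subrK => /eqP; rewrite mulf_eq0 => /orP [|/eqP //].
have p0 : (q ^+ j) ^+ 2 != 0 by rewrite !expf_neq0.
rewrite (_ : _ + _ = zeta * (1 - q ^ k / (q ^+ j) ^+ 2)); last first.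
  by rewrite mulrBr mulr1 addrC !mulNr mulrA.
rewrite mulf_eq0 (negbTE zeta0) subr_eq0 => /eqP e.
have {}e : q ^ k = q ^ (j * 2)%N%:Z.
  by rewrite -exprnP exprM -[RHS]mul1r e mulfVK.
by have := gen_pow_inj hq e; lia.
Qed.

(** X lowers k until the vector is killed by X, hence supported on the edge k = 2 j. There the
    diagonal part of E vanishes, and E lowers j with the coefficients [elow j], nonzero for 0 < j <
    d, until only (0, 0) is left. *)
Lemma model_reach (U : M -> Prop) (f : vsp M) : submodule U -> bounded f ->
  f <> 0 -> U f -> U E00.
Proof.
move=> Usub bf f0 Uf; have [UF Uop] := submodule_op Usub; case: UF => _ _ UZ.
have [_ _ bop] := bounded_submodule.
(* Induction on the upper bound of the support, which X lowers by one; at n = 0 the support is at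
   most (0, 0). *)
have [g [g0 Ug bg gX]] : exists g : vsp M,
    [/\ g <> 0, U g, bounded g & op GX g = 0].
  case: (bf) => n; elim: n f f0 Uf bf => [|n ih] f f0 Uf bf hn.
    exists f; split=> //; apply: funext => k; apply: funext => j.
    rewrite Nmodel_op /=; have [->|/eqP h] := eqVneq (f (k + 1) j) 0.
      by rewrite mulr0.
    case: (hn _ _ h) => h1 h2 _.
    have [-> ->] : k + 1 = 0 /\ j = 0%N by lia.
    by rewrite expr0z expr0 expr1n divr1 mulr1 addNr mul0r.
  have [fX|fX] := pselect (op GX f = 0); first by exists f.
  apply: (ih (op GX f)) => //; first exact: Uop.
    exact: (bop (sgenE q GX) f).
  move=> k j; rewrite Nmodel_op /= => h.
  have bX : bounded (op GX f) by exact: (bop (sgenE q GX) f).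
  case: bX => m /(_ k j); rewrite Nmodel_op /= => /(_ h) [h1 _ _].
  have h' : f (k + 1) j <> 0 by move=> e; apply: h; rewrite e mulr0.
  by case: (hn _ _ h') => _ h2 h3; split=> //; lia.
have {gX f f0 bf Uf} hg k j : g k j <> 0 -> k = 2 * j%:Z /\ (j < d)%N.
  move=> h; split; first exact: (model_X_ker bg gX).
  by case: bg => n /(_ k j h) [].
have [m hm] : exists m, forall k j, g k j <> 0 -> (j <= m)%N.
  by exists d => k j /hg []; lia.
(* Induction on the largest j in the support: if the entry there is nonzero, E moves it to j - 1
   without loss. *)
elim: m g g0 Ug bg hg hm => [|m ih] g g0 Ug bg hg hm.
  have gE : g = g 0 0%N *: E00.
    apply: funext => k; apply: funext => j; rewrite Nmodel_scale /E00 /delta.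
    have [/andP [/eqP -> /eqP ->]|kj] := boolP ((k == 0) && (j == 0%N)).
      by rewrite mulr1.
    rewrite mulr0; have [//|/eqP h] := eqVneq (g k j) 0.
    have [hk _] := hg k j h; have hj := hm k j h.
    by case/negP: kj; apply/andP; split; apply/eqP; lia.
  have g00 : g 0 0%N != 0.
    by apply/eqP => e; apply: g0; rewrite gE e scale0r.
  have := UZ (g 0 0%N)^-1 g Ug.
  by rewrite [X in _ *: X]gE scalerA mulVf // scale1r.
have [e|h] := eqVneq (g (2 * m.+1%:Z) m.+1) 0.
  apply: (ih g) => // k j gkj; have := hm k j gkj; rewrite leq_eqVlt.
  case/orP => [/eqP ej|//]; have [ek _] := hg k j gkj.
  by case: gkj; rewrite ek ej.
have [_ md] := hg _ _ (elimN eqP h).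
have bg' : bounded (op GE g) by exact: (bop (sgenE q GE) g).
have hgE k j : op GE g k j <> 0 -> g (k + 2) j.+1 <> 0.
  move=> h1 e; have [n /(_ k j h1) [h2 _ _]] := bg'.
  apply: h1; rewrite Nmodel_op /= e mulr0 addr0.
  have [->|/eqP h3] := eqVneq (g (k + 2) j) 0; first by rewrite mulr0.
  by have [h4 _] := hg _ _ h3; lia.
apply: (ih (op GE g)) => //.
- move/(congr1 (fun f : mspace F => f (2 * m%:Z) m)).
  rewrite [LHS]Nmodel_op -[RHS]/(0 : F) /=.
  have -> : 2 * m%:Z + 2 = 2 * m.+1%:Z by lia.
  have -> : g (2 * m.+1%:Z) m = 0.
    have [//|/eqP h3] := eqVneq (g (2 * m.+1%:Z) m) 0.
    by have [h4 _] := hg _ _ h3; lia.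
  have : elow q z lam (- zeta) m.+1 != 0 by apply: low_neq0.
  move: (elow _ _ _ _ _) => c c0; move/eqP; rewrite mulr0 add0r.
  by apply/negP; rewrite !mulf_neq0 ?invr_neq0 ?expfz_neq0.
- exact: Uop.
- by move=> k j /hgE /hg [h1 h2]; split; lia.
- by move=> k j /hgE /hm.
Qed.

Let phi1 (x : (Sq q)^o) : M := x *: (E00 : M).
Fact phi1_linear : linear phi1.
Proof. by move=> a x y; rewrite /phi1 scalerDl -scalerA. Qed.
HB.instance Definition _ :=
  GRing.isLinear.Build (Sq q) (Sq q)^o M *:%R phi1 phi1_linear.

Fact phi1_rel x : verma_rel lam z x -> phi1 x = 0.
Proof.
case=> ->; rewrite /phi1.
- exact: E00_E.
- exact: E00_X.
- by rewrite scalerBl; apply/eqP; rewrite subr_eq0; apply/eqP; exact: E00_K.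
- by rewrite scalerBl; apply/eqP; rewrite subr_eq0; apply/eqP; exact: E00_C.
Qed.

Let phi : verma q lam z -> M := qlift phi1_rel.
Let one : vsp (verma q lam z) := qmod_pi _ (1 : (Sq q)^o).

Let phiD (u v : verma q lam z) : phi (u + v) = phi u + phi v.
Proof. exact: linearD. Qed.
Let phiZ a (u : verma q lam z) : phi (a *: u) = a *: phi u.
Proof. by rewrite /phi linearZ_LR. Qed.

Let phi_one : phi one = E00.
Proof. by rewrite /phi qliftE; exact: (@scale1r _ M). Qed.

Let verma_gen (v : verma q lam z) : exists s : Sq q, v = s *: (one : verma q lam z).
Proof.
elim/qmod_ind: v => x; exists x; rewrite -[LHS]/(qmod_pi _ x).
by rewrite -[x in LHS]mulr1 -[x * 1]/(x *: (1 : (Sq q)^o)) linearZ_LR.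
Qed.

Let one_rel (x y : Sq q) : verma_rel lam z (x - y : (Sq q)^o) ->
  x *: (one : verma q lam z) = y *: (one : verma q lam z).
Proof.
move=> h; apply/eqP; rewrite -subr_eq0 -scalerBl; apply/eqP.
rewrite /one -linearZ_LR -[RHS](linear0 (qmod_pi (verma_rel lam z))).
by apply/qmod_eq; rewrite subr0 => U _; apply; rewrite -[_ *: _]/(_ * _) mulr1.
Qed.

Let one_E : op GE one = 0.
Proof.
rewrite -[LHS]/(sgenE q GE *: (one : verma q lam z)) (@one_rel _ 0) ?scale0r //.
by rewrite subr0; constructor 1.
Qed.
Let one_X : op GX one = 0.
Proof.
rewrite -[LHS]/(sgenE q GX *: (one : verma q lam z)) (@one_rel _ 0) ?scale0r //.
by rewrite subr0; constructor 2.
Qed.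
Let one_K : op GK one = lam *: one.
Proof. by apply: one_rel; constructor 3. Qed.
Let one_C : op GC one = z *: one.
Proof. by apply: one_rel; constructor 4. Qed.

Let verma_span (v : vsp (verma q lam z)) : in_span (pbw one) v.
Proof.
have [_ _ h] := pbw_submodule hq lam0 one_E one_X one_K one_C.
by have [s ->] := verma_gen v; apply: h; exact: (in_span_base (pbw one) (0%N, 0%N)).
Qed.

Let phi_op g (u : vsp (verma q lam z)) : phi (op g u) = op g (phi u : vsp M).
Proof. exact: phiZ. Qed.
Let phi_scale c (u : vsp (verma q lam z)) : phi (c *: u) = c *: (phi u : vsp M).
Proof. exact: phiZ. Qed.
Let phi_sub (u v : vsp (verma q lam z)) : phi (u - v) = (phi u : vsp M) - phi v.
Proof. by rewrite -scaleN1r phiD phi_scale scaleN1r. Qed.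

Let phi_kill s (u : vsp (verma q lam z)) :
  phi (kill (@op _ _ (verma q lam z) GK) s u) = kill (@op _ _ M GK) s (phi u).
Proof. by elim: s => // a s ih; rewrite !kill_cons phi_sub phi_op phi_scale ih. Qed.

Lemma bounded_phi v : bounded (phi v).
Proof.
have [_ _ h] := bounded_submodule; have [s ->] := verma_gen v.
rewrite phiZ phi_one; apply: h; exists 0%N => k j; rewrite /E00 /delta.
by have [->|] := eqVneq k 0; have [->|] := eqVneq j 0%N => //=; split.
Qed.

(** If phi u were nonzero, [model_reach] would give a vector of U over the generator of the model.
    Its component of weight lam is then the generator [one], and annihilating the other weights
    leaves a nonzero multiple of [one] in U. *)
Lemma proper_ker (U : verma q lam z -> Prop) u :
  submodule U -> ~ (forall w, U w) -> U u -> phi u = 0.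
Proof.
move=> Usub Uprop Uu; apply: contrapT => u0; apply: Uprop.
have [U0 UD UZ] := Usub.
pose U' (f : M) := exists2 v, U v & phi v = f.
have U'sub : submodule U'.
  split.
  - by exists 0 => //; rewrite /phi linear0.
  - by move=> _ _ [x hx <-] [y hy <-]; exists (x + y); [exact: UD|exact: phiD].
  - by move=> a _ [x hx <-]; exists (a *: x); [exact: UZ|exact: phiZ].
have [v Uv ev] : U' E00.
  by apply: (model_reach U'sub (bounded_phi u) u0); exists u.
have [c [s [hs e]]] := pbw_top hq lam0 one_K (verma_span v).
have lam_s : lam \notin [seq lam * q ^ (- n) | n <- s].
  apply/negP => /mapP [n hn /esym /eqP]; rewrite -{2}[lam]mulr1.
  move=> /eqP /(mulfI lam0) /(gen_pow hq) /eqP; rewrite oppr_eq0 => /eqP n0.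
  by rewrite n0 in hn; rewrite hn in hs.
have E00_eig : op GK ((1 - c) *: E00) = lam *: ((1 - c) *: E00).
  by rewrite opZ E00_K !scalerA mulrC.
(* After phi, (1 - c) times the generator has weight lam and is annihilated by factors for other
   weights only. *)
have c1 : c = 1.
  have := congr1 phi e; rewrite phi_kill phi_sub phi_scale ev phi_one.
  have -> : phi 0 = 0 by rewrite /phi linear0.
  rewrite -[X in X - _]scale1r -scalerBl => /(kill_eigen_neq0 E00_eig lam_s) /eqP.
  by rewrite scaler_eq0 => /orP [|/eqP /E00_neq0 //]; rewrite subr_eq0 => /eqP.
have Uk t x : U x -> U (kill (@op _ _ (verma q lam z) GK) t x).
  have [[UF0 UFD UFZ] Uop] := submodule_op Usub.
  elim: t => // a t ih /ih hx; rewrite kill_cons.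
  by apply: (submodule_ext Usub); [exact: Uop|exact: UFZ].
move: e; rewrite c1 scale1r (_ : v - one = v + (-1) *: one) ?scaleN1r //.
rewrite -[- one]scaleN1r killD killZ scaleN1r => /eqP; rewrite subr_eq0 => /eqP e.
have := Uk [seq lam * q ^ (- n) | n <- s] v Uv.
rewrite e (kill_eigen _ one_K); set p := \prod_(_ <- _) _ => Up.
have p0 : p != 0.
  apply/negP; rewrite prodf_seq_eq0 => /hasP [x hx] /=; rewrite subr_eq0.
  by move=> /eqP ex; rewrite -ex (negbTE lam_s) in hx.
have U1 : U one.
  have := UZ (scal q p^-1) _ Up; rewrite -[X in U X]/(p^-1 *: (p *: one)).
  by rewrite scalerA mulVf // scale1r.
by move=> w; have [x ->] := verma_gen w; exact: UZ.
Qed.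

(** The kernel of phi is itself proper, since phi maps [one] to a nonzero vector. It is therefore
    the largest proper submodule, and N(lam, z) embeds in the model. *)
Lemma proper_vectP v : proper_vect v <-> phi v = 0.
Proof.
split=> [[U [hU nU Uv]]|h]; first exact: (proper_ker hU nU Uv).
exists (fun v => phi v = 0); split=> //.
  split; first by rewrite /phi linear0.
    by move=> x y hx hy; rewrite phiD hx hy addr0.
  by move=> a x hx; rewrite phiZ hx scaler0.
by move/(_ one); rewrite phi_one.
Qed.

Definition Nphi : Nmod q lam z -> M := qlift (fun v => (proper_vectP v).1).
Definition Ntop : Nmod q lam z := qmod_pi _ (one : verma q lam z).

Lemma Nphi_linear : linear Nphi.
Proof. by move=> a x y; rewrite /Nphi linearP. Qed.

Lemma Nphi_ker x : Nphi x = 0 -> x = 0.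
Proof.
elim/qmod_ind: x => x; rewrite -![\pi_(qmod _) _]/(qmod_pi _ _) /Nphi qliftE.
move=> /proper_vectP h; rewrite -(linear0 (qmod_pi (@proper_vect _ _ (verma q lam z)))).
by apply/qmod_eq; rewrite subr0 => U _; apply.
Qed.

Lemma Nphi_top : Nphi Ntop = delta 0 0 :> mspace F.
Proof. by rewrite /Nphi /Ntop qliftE; exact: phi_one. Qed.

Lemma Nmod_gen (v : Nmod q lam z) : exists s : Sq q, v = s *: Ntop.
Proof.
elim/qmod_ind: v => x; have [s ->] := verma_gen x; exists s.
by rewrite -[LHS]/(qmod_pi _ _) linearZ_LR.
Qed.

Let piZ a (u : verma q lam z) :
  qmod_pi (@proper_vect _ _ (verma q lam z)) (a *: u) = a *: qmod_pi _ u.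
Proof. exact: linearZ_LR. Qed.
Lemma Ntop_E : op GE (Ntop : vsp (Nmod q lam z)) = 0.
Proof.
apply: etrans (esym (piZ (sgenE q GE) one)) _.
rewrite -[X in qmod_pi _ X]/(op GE one) one_E; exact: linear0.
Qed.
Lemma Ntop_X : op GX (Ntop : vsp (Nmod q lam z)) = 0.
Proof.
apply: etrans (esym (piZ (sgenE q GX) one)) _.
rewrite -[X in qmod_pi _ X]/(op GX one) one_X; exact: linear0.
Qed.
Lemma Ntop_K : op GK (Ntop : vsp (Nmod q lam z)) = lam *: (Ntop : vsp (Nmod q lam z)).
Proof.
apply: etrans (esym (piZ (sgenE q GK) one)) _.
rewrite -[X in qmod_pi _ X]/(op GK one) one_K; exact: piZ.
Qed.
Lemma Ntop_C : op GC (Ntop : vsp (Nmod q lam z)) = z *: (Ntop : vsp (Nmod q lam z)).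
Proof.
apply: etrans (esym (piZ (sgenE q GC) one)) _.
rewrite -[X in qmod_pi _ X]/(op GC one) one_C; exact: piZ.
Qed.

End SimpleQuotient.

(** * The localized and twisted module *)

Section TensorLift.
Variables (S A : pzRingType) (f : {rmorphism S -> A}) (V : lmodType S).
Implicit Types (u v : V) (t : tterm A V).

Lemma tens_scale a t : a *: \pi_(tens f V) t = \pi_(tens f V) (tact a t).
Proof. by apply/tens_eq; apply: tact_cong; apply: tcong_repr. Qed.
Lemma tens_plus s t : \pi_(tens f V) s + \pi_(tens f V) t = \pi_(tens f V) (TAdd s t).
Proof. by apply/tens_eq; apply: tcong_add; apply: tcong_repr. Qed.

Lemma tpureM a b v : tpure f (a * b) v = a *: tpure f b v.
Proof. by rewrite /tpure tens_scale. Qed.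
Lemma tpureZ a s v : tpure f (a * f s) v = tpure f a (s *: v).
Proof. by apply/tens_eq; apply: tcong_bal. Qed.
Lemma tpureDr a u v : tpure f a (u + v) = tpure f a u + tpure f a v.
Proof. by rewrite /tpure tens_plus; apply/tens_eq; apply: tcong_pureDr. Qed.
Lemma tpure1Z s v : tpure f 1 (s *: v) = f s *: tpure f 1 v.
Proof. by rewrite -tpureZ mul1r -tpureM mulr1. Qed.
Lemma tpure0r a : tpure f a (0 : V) = 0.
Proof. by apply: (addrI (tpure f a 0)); rewrite -tpureDr !addr0. Qed.

Lemma tpureB a u v : tpure f a (u - v) = tpure f a u - tpure f a v.
Proof.
rewrite tpureDr; congr (_ + _); apply/eqP; rewrite -addr_eq0 -tpureDr.
by rewrite addNr tpure0r.
Qed.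

Lemma tens_ind (P : tens f V -> Prop) :
  (forall x y, P x -> P y -> P (x + y)) -> (forall a v, P (tpure f a v)) ->
  forall x, P x.
Proof.
move=> PD P1; elim/tens_indpi; elim=> [a v|s hs t ht]; first exact: P1.
by rewrite -tens_plus; apply: PD.
Qed.

Variables (W : lmodType A) (phi : V -> W).
Hypothesis phiD : forall u v, phi (u + v) = phi u + phi v.
Hypothesis phiZ : forall s v, phi (s *: v) = f s *: phi v.

Fixpoint teval (t : tterm A V) : W :=
  match t with
  | TPure a v => a *: phi v
  | TAdd s t => teval s + teval t
  end.

Lemma teval_cong s t : tcong f s t -> teval s = teval t.
Proof.
elim=> {s t} //=.
- by move=> s t u _ -> _ ->.
- by move=> s s' t t' _ -> _ ->.
- by move=> s t u; rewrite addrA.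
- by move=> s t; rewrite addrC.
- by move=> s; rewrite scale0r add0r.
- by move=> a b v; rewrite scalerDl.
- by move=> a u v; rewrite phiD scalerDr.
- by move=> a s v; rewrite phiZ scalerA.
Qed.

Definition tlift (x : tens f V) : W := teval (repr x).

Lemma tlift_pi t : tlift (\pi_(tens f V) t) = teval t.
Proof. exact/teval_cong/tcong_repr. Qed.

Lemma tlift_pure a v : tlift (tpure f a v) = a *: phi v.
Proof. exact: tlift_pi. Qed.

Lemma tliftD x y : tlift (x + y) = tlift x + tlift y.
Proof.
elim/tens_indpi: x => s; elim/tens_indpi: y => t.
by rewrite tens_plus !tlift_pi.
Qed.

Lemma tliftZ a x : tlift (a *: x) = a *: tlift x.
Proof.
elim/tens_indpi: x => t; rewrite tens_scale !tlift_pi.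
by elim: t => [b v|s hs t ht] /=; rewrite ?scalerA // scalerDr hs ht.
Qed.

End TensorLift.

(** * A basis of the twisted module *)

Section Twist.
Variables (F : fieldType) (q : F) (hq : generic q) (z lam : F) (d : nat).
Hypotheses (z0 : z != 0) (lam0 : lam != 0) (d0 : (0 < d)%N).
Hypothesis hlam : lam ^+ 2 = q ^ (2 * d%:Z - 3).
Local Notation zeta := (z / (q - 1)).
Local Notation N := (Nmod q lam z).
Local Notation i := (SqY_in q).
Local Notation g := (sgenE q).
Local Notation yi := (Yinv q).
Local Notation TS := (tens i N).
Local Notation ops := (@op F q N).

Let one : N := Ntop q z lam.

Lemma yyi : i (g GY) * yi = 1. Proof. exact: loc_mulV. Qed.
Lemma yiy : yi * i (g GY) = 1. Proof. exact: loc_mulVl. Qed.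

Definition YZ (k : int) : SqY q :=
  match k with Posz n => i (g GY) ^+ n | Negz n => yi ^+ n.+1 end.

Lemma YZS k : i (g GY) * YZ k = YZ (k + 1).
Proof.
case: k => [n|[|n]].
- by rewrite -PoszD addn1 /= exprS.
- by rewrite /= expr1 yyi.
- have -> : Negz n.+1 + 1 = Negz n by rewrite !NegzE; lia.
  by rewrite /= exprS mulrA yyi mul1r.
Qed.

Lemma YZP k : yi * YZ k = YZ (k - 1).
Proof. by rewrite -{1}[k](subrK 1) -YZS mulrA yiy mul1r. Qed.

Lemma Fyi : i (g GF) * yi = yi * i (g GF).
Proof.
have FY : g GF * g GY = g GY * g GF by exact: (Sq_relP (Sq_FY q)).
rewrite -[LHS]mul1r -yiy -!mulrA [i (g GY) * _]mulrA -rmorphM -FY rmorphM.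
by rewrite -!mulrA yyi mulr1.
Qed.

Lemma FYZ k : i (g GF) * YZ k = YZ k * i (g GF).
Proof.
elim/int_shift_ind: k => [|k ih|k ih]; first by rewrite /= !expr0 mulr1 mul1r.
- have FY : g GF * g GY = g GY * g GF by exact: (Sq_relP (Sq_FY q)).
  by rewrite -YZS mulrA -rmorphM FY rmorphM -mulrA ih mulrA.
- by rewrite -[k](addrK 1) -YZP mulrA Fyi -mulrA ih mulrA.
Qed.

(** These vectors do not involve b; the twist only changes the action on them. *)
Definition vtw (k : int) (l : nat) : TS := YZ k *: tpure i 1 (iter l (@ops GF) one).

Lemma vtw_Y k l : i (g GY) *: vtw k l = vtw (k + 1) l.
Proof. by rewrite /vtw scalerA YZS. Qed.
Lemma vtw_yi k l : yi *: vtw k l = vtw (k - 1) l.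
Proof. by rewrite /vtw scalerA YZP. Qed.
Lemma vtw_F k l : i (g GF) *: vtw k l = vtw k l.+1.
Proof. by rewrite /vtw scalerA FYZ -scalerA -tpure1Z. Qed.
Lemma vtw0 : vtw 0 0 = tpure i 1 one.
Proof. by rewrite /vtw /= expr0 scale1r. Qed.

Lemma one_op s u : s *: one = u -> i s *: vtw 0 0 = tpure i 1 u.
Proof. by move=> <-; rewrite vtw0 tpure1Z. Qed.

Lemma vtw_K : i (g GK) *: vtw 0 0 = i (scal q lam) *: vtw 0 0.
Proof. by rewrite (one_op (Ntop_K q z lam)) vtw0 -tpure1Z. Qed.
Lemma vtw_X : i (g GX) *: vtw 0 0 = 0.
Proof. by rewrite (one_op (Ntop_X q z lam)) tpure0r. Qed.
Lemma vtw_E : i (g GE) *: vtw 0 0 = 0.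
Proof. by rewrite (one_op (Ntop_E q z lam)) tpure0r. Qed.

Lemma tens_C (x : TS) : i (g GC) *: x = i (scal q z) *: x.
Proof.
elim/tens_ind: x => [x y hx hy|a n]; first by rewrite !scalerDr hx hy.
rewrite -!tpureM (loc_central (@C_central _ q)).
rewrite (loc_central (@scal_central _ q z)) !tpureZ; congr tpure.
have [s ->] := Nmod_gen n; rewrite !scalerA C_central scal_central -!scalerA.
by congr (s *: _); exact: (Ntop_C q z lam).
Qed.

Lemma Y_inj (x y : TS) : i (g GY) *: x = i (g GY) *: y -> x = y.
Proof.
by move=> /(congr1 (fun u => yi *: u)); rewrite !scalerA yiy !scale1r.
Qed.

(* [twistB hq b0 N] has the same elements as [TS]. *)
Section FixB.
Variables (b : F) (b0 : b != 0).
Local Notation T := (twistB hq b0 N).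

Lemma twist_op h (x : vsp T) : op h x = theta_gen b i yi h *: (x : TS).
Proof. by rewrite -Theta_gen. Qed.

Lemma twist_scale c (x : vsp T) : c *: x = i (scal q c) *: (x : TS).
Proof. by rewrite -(Theta_scal hq b0). Qed.

Local Notation v := (vtw : int -> nat -> vsp T).

Lemma twist_C (x : vsp T) : op GC x = z *: x.
Proof. by rewrite twist_op twist_scale tens_C. Qed.
Lemma twist_Y k l : op GY (v k l) = v (k + 1) l.
Proof. by rewrite twist_op vtw_Y. Qed.
Lemma twist_F k l : op GF (v k l) = v k l.+1.
Proof. by rewrite twist_op vtw_F. Qed.
Lemma twist_Yinj : injective (fun x : vsp T => op GY x).
Proof. by move=> x y /=; rewrite !twist_op => /Y_inj. Qed.
Lemma twist_K : op GK (v 0 0) = (lam / b) *: v 0 0.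
Proof.
rewrite twist_op twist_scale /= -scalerA vtw_K scalerA -!rmorphM.
by rewrite [b^-1 * _]mulrC.
Qed.
(** X and E kill the generator, so only the terms of Theta_b in C Y^-1, here, and in C Y^-2, for E,
    survive. *)
Lemma twist_X : op GX (v 0 0) = (zeta * (1 - b)) *: v (-1) 0.
Proof.
rewrite twist_op twist_scale /= scalerBl -!scalerA vtw_X scaler0 sub0r.
rewrite vtw_yi tens_C sub0r scalerA -!rmorphM -scaleNr -!rmorphN.
by congr (i (scal q _) *: _); qfield hq.
Qed.
Lemma twist_E : op GE (v 0 0) =
  ((q + q ^+ 2 - b^-1 * q ^+ 2 - b * q) / (q ^+ 2 - 1) * zeta) *: v (- 2) 0.
Proof.
rewrite twist_op twist_scale /= !scalerBl !scalerDl -!scalerA vtw_X vtw_E.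
rewrite !scaler0 add0r sub0r.
rewrite !vtw_yi tens_C (_ : 0 - 1 - 1 = -2) //.
rewrite scalerA -!rmorphM -scaleNr -!rmorphN.
by congr (i (scal q _) *: _); qfield hq; rewrite b0.
Qed.

Local Notation tau := (etau q (lam / b) (- (zeta * b))).
Local Notation e := (efam tau v).

Local Notation ML :=
  (model_loc hq lam0 (Nh_neq0 hq z0) d0 (Nlow hq z0 lam0 d0 hlam)).
Let phi : N -> ML := Nphi hq z0 lam0 d0 hlam.

Let phiD (u w : N) : phi (u + w) = phi u + phi w.
Proof. by have := Nphi_linear hq z0 lam0 d0 hlam 1 u w; rewrite !scale1r. Qed.
Let phi0 : phi 0 = 0.
Proof. by apply: (addrI (phi 0)); rewrite -phiD !addr0. Qed.
Let phiZ s (w : N) : phi (s *: w) = i s *: phi w.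
Proof.
have := Nphi_linear hq z0 lam0 d0 hlam s w 0.
rewrite addr0 -/(phi _) => ->; rewrite -[Nphi _ _ _ _ _ 0]/(phi 0) phi0 addr0.
by rewrite [RHS]model_locE.
Qed.

(** As Y is invertible on the model, the embedding of N extends to the tensor product. It ignores
    the twist, but F, Y and the scalars are fixed by Theta_b, and the recursion for [e] uses nothing
    else. *)
Let Phi : TS -> ML := tlift phi.

Let Phi_gen h (x : TS) : Phi (i (g h) *: x) =
  model_op q z lam (- zeta) d h (Phi x : mspace F) :> mspace F.
Proof. by rewrite [LHS](tliftZ phiD phiZ) [LHS]model_locE [LHS]model_opE. Qed.
Let Phi_F (x : vsp T) : Phi (op GF x) =
  model_op q z lam (- zeta) d GF (Phi x : mspace F) :> mspace F.
Proof. by rewrite twist_op; exact: Phi_gen. Qed.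
Let Phi_scale c (x : vsp T) : Phi (c *: x) = c *: (Phi x : mspace F) :> mspace F.
Proof.
by rewrite twist_scale [LHS](tliftZ phiD phiZ) [LHS]model_locE [LHS]model_scalE.
Qed.
Let Phi_sub (x y : vsp T) :
  Phi (x - y) = (Phi x : mspace F) - (Phi y : mspace F) :> mspace F.
Proof.
rewrite -[- y]scaleN1r; apply: etrans (tliftD phiD phiZ x _) _.
by rewrite -scaleN1r; congr (_ + _); exact: Phi_scale.
Qed.

Let Phi_v k : Phi (v k 0) = delta F k 0 :> mspace F.
Proof.
have P0 : Phi (v 0 0) = delta F 0 0 :> mspace F.
  rewrite [v 0 0]vtw0 [LHS](tlift_pure phiD phiZ) scale1r.
  exact: (Nphi_top hq z0 lam0 d0 hlam).
elim/int_shift_ind: k => [|k ih|k ih] //.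
  rewrite -[v _ _]vtw_Y [LHS]Phi_gen ih; apply: funext => k'; apply: funext => j'.
  rewrite /= /delta; congr ((_ && _)%:R); lia.
rewrite -[k](addrK 1) -[v _ _]vtw_yi [LHS](tliftZ phiD phiZ) [LHS]model_loc_inv.
rewrite -[tlift _ _]/(Phi (v (k + 1) 0)) ih; apply: funext => k'; apply: funext => j'.
by rewrite /model_yinv /delta; congr ((_ && _)%:R); lia.
Qed.

Let tauE : tau = etau q lam (- zeta).
Proof.
rewrite (efam_tauE hq z0 b0 lam0); have := efam_tauE hq z0 (oner_neq0 F) lam0.
by rewrite divr1 mulr1 => ->.
Qed.

(** tau is the same for the twisted module and for the untwisted model, so both recursions agree, up
    to the cut of F at d. *)
Let Phi_e k j : Phi (e k j) = edelta F d k j :> mspace F.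
Proof.
elim: j k => [|j ih] k; first by rewrite /edelta d0; exact: Phi_v.
rewrite [e k j.+1]/= Phi_sub Phi_scale Phi_F !ih tauE; set tau' := etau _ _ _.
apply: funext => k'; apply: funext => j'.
have mB (f f' : mspace F) : (f - f') k' j' = f k' j' - f' k' j' :> F by [].
rewrite mB {mB} mspaceZ /= /edelta; case: (ltnP j d) => jd; last first.
  rewrite ltnNge (leq_trans jd (leqnSn _)) /=.
  by case: j' => [|j']; rewrite !mulr0 ?addr0 subr0.
have -> : (delta F (k - 2) j (k' - 2) j') = delta F k j k' j'.
  by rewrite /delta; congr ((_ && _)%:R); lia.
have -> : tau' * (q ^+ j') ^+ 2 * delta F k j k' j' =
    tau' * (q ^+ j) ^+ 2 * delta F k j k' j'.
  by rewrite /delta; have [->//|_] := eqVneq j' j; rewrite andbF !mulr0.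
rewrite addrK; case: (ltnP j.+1 d) => jd'; last first.
  case: j' => [|j'] /=; first by rewrite mulr0.
  have [->|jj] := eqVneq j' j; last by rewrite /delta (negbTE jj) andbF mulr0.
  by rewrite (_ : j.+1 == d) ?mul0r //; apply/eqP; lia.
case: j' => [|j'] /=; first by rewrite mulr0 /delta andbF.
rewrite /delta eqSS (_ : (k' - 2 == k - 2) = (k' == k)); last by lia.
have [->|jj] := eqVneq j' j; last by rewrite andbF mulr0.
by rewrite (_ : j.+1 != d) ?mul1r //; lia.
Qed.

(** At k = 2 j no negative power of Y occurs. The vanishing of [e (2 d) d] can thus be tested in N,
    where [Nphi] is injective; other k follow by applying or cancelling Y. *)
Let pure_e j : exists n : N, e (2 * j%:Z) j = tpure i 1 n.
Proof.
elim: j => [|j [n hn]]; first by exists one; exact: vtw0.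
exists (ops GF n - (tau * (q ^+ j) ^+ 2) *: ops GY (ops GY n)).
rewrite [e _ j.+1]/= (_ : 2 * j.+1%:Z - 2 = 2 * j%:Z); last by lia.
have eY := efam_opY (etau q (lam / b) (- (zeta * b))) twist_Y.
rewrite (_ : 2 * j.+1%:Z = 2 * j%:Z + 1 + 1); last by lia.
rewrite -!eY hn !twist_op twist_scale /= -!tpure1Z.
by apply/esym; apply: etrans (tpureB _ _ _ _) _.
Qed.

Lemma twist_e0 k : e k d = 0.
Proof.
have [n hn] := pure_e d.
have n0 : n = 0.
  apply: (@Nphi_ker _ _ hq _ _ _ z0 lam0 d0 hlam); have := Phi_e (2 * d%:Z) d.
  rewrite hn /edelta ltnn; move=> h; rewrite -[RHS]h.
  by apply/esym; apply: etrans (tlift_pure phiD phiZ _ _) _; rewrite scale1r.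
have eY := efam_opY (etau q (lam / b) (- (zeta * b))) twist_Y.
rewrite -[k](subrK (2 * d%:Z)); elim/int_shift_ind: (k - 2 * d%:Z) => [|m ih|m ih].
- by rewrite add0r hn n0 tpure0r.
- by rewrite addrAC -eY ih op0.
- by apply: twist_Yinj; rewrite /= eY op0 addrAC.
Qed.

Lemma twist_e_neq0 j : (j < d)%N -> e 0 j <> 0.
Proof.
move=> jd e0; have := Phi_e 0 j; rewrite e0 /edelta jd.
move=> /(congr1 (fun f : mspace F => f 0 j)).
have -> : Phi (0 : vsp T) = 0 :> mspace F.
  by have := Phi_scale 0 0; rewrite !scale0r.
by rewrite /delta !eqxx /= => /esym /eqP; rewrite oner_eq0.
Qed.

Lemma twist_action : basis_action b z lam d (vtw : int -> nat -> T).
Proof.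
exact: (v_basis_action hq z0 b0 lam0 twist_C twist_Yinj twist_Y twist_F twist_K
  twist_X twist_E d0 twist_e0).
Qed.

Lemma twist_free : is_free (@fam (vsp T) d v).
Proof.
exact: (v_free hq z0 b0 lam0 twist_C twist_Yinj twist_Y twist_F twist_K
  twist_X twist_e_neq0).
Qed.
End FixB.

Let T0 : lmodType (Sq q) := restr i TS.
Let v0 : int -> nat -> vsp T0 := vtw.

(* [T0] is the case b = 1, and its span is stable under Y^-1. *)
Lemma tens_span (x : TS) : in_span (@fam (vsp T0) d v0) x.
Proof.
have hE h (y : vsp T0) : op h y = i (g h) *: (y : TS) by [].
have hS c (y : vsp T0) : c *: y = i (scal q c) *: (y : TS) by [].
have hC (y : vsp T0) : op GC y = z *: y by exact: tens_C.
have hinj : injective (fun y : vsp T0 => op GY y) by move=> y y' /Y_inj.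
have hY k l : op GY (v0 k l) = v0 (k + 1) l by exact: vtw_Y.
have hF k l : op GF (v0 k l) = v0 k l.+1 by exact: vtw_F.
have hK : op GK (v0 0 0) = (lam / 1) *: v0 0 0 by rewrite divr1; exact: vtw_K.
have hX : op GX (v0 0 0) = (zeta * (1 - 1)) *: v0 (-1) 0.
  by rewrite subrr mulr0 scale0r; exact: vtw_X.
have hEE : op GE (v0 0 0) =
    ((q + q ^+ 2 - 1^-1 * q ^+ 2 - 1 * q) / (q ^+ 2 - 1) * zeta) *: v0 (- 2) 0.
  rewrite invr1 !mul1r addrK subrr !mul0r scale0r; exact: vtw_E.
(* The operations of [T0] and of the twist by 1 agree by lemmas and not by conversion, so the
   vanishing is transported along the recursion. *)
have e0 k : efam (etau q (lam / 1) (- (zeta * 1))) v0 k d = 0.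
  rewrite -[RHS](twist_e0 (oner_neq0 F) k);
  set tau1 := etau _ _ _.
  pose v1 : int -> nat -> vsp (twistB hq (oner_neq0 F) N) := vtw.
  elim: (d) k => [|j ih] k; first by [].
  set c := tau1 * (q ^+ j) ^+ 2.
  pose st (x y : TS) : TS := i (g GF) *: x - i (scal q c) *: y.
  have s1 : efam tau1 v1 k j.+1 = st (efam tau1 v1 (k - 2) j) (efam tau1 v1 k j).
    apply: etrans (efamS _ _ _ _) _; apply: (congr2 (fun x y : TS => x - y)).
      exact: twist_op.
    exact: twist_scale.
  exact: etrans (congr2 st (ih (k - 2)) (ih k)) (esym s1).
have va : basis_action 1 z lam d (v0 : int -> nat -> T0).
  exact: (v_basis_action hq z0 (oner_neq0 F) lam0 hC hinj hY hF hK hX hEE d0 e0).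
have Usub := span_submodule hq (oner_neq0 F) lam0 d0 va.
have [U0 UD UZ] := in_span_submodule (@fam (vsp T0) d v0).
set U := in_span _ in Usub U0 UD UZ *.
have Uyi (y : TS) : U y -> U (yi *: y).
  case=> s [c ->]; rewrite scaler_sumr; apply: (@submodule_sum _ (vsp T0) U) => //.
  move=> [k l] _; rewrite /fam /= hS scalerA -(loc_central (@scal_central _ q (c (k, l)))).
  rewrite -scalerA vtw_yi; apply: (UZ (c (k, l))).
  exact: (@fam_in_span _ _ T0 _ v0 (k - 1) l (ltn_ord l)).
have UA (a : SqY q) (y : TS) : U y -> U (a *: y).
  elim/pres_ind: a y; elim=> [s|[]|s hs t ht|s hs t ht] y Uy.
  - by case: Usub => _ _ h; apply: (h s y).
  - exact: Uyi.
  - by rewrite pres_piD scalerDl; apply: UD; [exact: hs|exact: ht].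
  - by rewrite pres_piM -scalerA; apply: hs; exact: ht.
elim/tens_ind: x => [x y hx hy|a n]; first exact: UD.
have [s ->] := Nmod_gen n; rewrite -[a]mulr1 tpureM tpure1Z; apply: (UA); apply: (UA).
by rewrite -/one -vtw0; exact: (@fam_in_span _ _ T0 _ v0 0 0 d0).
Qed.

Lemma twist_span (b : F) (b0 : b != 0) (x : vsp (twistB hq b0 N)) :
  in_span (@fam (vsp (twistB hq b0 N)) d vtw) x.
Proof.
have [s [c e]] := tens_span x; exists s, c; rewrite e; apply: eq_bigr => j _.
by rewrite [RHS]twist_scale.
Qed.

End Twist.

(** * Finitely spanned subspaces *)

Section FiniteSpan.
Variables (F : fieldType) (V : lmodType F) (W : V -> Prop) (n : nat) (e : 'I_n -> V).
Hypothesis We : forall w, W w -> exists c : 'I_n -> F, w = \sum_(i < n) c i *: e i.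

Lemma span_dep (u : nat -> V) : (forall i, W (u i)) ->
  exists a : nat -> F, (exists2 i, (i <= n)%N & a i != 0) /\
    \sum_(i < n.+1) a i *: u i = 0.
Proof.
move=> Wu; have [c hc] := choice (fun i => We (Wu i)).
pose M : 'M[F]_(n.+1, n) := \matrix_(i, j) c i j.
have : kermx M != 0.
  by rewrite -mxrank_eq0 mxrank_ker -lt0n subn_gt0 (leq_ltn_trans (rank_leq_col M)).
case/rowV0Pn => r /sub_kermxP rM r0.
exists (fun i => r 0 (inord i)); split.
  have [i hi] : exists i, r 0 i != 0.
    apply/existsP; apply: contraR r0; rewrite negb_exists => /forallP h.
    by apply/eqP/rowP => i; rewrite mxE; apply/eqP; move: (h i); rewrite negbK.
  by exists i; rewrite ?inord_val // -ltnS.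
rewrite (eq_bigr (fun i : 'I_n.+1 => \sum_(j < n) (r 0 i * M i j) *: e j)).
  rewrite exchange_big big1 //= => j _; rewrite -scaler_suml.
  have := congr1 (fun A : 'rV_n => A 0 j) rM; rewrite !mxE => ->.
  exact: scale0r.
move=> i _; rewrite inord_val hc scaler_sumr; apply: eq_bigr => j _.
by rewrite scalerA mxE.
Qed.

(** [B m] is applied to a linear relation among the [u i], with m the largest index of a nonzero
    coefficient. *)
Lemma span_triangular (V' : lmodType F) (u : nat -> V) (B : nat -> V -> V') :
  (forall m, linear (B m)) -> (forall i, W (u i)) ->
  (forall m i, (i < m)%N -> B m (u i) = 0) -> (forall m, B m (u m) <> 0) -> False.
Proof.
move=> Bl Wu B0 B1; have [a [[i0 hi0 ai0] s0]] := span_dep Wu.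
have ex : exists i, (i <= n)%N && (a i != 0) by exists i0; rewrite hi0.
have [m /andP [mn am] hmax] := ex_maxnP ex (fun i h => proj1 (andP h)).
have B00 : B m 0 = 0.
  by have := Bl m (-1) 0 0; rewrite scaler0 addr0 scaleN1r addNr.
have BD x y : B m (x + y) = B m x + B m y.
  by have := Bl m 1 x y; rewrite !scale1r.
have BZ c x : B m (c *: x) = c *: B m x.
  by have := Bl m c x 0; rewrite B00 !addr0.
have := congr1 (B m) s0; rewrite B00 (big_morph _ BD B00).
have mn1 : (m < n.+1)%N by [].
rewrite (bigD1 (Ordinal mn1)) //= big1 ?addr0.
  by rewrite BZ => /eqP; rewrite scaler_eq0 (negbTE am) => /eqP /B1.
move=> i hi; rewrite BZ; have [im|mi] := ltnP i m; first by rewrite B0 // scaler0.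
have mi' : (m < i)%N by rewrite ltn_neqAle mi andbT eq_sym.
have [->|ai] := eqVneq (a i) 0; first exact: scale0r.
by have := hmax i; rewrite -ltnS ltn_ord ai => /(_ isT); rewrite leqNgt mi'.
Qed.

Variable A : {linear V -> V}.
Hypothesis WA : forall w, W w -> W (A w).
Hypotheses (W0 : W 0) (WD : forall u v, W u -> W v -> W (u + v)).
Hypothesis WZ : forall c u, W u -> W (c *: u).

Lemma Witer w i : W w -> W (iter i A w).
Proof. by move=> Ww; elim: i => //= i; exact: WA. Qed.

(** A relation among w, A w, A^2 w, ... with zero constant term can be divided by A; once the
    constant term is nonzero it exhibits w as an image. *)
Lemma surj_of_inj : (forall w, W w -> A w = 0 -> w = 0) ->
  forall w, W w -> exists2 w', W w' & A w' = w.
Proof.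
move=> Ainj w Ww.
have Wsum (a : nat -> F) m : W (\sum_(i < m) a i *: iter i A w).
  by elim/big_ind: _ => // i _; apply: (WZ); apply: Witer.
have [a [[i hi ai] s0]] := span_dep (fun i => Witer i Ww).
elim: (n) a i hi ai s0 => [|m ih] a i hi ai.
  have ei : i = 0%N by lia.
  rewrite ei in ai.
  rewrite big_ord1 /= => /eqP; rewrite scaler_eq0 (negbTE ai) => /eqP ->.
  by exists 0 => //; rewrite linear0.
rewrite big_ord_recl /=.
have -> : \sum_(i < m.+1) a (bump 0 i) *: A (iter i A w) =
    A (\sum_(i < m.+1) a i.+1 *: iter i A w).
  by rewrite linear_sum; apply: eq_bigr => j _; rewrite linearZ_LR.
have [a0|a0] := eqVneq (a 0%N) 0.
  rewrite a0 scale0r add0r => /(Ainj _ (Wsum (fun i => a i.+1) _)).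
  case: i hi ai => [|i] hi ai; first by rewrite a0 eqxx in ai.
  exact: (ih (fun i => a i.+1) i).
move/eqP; rewrite addr_eq0 => /eqP h.
exists (- (a 0%N)^-1 *: \sum_(i < m.+1) a i.+1 *: iter i A w).
  by apply: (WZ); apply: (Wsum (fun i => a i.+1)).
rewrite linearZ_LR scaleNr -scalerN -h scalerA mulVf //.
exact: scale1r.
Qed.

End FiniteSpan.

Section Eigenvector.
Variables (F : closedFieldType) (V : lmodType F) (W : V -> Prop).
Variables (n : nat) (e : 'I_n -> V) (A : {linear V -> V}).
Hypothesis We : forall w, W w -> exists c : 'I_n -> F, w = \sum_(i < n) c i *: e i.
Hypothesis WA : forall w, W w -> W (A w).
Hypotheses (WD : forall u v, W u -> W v -> W (u + v)).
Hypothesis WZ : forall c u, W u -> W (c *: u).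

Let pev w m (p : {poly F}) := \sum_(i < m) p`_i *: iter i A w.

Let pev_kill w r : pev w (size r).+1 (\prod_(a <- r) ('X - a%:P)) = kill A r w.
Proof.
elim: r => [|a r ih]; first by rewrite big_nil /pev big_ord1 coef1 scale1r.
rewrite big_cons kill_cons -ih /pev mulrBl; set p := \prod_(_ <- _) _.
rewrite (eq_bigr (fun i : 'I_(size r).+2 =>
   ('X * p)`_i *: iter i A w - a *: (p`_i *: iter i A w))); last first.
  by move=> i _; rewrite coefB coefCM scalerBl scalerA.
rewrite big_split /= sumrN -scaler_sumr; congr (_ - _ *: _).
  rewrite big_ord_recl coefXM scale0r add0r linear_sum.
  by apply: eq_bigr => i _; rewrite coefXM linearZ_LR.
rewrite big_ord_recr /= [X in _ + X](_ : _ = 0) ?addr0 //.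
by rewrite nth_default ?scale0r // size_prod_XsubC.
Qed.

(** A polynomial in A annihilating w splits into linear factors; the last partial product applied to
    w that is still nonzero is an eigenvector. *)
Lemma exists_eigenvector w : W w -> w <> 0 ->
  exists v a, [/\ W v, v <> 0 & A v = a *: v].
Proof.
move=> Ww w0; have Wi i : W (iter i A w) by apply: Witer.
have [a [[i hi ai] s0]] := span_dep We Wi.
pose p := \poly_(i < n.+1) a i.
have p0 : p != 0.
  apply: contra ai => /eqP h; have := congr1 (fun t : {poly F} => t`_i) h.
  by rewrite coef_poly ltnS hi coef0 => ->.
have [r hr] := closed_field_poly_normal p.
have sz : ((size r).+1 <= n.+1)%N.
  rewrite -(size_prod_XsubC r id) -(size_scale _ (_ : lead_coef p != 0)).
    by rewrite -hr size_poly.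
  by rewrite lead_coef_eq0.
have pr : pev w (size r).+1 p = 0.
  rewrite -[RHS]s0 /pev -(subnKC sz) big_split_ord /= [X in _ = _ + X]big1.
    rewrite addr0; apply: eq_bigr => j _; congr (_ *: _).
    by rewrite coef_poly (leq_trans (ltn_ord j) sz).
  move=> j _; rewrite [a _](_ : _ = 0) ?scale0r //.
  have -> : a ((size r).+1 + j)%N = p`_((size r).+1 + j).
    by rewrite coef_poly -ltn_subRL ltn_ord.
  rewrite nth_default // hr size_scale ?lead_coef_eq0 // size_prod_XsubC.
  exact: leq_addr.
have {pr} : kill A r w = 0.
  rewrite -pev_kill; move: pr; rewrite hr /pev.
  rewrite (eq_bigr (fun j : 'I_(size r).+1 => lead_coef p *:
    ((\prod_(z <- r) ('X - z%:P))`_j *: iter j A w))); last first.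
    by move=> j _; rewrite coefZ scalerA.
  rewrite -scaler_sumr => /eqP; rewrite scaler_eq0 lead_coef_eq0 (negbTE p0).
  by move/eqP.
have Wkill s : W (kill A s w).
  elim: s => //= b s ih; rewrite -scaleNr; apply: (WD); [exact: WA|exact: WZ].
elim: {hr sz} r => [|b r ih] //; rewrite kill_cons => h.
case: (pselect (kill A r w = 0)) => [/ih //|kr].
exists (kill A r w), b; split=> //.
by apply/eqP; rewrite -subr_eq0 h.
Qed.

End Eigenvector.

(** * Modules in the class N *)

Section WeightVectors.
Variables (F : fieldType) (q : F) (hq : generic q) (V : lmodType (Sq q)).
Let q0 := gen_neq0 hq.
Local Notation W := (vsp V).
Implicit Types v w u : W.
Local Notation oC := (@op _ _ V GC).
Local Notation oE := (@op _ _ V GE).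
Local Notation oF := (@op _ _ V GF).
Local Notation oK := (@op _ _ V GK).
Local Notation oKi := (@op _ _ V GKi).
Local Notation oX := (@op _ _ V GX).
Local Notation oY := (@op _ _ V GY).

Lemma op_iterZ (g : sgen) n c v :
  iter n (@op _ _ V g) (c *: v) = c *: iter n (@op _ _ V g) v.
Proof. by elim: n => //= n ->; rewrite opZ. Qed.
Lemma op_iter0 (g : sgen) n : iter n (@op _ _ V g) 0 = 0.
Proof. by elim: n => //= n ->; rewrite op0. Qed.
Lemma op_iter_linear (g : sgen) n : linear (iter n (@op _ _ V g)).
Proof. by move=> c u v; elim: n => //= n ->; rewrite !opL. Qed.

Definition wt mu v := oK v = mu *: v.

Lemma wtZ mu c v : wt mu v -> wt mu (c *: v).
Proof. by rewrite /wt opZ => ->; rewrite !scalerA mulrC. Qed.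
Lemma wtD mu u v : wt mu u -> wt mu v -> wt mu (u + v).
Proof. by rewrite /wt opD => -> ->; rewrite scalerDr. Qed.
Lemma wtB mu u v : wt mu u -> wt mu v -> wt mu (u - v).
Proof. by rewrite /wt opB => -> ->; rewrite scalerBr. Qed.
Lemma wt0 mu : wt mu 0.
Proof. by rewrite /wt op0 scaler0. Qed.
Lemma wtE mu v : wt mu v -> wt (q ^+ 2 * mu) (oE v).
Proof. by rewrite /wt opKE => ->; rewrite opZ scalerA. Qed.
Lemma wtF mu v : wt mu v -> wt (q ^- 2 * mu) (oF v).
Proof. by rewrite /wt opKF => ->; rewrite opZ scalerA. Qed.
Lemma wtX mu v : wt mu v -> wt (q * mu) (oX v).
Proof. by rewrite /wt opKX => ->; rewrite opZ scalerA. Qed.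
Lemma wtY mu v : wt mu v -> wt (q^-1 * mu) (oY v).
Proof. by rewrite /wt opKY => ->; rewrite opZ scalerA. Qed.
Lemma wt_iter (g : sgen) c mu n v :
  (forall nu u, wt nu u -> wt (c * nu) (@op _ _ V g u)) ->
  wt mu v -> wt (c ^+ n * mu) (iter n (@op _ _ V g) v).
Proof.
move=> h hv; elim: n => [|n ih] /=; first by rewrite expr0 mul1r.
by rewrite exprS -mulrA; apply: h.
Qed.

Section Central.
Variable z : F.
Hypothesis hC : forall v, oC v = z *: v.

Lemma YXE v : oY (oX v) = q^-1 *: (oX (oY v) + z *: v).
Proof. by rewrite opXY hC subrK scalerA mulVf // scale1r. Qed.

(** X and Y form a q-oscillator with vacuum v; the coefficient is nonzero as soon as z is. *)
Lemma YX_chain v n : oY v = 0 ->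
  oY (iter n.+1 oX v) = (z * (q ^+ n.+1 - 1) / (q ^+ n.+1 * (q - 1))) *: iter n oX v.
Proof.
move=> Yv; elim: n => [|n ih].
  rewrite /= YXE Yv op0 add0r scalerA; congr (_ *: _).
  by rewrite expr1; qfield hq.
rewrite [iter n.+2 _ _]/= YXE ih opZ -[oX (iter n _ _)]/(iter n.+1 oX v).
rewrite -scalerDl scalerA; congr (_ *: _).
rewrite (exprS q n.+1); have x0 := expf_neq0 n.+1 q0.
by move: (q ^+ n.+1) x0 => x x0; qfield hq; rewrite x0.
Qed.

Lemma XY_chain v n : oX v = 0 ->
  oX (iter n.+1 oY v) = (- (z * (q ^+ n.+1 - 1) / (q - 1))) *: iter n oY v.
Proof.
move=> Xv; elim: n => [|n ih].
  rewrite /= opXY Xv op0 scaler0 sub0r hC -scaleNr; congr (_ *: _).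
  by rewrite expr1; qfield hq.
rewrite [iter n.+2 _ _]/= opXY ih hC opZ -[oY (iter n _ _)]/(iter n.+1 oY v).
rewrite scalerA -scalerBl; congr (_ *: _).
rewrite (exprS q n.+1); move: (q ^+ n.+1) => x; by qfield hq.
Qed.
End Central.

(** The substitute for [YX_chain] when z = 0: Y turns one factor E into a factor X, with a
    coefficient free of z. [XF_chain] is its counterpart for [XY_chain]. *)
Lemma YE_chain v n : oY v = 0 ->
  oY (iter n.+1 oE v) =
  (- (q * (q ^+ (2 * n.+1) - 1) / (q ^+ 2 - 1))) *: oX (iter n oE v).
Proof.
have YEE w : oY (oE w) = q *: (oE (oY w) - oX w).
  by rewrite opEY addrC addKr scalerA mulfV // scale1r.
move=> Yv; elim: n => [|n ih].
  rewrite /= YEE Yv op0 sub0r scalerN -scaleNr; congr (_ *: _).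
  by rewrite muln1; qfield hq.
rewrite [iter n.+2 _ _]/= YEE ih opZ opEX -[oE (iter n _ _)]/(iter n.+1 oE v).
vect (F : pzRingType); rewrite (mulnS 2 n.+1) exprD.
by move: (q ^+ (2 * n.+1)) => x; qfield hq.
Qed.

Lemma XF_chain mu v n : mu != 0 -> wt mu v -> oX v = 0 ->
  oX (iter n.+1 oF v) =
  (- (mu^-1 * (q ^+ (2 * n.+1) - 1) / (q ^+ 2 - 1))) *: oY (iter n oF v).
Proof.
move=> mu0 wv Xv; elim: n => [|n ih].
  rewrite /= opXF Xv op0 sub0r (opKi_eigen mu0 wv) opZ -scaleNr; congr (_ *: _).
  by rewrite muln1; qfield hq; rewrite mu0.
rewrite [iter n.+2 _ _]/= opXF ih opZ opFY -[oF (iter n _ _)]/(iter n.+1 oF v).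
have w1 : wt ((q ^- 2) ^+ n.+1 * mu) (iter n.+1 oF v) by apply: wt_iter wv => nu u; exact: wtF.
rewrite (opKi_eigen _ w1); last by rewrite mulf_neq0 // expf_neq0 // invr_neq0 // expf_neq0.
rewrite opZ -scalerBl; congr (_ *: _).
rewrite exprVn -exprM (mulnS 2 n.+1) exprD; have x0 := expf_neq0 (2 * n.+1) q0.
by move: (q ^+ (2 * n.+1)) x0 => x x0; qfield hq; rewrite ?x0 ?mu0.
Qed.

Lemma pow_sub1_neq0 n : (0 < n)%N -> q ^+ n - 1 != 0.
Proof. by move=> n0; rewrite subr_eq0; case: hq => _; exact. Qed.

(** Each A removes one B and leaves one D, past which further A move up to nonzero factors. D is the
    identity for z nonzero, and X or Y for z = 0. *)
Lemma chain_power (A B : sgen) (D : W -> W) v (c d : nat -> F) :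
  (forall n, c n != 0) -> (forall n, d n != 0) ->
  (forall k w, D (k *: w) = k *: D w) ->
  (forall n, op A (iter n.+1 (@op _ _ V B) v) = c n *: D (iter n (@op _ _ V B) v)) ->
  (forall n w, iter n (@op _ _ V A) (D w) = d n *: D (iter n (@op _ _ V A) w)) ->
  forall n, exists2 k, k != 0 &
    iter n (@op _ _ V A) (iter n (@op _ _ V B) v) = k *: iter n D v.
Proof.
move=> c0 dn0 DZ hAB hAD; elim=> [|n [k k0 ih]].
  by exists 1; rewrite ?oner_neq0 ?scale1r.
exists (c n * d n * k); first by rewrite !mulf_neq0.
by rewrite iterSr hAB op_iterZ hAD ih DZ !scalerA.
Qed.

End WeightVectors.

(** * Injectivity and surjectivity in the class N *)

Section ClassN.
Variables (F : closedFieldType) (q : F) (hq : generic q) (V : lmodType (Sq q)).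
Hypothesis hN : class_N V.
Let q0 := gen_neq0 hq.
Local Notation W := (vsp V).
Implicit Types v w u : W.
Local Notation oC := (@op _ _ V GC).
Local Notation oE := (@op _ _ V GE).
Local Notation oF := (@op _ _ V GF).
Local Notation oK := (@op _ _ V GK).
Local Notation oKi := (@op _ _ V GKi).
Local Notation oX := (@op _ _ V GX).
Local Notation oY := (@op _ _ V GY).

Let simV : simple_module V. Proof. by case: hN => [[]]. Qed.

Lemma wt_fd mu : mu != 0 -> exists n (e : 'I_n -> W), forall w, wt mu w ->
  exists c : 'I_n -> F, w = \sum_(i < n) c i *: e i.
Proof.
by case: hN => [[_ _ hf] _] mu0; have [n [e [_ he]]] := hf mu mu0; exists n, e.
Qed.

Lemma wt_triangular mu (V' : lmodType F) (u : nat -> W) (B : nat -> W -> V') :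
  mu != 0 -> (forall m, linear (B m)) -> (forall i, wt mu (u i)) ->
  (forall m i, (i < m)%N -> B m (u i) = 0) -> (forall m, B m (u m) <> 0) -> False.
Proof. by move=> /wt_fd [n [e he]]; exact: span_triangular he V' u B. Qed.

(** Vectors with strictly increasing nilpotency order under A are independent, which one weight
    space cannot accommodate. *)
Lemma wt_absurd (A : sgen) mu (u : nat -> W) (m : nat -> nat) : mu != 0 ->
  (forall i, wt mu (u i)) -> (forall i j, (i < j)%N -> (m i < m j)%N) ->
  (forall i, iter (m i) (@op _ _ V A) (u i) <> 0) ->
  (forall i, iter (m i).+1 (@op _ _ V A) (u i) = 0) -> False.
Proof.
move=> mu0 hu hm h1 h0.
apply: (@wt_triangular mu W u (fun i => iter (m i) (@op _ _ V A)) mu0) => //.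
  by move=> i; exact: op_iter_linear.
move=> j i /hm ij; rewrite -(subnK ij) iterD h0; exact: op_iter0.
Qed.

Lemma weight_decomp v : exists (s : seq F) (w : F -> W),
  [/\ uniq s, forall mu, mu \in s -> mu != 0 /\ wt mu (w mu)
    & v = \sum_(mu <- s) w mu].
Proof. by case: hN => [[_ [h _] _] _]; exact: h. Qed.

Lemma weight_ind (P : W -> Prop) : (forall u v, P u -> P v -> P (u + v)) -> P 0 ->
  (forall mu v, mu != 0 -> wt mu v -> P v) -> forall v, P v.
Proof.
move=> PD P0 Pw v; have [s [w [us hs ->]]] := weight_decomp v.
rewrite big_seq; elim/big_ind: _ => // mu /hs [mu0 hw]; exact: Pw hw.
Qed.

(** The generator multiplies weights by the nonzero c, so the images of distinct weight components
    cannot cancel and each is zero. *)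
Lemma weight_ker (g : sgen) (c : F) v : c != 0 ->
  (forall mu u, wt mu u -> wt (c * mu) (@op _ _ V g u)) ->
  op g v = 0 -> v <> 0 -> exists u mu, [/\ mu != 0, u <> 0, wt mu u & op g u = 0].
Proof.
move=> c0 hg gv v0; have [s [w [us hs e]]] := weight_decomp v.
have [mu hmu wmu] : exists2 mu, mu \in s & w mu <> 0.
  apply: contrapT => h; apply: v0; rewrite e big1_seq // => mu /andP [_ hmu].
  by apply: contrapT => h'; apply: h; exists mu.
have [mu0 wtmu] := hs mu hmu; exists (w mu), mu; split=> //.
case: hN => [[_ [_ hind] _] _].
pose s' := [seq c * nu | nu <- s]; pose w' nu : V := op g (w (c^-1 * nu)).
have hw' nu : w' (c * nu) = op g (w nu) by rewrite /w' mulKf.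
have -> : op g (w mu) = w' (c * mu) by rewrite hw'.
apply: (hind s') => //.
- by rewrite map_inj_uniq //; exact: mulfI.
- move=> _ /mapP [nu hnu ->]; have [nu0 wnu] := hs nu hnu.
  by rewrite mulf_neq0 // hw'; split=> //; exact: hg.
- rewrite big_map -[RHS]gv e op_sum; apply: eq_bigr => nu _; exact: hw'.
- exact: map_f.
Qed.

Lemma exists_weight : exists mu v, [/\ mu != 0, wt mu v & v <> 0].
Proof.
have [[v v0] _] := simV; have [s [w [us hs e]]] := weight_decomp v.
apply: contrapT => h; apply: v0; rewrite [v]e big1_seq // => mu /andP [_ hmu].
apply: contrapT => h'; apply: h; exists mu, (w mu); have [mu0 wm] := hs mu hmu.
by split.
Qed.

(** C preserves a finite-dimensional weight space, where it has an eigenvector; the eigenspace in V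
    is a submodule. *)
Lemma central_scalar : exists z, forall v, oC v = z *: v.
Proof.
have [mu [v [mu0 wv v0]]] := exists_weight; have [n [e he]] := wt_fd mu0.
have cA w : wt mu w -> wt mu (oC w) by rewrite /wt -opCC => ->; rewrite opZ.
have [w [z [_ w0 wz]]] := exists_eigenvector (A := oC) he cA
  (fun u u' => @wtD _ _ V mu u u') (fun c u => @wtZ _ _ V mu c u) wv v0.
exists z; apply: (@simple_full _ _ V (fun u : W => oC u = z *: u) w) => //.
apply: (@submodule_gen _ _ V).
- by rewrite op0 scaler0.
- by move=> u u' hu hu'; rewrite scalerDr -hu -hu'; exact: opD.
- by move=> c u hu; rewrite opZ hu !scalerA mulrC.
- by move=> g u hu; rewrite opCC hu opZ.
Qed.

Lemma generated v : v <> 0 -> generated_by (v : V).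
Proof.
move=> v0; apply: (simple_full simV (msubspan_submodule _) _ v0).
by move=> U _; apply.
Qed.

Lemma no_highest mu v : mu != 0 -> wt mu v -> v <> 0 -> oE v = 0 -> oX v = 0 -> False.
Proof.
move=> mu0 wv v0 Ev Xv; case: hN => [[_ wV _] [_ h _]]; apply: h; split=> //.
by exists v; split=> //; [split=> //; exists mu|exact: generated].
Qed.

Lemma no_lowest mu v : mu != 0 -> wt mu v -> v <> 0 -> oF v = 0 -> oY v = 0 -> False.
Proof.
move=> mu0 wv v0 Ev Xv; case: hN => [[_ wV _] [_ _ h]]; apply: h; split=> //.
by exists v; split=> //; [split=> //; exists mu|exact: generated].
Qed.

Section Central.
Variable z : F.
Hypothesis hC : forall v, oC v = z *: v.

(** The common kernel of X and Y is a submodule, so by simplicity both would act as zero, against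
    the definition of the class N. *)
Lemma no_XY_kernel v : z = 0 -> v <> 0 -> oX v = 0 -> oY v = 0 -> False.
Proof.
move=> z0 v0 Xv Yv.
have h : forall w : V, oX w = 0 /\ oY w = 0.
  apply: (@simple_full _ _ V (fun u : W => oX u = 0 /\ oY u = 0) v) => //.
  apply: (@submodule_gen _ _ V).
  - by rewrite !op0.
  - by move=> u u' [h1 h2] [h1' h2']; split; rewrite [LHS]opD ?h1 ?h1' ?h2 ?h2' addr0.
  - by move=> c u [h1 h2]; rewrite !opZ h1 h2 scaler0.
  move=> g u [h1 h2].
  have sc0 c x : c != 0 -> c *: x = 0 :> W -> x = 0.
    by move=> c0 /eqP; rewrite scaler_eq0 (negbTE c0) => /eqP.
  have h3 : oY (oKi u) = 0.
    apply: (sc0 q^-1); first exact: invr_neq0.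
    have e : oK (oY (oKi u)) = q^-1 *: oY u by rewrite opKY opKKi.
    by rewrite -(opKiK (oY (oKi u))) e h2 scaler0 op0 scaler0.
  have h3' : oX (oKi u) = 0.
    apply: (sc0 q) => //.
    have e : oK (oX (oKi u)) = q *: oX u by rewrite opKX opKKi.
    by rewrite -(opKiK (oX (oKi u))) e h1 scaler0 op0 scaler0.
  case: g.
  - by rewrite -!opCC h1 h2 op0.
  - split; apply: (sc0 q) => //; first by rewrite -opEX h1 op0.
    apply: (sc0 (q^-1 * q^-1)); first by rewrite mulf_neq0 // invr_neq0.
    by have := opEY u; rewrite h2 op0 h1 add0r scalerA mulfVK // => <-.
  - by rewrite -opFY h2 opXF h1 h3 !op0 subr0.
  - split; [apply: (sc0 q) => //|apply: (sc0 q^-1); first exact: invr_neq0].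
      by rewrite -opKX h1 op0.
    by rewrite -opKY h2 op0.
  - by [].
  - by rewrite h1 !op0.
  - by rewrite h2 !op0.
case: hN => _ [[[x hx]|[x hx]] _ _]; apply: hx; first exact: (h x).1.
exact: (h x).2.
Qed.

Lemma Y_injective v : oY v = 0 -> v = 0.
Proof.
move=> Yv0; apply: contrapT => vn0.
have [u [mu [mu0 u0 wu Yu]]] := weight_ker (invr_neq0 q0) (@wtY _ _ V) Yv0 vn0.
have YF n : oY (iter n oF u) = 0.
  by elim: n => //= n ih; rewrite -opFY ih op0.
have wF n : wt ((q ^- 2) ^+ n * mu) (iter n oF u).
  by apply: wt_iter wu => nu w; exact: wtF.
have nF0 n : (q ^- 2) ^+ n * mu != 0.
  by rewrite mulf_neq0 // expf_neq0 // invr_neq0 // expf_neq0.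
have F0 n : iter n oF u <> 0.
  elim: n => //= n ih h; exact: (no_lowest (nF0 n) (wF n) ih h (YF n)).
have p1 n : q ^+ n.+1 - 1 != 0 by apply: pow_sub1_neq0.
have pn n : q ^+ n != 0 by exact: expf_neq0.
have q1 := gen_sub1 hq.
have iter_id n (w : W) : iter n id w = w by elim: n.
(* For z nonzero Y^(2n) takes X^(2n) F^n u to a nonzero multiple of F^n u, which Y kills. The power
   2 n of X brings the weight back to mu. *)
have [z0|z0] := eqVneq z 0; last first.
  have hk n (w : W) : oY w = 0 -> exists2 k, k != 0 & iter n oY (iter n oX w) = k *: w.
    move=> Yw; suff [k k0 e] : exists2 k, k != 0 &
      iter n oY (iter n oX w) = k *: iter n id w by exists k; rewrite // e iter_id.
    apply: (@chain_power _ _ V GY GX id w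
       (fun n => z * (q ^+ n.+1 - 1) / (q ^+ n.+1 * (q - 1))) (fun=> 1)) => //.
    - by move=> m; rewrite !mulf_neq0 ?invr_neq0 ?mulf_neq0.
    - by move=> _; exact: oner_neq0.
    - by move=> m; exact: YX_chain.
    - by move=> m x; rewrite scale1r.
  apply: (@wt_absurd GY mu (fun n => iter (2 * n) oX (iter n oF u)) (fun n => 2 * n)%N mu0).
  - move=> n; have := @wt_iter _ _ V GX q _ (2 * n) _ (@wtX _ _ V) (wF n).
    by rewrite exprM exprVn mulrA mulfV ?mul1r // !expf_neq0.
  - by move=> i j ij; lia.
  - move=> n; have [k k0 ->] := hk (2 * n)%N _ (YF n).
    by move=> /eqP; rewrite scaler_eq0 (negbTE k0) => /eqP /F0.
  - move=> n; have [k k0 e] := hk (2 * n)%N _ (YF n).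
    by rewrite iterS e opZ YF scaler0.
(* For z = 0 those coefficients vanish. Now X preserves the kernel of Y and is injective on it by
   [no_XY_kernel]; E^n replaces X^(2n). *)
have YX w : oY (oX w) = q^-1 *: oX (oY w).
  by rewrite (YXE hq hC) z0 scale0r addr0.
have YXn n w : iter n oY (oX w) = q^-1 ^+ n *: oX (iter n oY w).
  elim: n => [|n ih]; first by rewrite expr0 scale1r.
  by rewrite iterS ih opZ YX scalerA -exprSr.
have YkX n m : oY (iter m oX (iter n oF u)) = 0.
  by elim: m => [|m ih]; rewrite ?YF // iterS YX ih op0 scaler0.
have X0 n m : iter m oX (iter n oF u) <> 0.
  elim: m => [|m ih]; first exact: F0.
  by move=> h; exact: (no_XY_kernel z0 ih h (YkX n m)).
have hk n : exists2 k, k != 0 &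
    iter n oY (iter n oE (iter n oF u)) = k *: iter n oX (iter n oF u).
  apply: (@chain_power _ _ V GY GE oX _
    (fun n => - (q * (q ^+ (2 * n.+1) - 1) / (q ^+ 2 - 1))) (fun n => q^-1 ^+ n)).
  - move=> m; rewrite oppr_eq0 !mulf_neq0 ?invr_neq0 ?(gen_sqr hq) //.
    by apply: pow_sub1_neq0.
  - by move=> m; rewrite expf_neq0 // invr_neq0.
  - by move=> k w; rewrite opZ.
  - by move=> m; apply: YE_chain.
  - exact: YXn.
apply: (@wt_absurd GY mu (fun n => iter n oE (iter n oF u)) id mu0) => //.
- move=> n; have := @wt_iter _ _ V GE (q ^+ 2) _ n _ (@wtE _ _ V) (wF n).
  by rewrite exprVn mulrA mulfV ?mul1r // !expf_neq0.
- move=> n; have [k k0 ->] := hk n.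
  by move=> /eqP; rewrite scaler_eq0 (negbTE k0) => /eqP /X0.
- by move=> n; have [k k0 e] := hk n; rewrite iterS e opZ YkX scaler0.
Qed.

(** The argument for Y with highest weight vectors in place of lowest ones; for z = 0 the
    nonvanishing of Y^m E^n u now comes from [Y_injective]. *)
Lemma X_injective v : oX v = 0 -> v = 0.
Proof.
move=> Xv0; apply: contrapT => vn0.
have [u [mu [mu0 u0 wu Xu]]] := weight_ker q0 (@wtX _ _ V) Xv0 vn0.
have sc0 c x : c != 0 -> c *: x = 0 :> W -> x = 0.
  by move=> c0 /eqP; rewrite scaler_eq0 (negbTE c0) => /eqP.
have XE n : oX (iter n oE u) = 0.
  by elim: n => //= n ih; apply: (sc0 q) => //; rewrite -opEX ih op0.
have wE n : wt ((q ^+ 2) ^+ n * mu) (iter n oE u).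
  by apply: wt_iter wu => nu w; exact: wtE.
have nE0 n : (q ^+ 2) ^+ n * mu != 0.
  by rewrite mulf_neq0 // !expf_neq0.
have E0 n : iter n oE u <> 0.
  elim: n => //= n ih h; exact: (no_highest (nE0 n) (wE n) ih h (XE n)).
have p1 n : q ^+ n.+1 - 1 != 0 by apply: pow_sub1_neq0.
have pn n : q ^+ n != 0 by exact: expf_neq0.
have q1 := gen_sub1 hq.
have iter_id n (w : W) : iter n id w = w by elim: n.
have [z0|z0] := eqVneq z 0; last first.
  have hk n (w : W) : oX w = 0 -> exists2 k, k != 0 & iter n oX (iter n oY w) = k *: w.
    move=> Xw; suff [k k0 e] : exists2 k, k != 0 &
      iter n oX (iter n oY w) = k *: iter n id w by exists k; rewrite // e iter_id.
    apply: (@chain_power _ _ V GX GY id w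
       (fun n => - (z * (q ^+ n.+1 - 1) / (q - 1))) (fun=> 1)) => //.
    - by move=> m; rewrite oppr_eq0 !mulf_neq0 ?invr_neq0 ?mulf_neq0.
    - by move=> _; exact: oner_neq0.
    - by move=> m; exact: XY_chain.
    - by move=> m x; rewrite scale1r.
  apply: (@wt_absurd GX mu (fun n => iter (2 * n) oY (iter n oE u)) (fun n => 2 * n)%N mu0).
  - move=> n; have := @wt_iter _ _ V GY q^-1 _ (2 * n) _ (@wtY _ _ V) (wE n).
    by rewrite mulrA exprM -!exprMn mulVf // !expr1n mul1r.
  - by move=> i j ij; lia.
  - move=> n; have [k k0 ->] := hk (2 * n)%N _ (XE n).
    by move=> /eqP; rewrite scaler_eq0 (negbTE k0) => /eqP /E0.
  - move=> n; have [k k0 e] := hk (2 * n)%N _ (XE n).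
    by rewrite iterS e opZ XE scaler0.
have XY w : oX (oY w) = q *: oY (oX w).
  by rewrite opXY hC z0 scale0r subr0.
have XYn n w : iter n oX (oY w) = q ^+ n *: oY (iter n oX w).
  elim: n => [|n ih]; first by rewrite expr0 scale1r.
  by rewrite iterS ih opZ XY scalerA -exprSr.
have XkY n m : oX (iter m oY (iter n oE u)) = 0.
  by elim: m => [|m ih]; rewrite ?XE // iterS XY ih op0 scaler0.
have Y0 n m : iter m oY (iter n oE u) <> 0.
  elim: m => [|m ih]; first exact: E0.
  by move=> /Y_injective.
have hk n : exists2 k, k != 0 &
    iter n oX (iter n oF (iter n oE u)) = k *: iter n oY (iter n oE u).
  apply: (@chain_power _ _ V GX GF oY _
    (fun m => - (((q ^+ 2) ^+ n * mu)^-1 * (q ^+ (2 * m.+1) - 1) / (q ^+ 2 - 1)))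
    (fun n => q ^+ n)).
  - move=> m; rewrite oppr_eq0 !mulf_neq0 ?invr_neq0 ?(gen_sqr hq) ?nE0 //.
    by apply: pow_sub1_neq0.
  - by move=> m; rewrite expf_neq0.
  - by move=> k w; rewrite opZ.
  - by move=> m; apply: XF_chain.
  - exact: XYn.
apply: (@wt_absurd GX mu (fun n => iter n oF (iter n oE u)) id mu0) => //.
- move=> n; have := @wt_iter _ _ V GF (q ^- 2) _ n _ (@wtF _ _ V) (wE n).
  by rewrite mulrA -exprMn mulVf ?expr1n ?mul1r // !expf_neq0.
- move=> n; have [k k0 ->] := hk n.
  by move=> /eqP; rewrite scaler_eq0 (negbTE k0) => /eqP /Y0.
- by move=> n; have [k k0 e] := hk n; rewrite iterS e opZ XkY scaler0.
Qed.

(** Y X preserves each weight space and is injective there, hence surjective. *)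
Lemma Y_surjective v : exists w, oY w = v.
Proof.
elim/weight_ind: v => [u v [u' <-] [v' <-]||mu v mu0 wv].
- by exists (u' + v'); rewrite opD.
- by exists 0; rewrite op0.
have [n [e he]] := wt_fd mu0.
pose A (w : W) : W := oY (oX w).
have Al : linear A by move=> c x y; rewrite /A !opL.
pose AL : {linear W -> W} := HB.pack A (GRing.isLinear.Build F W W *:%R A Al).
have wA w : wt mu w -> wt mu (AL w).
  by move=> /wtX /wtY; rewrite mulrA mulVf // mul1r.
have [|w' _ e'] := surj_of_inj he wA (@wt0 _ _ V mu) (fun u u' => @wtD _ _ V mu u u')
   (fun c u => @wtZ _ _ V mu c u) _ wv.
  by move=> w _ /Y_injective /X_injective.
by exists (oX w').
Qed.

End Central.
End ClassN.

(** * The classification *)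

Lemma kill_mkseq_neq0 (F : fieldType) (V : lmodType F) (A : {linear V -> V})
    (a : nat -> F) m v : injective a -> A v = a m *: v ->
  kill A (mkseq a m) v = 0 -> v = 0.
Proof.
move=> ainj Av; have h : a m \notin mkseq a m.
  by apply/mapP => [[j jm /ainj mj]]; move: jm; rewrite mj mem_iota; lia.
exact: (kill_eigen_neq0 Av h).
Qed.

Section Classification.
Variables (F : closedFieldType) (q : F) (hq : generic q) (V : lmodType (Sq q)).
Hypothesis hN : class_N V.
Variable z : F.
Hypothesis hC : forall v : vsp V, op GC v = z *: v.
Let q0 := gen_neq0 hq.
Local Notation W := (vsp V).
Implicit Types v w u : W.
Local Notation oE := (@op _ _ V GE).
Local Notation oF := (@op _ _ V GF).
Local Notation oK := (@op _ _ V GK).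
Local Notation oX := (@op _ _ V GX).
Local Notation oY := (@op _ _ V GY).
Local Notation zeta := (z / (q - 1)).
Local Notation H := (@Hop F q V z).

Let Yinj : injective oY.
Proof.
move=> u v e; apply/eqP; rewrite -subr_eq0; apply/eqP.
by apply: (Y_injective hq hN hC); rewrite opB e subrr.
Qed.

Lemma exists_Yinv : exists yi : W -> W,
  (forall v, oY (yi v) = v) /\ (forall v, yi (oY v) = v).
Proof.
have [yi h] := choice (Y_surjective hq hN hC).
by exists yi; split=> // v; apply: Yinj.
Qed.

Lemma wtH mu v : wt mu v -> wt mu (H v).
Proof.
move=> wv; apply: wtB; last exact: wtZ.
by move/wtX/wtY: wv; rewrite mulrA mulVf // mul1r.
Qed.

Let HB u v : H (u - v) = H u - H v.
Proof. by rewrite /Hop !opL; vect (F : pzRingType); ring. Qed.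
Let HZ c v : H (c *: v) = c *: H v.
Proof. by rewrite /Hop !opL; vect (F : pzRingType); ring. Qed.

Section Inverse.
Variable yi : W -> W.
Hypothesis Yyi : forall v, oY (yi v) = v.

Lemma wt_yi mu v : wt mu v -> wt (q * mu) (yi v).
Proof.
move=> wv; apply: Yinj; rewrite [oY (_ *: _)]opZ Yyi.
have := opKY (yi v); rewrite Yyi wv => /(congr1 (fun u => q *: u)).
by rewrite !scalerA mulfV // scale1r => <-.
Qed.

Let T v := yi (yi (oF v)).

Let wtT mu v : wt mu v -> wt mu (T v).
Proof. by move/wtF/wt_yi/wt_yi; rewrite !mulrA -expr2 mulfV ?mul1r // expf_neq0. Qed.

(** The term in mu^-1 stems from Y K^-1 in the relation for F X. The identity is checked after
    applying Y twice, where only defining relations occur. *)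
Lemma HT mu v : mu != 0 -> wt mu v ->
  H (T v) = q ^- 2 *: (T (H v) - mu^-1 *: v).
Proof.
move=> mu0 wv; apply: Yinj; apply: Yinj.
set y := T v.
have Fv : oF v = oY (oY y) by rewrite /y /T !Yyi.
have e1 : oY (oY (T (H v))) = oY (mu^-1 *: oY v + oX (oY (oY y))) - zeta *: oY (oY y).
  by rewrite /T !Yyi /Hop opB opZ opFY opFX (opKi_eigen mu0 wv) opZ Fv.
rewrite !opL e1 /Hop !opXY !hC !opL.
vect (F : pzRingType); by qfield hq; rewrite ?mu0.
Qed.

(** If H v = 0, then H T^(n+1) v is a nonzero multiple of T^n v, and the T^n v would be independent
    vectors of one weight. *)
Lemma H_injective mu v : mu != 0 -> wt mu v -> H v = 0 -> v = 0.
Proof.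
move=> mu0 wv Hv; apply: contrapT => v0.
have wTn n : wt mu (iter n T v) by elim: n => //= n; exact: wtT.
have TZ c u : T (c *: u) = c *: T u.
  by apply: Yinj; apply: Yinj; rewrite !opL /T !Yyi opZ.
have T0 : T 0 = 0 by have := TZ 0 0; rewrite !scale0r.
have HTn n : H (iter n.+1 T v) =
    (- (mu^-1 * (q ^+ (2 * n.+1) - 1) / (q ^+ 2 - 1) / q ^+ (2 * n.+1))) *: iter n T v.
  elim: n => [|n ih].
    rewrite [iter 1 T v]/= (HT mu0 wv) Hv T0 sub0r -scaleNr scalerA.
    by congr (_ *: _); rewrite muln1; qfield hq; rewrite ?mu0.
  rewrite [iter n.+2 T v]/= (HT mu0 (wTn n.+1)) ih TZ.
  rewrite -[T (iter n T v)]/(iter n.+1 T v) -scalerBl scalerA; congr (_ *: _).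
  rewrite (mulnS 2 n.+1) exprD; have x0 := expf_neq0 (2 * n.+1) q0.
  by move: (q ^+ (2 * n.+1)) x0 => x x0; qfield hq; rewrite ?x0 ?mu0.
have Hlin m : linear (iter m H).
  by move=> c x y; elim: m => //= m ->; rewrite linearP.
have HZi m c u : iter m H (c *: u) = c *: iter m H u.
  by elim: m => //= m ->; rewrite HZ.
have Hn n : exists2 k, k != 0 & iter n H (iter n T v) = k *: v.
  elim: n => [|n [k k0 ih]]; first by exists 1; rewrite ?oner_neq0 ?scale1r.
  eexists; last by rewrite iterSr HTn HZi ih scalerA.
  rewrite mulf_neq0 // oppr_eq0 !mulf_neq0 ?invr_neq0 ?(gen_sqr hq) ?expf_neq0 //.
  exact: (pow_sub1_neq0 hq).
apply: (@wt_triangular _ _ _ hN mu W (fun n => iter n T v) (fun n => iter n H) mu0) => //.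
- move=> m i im; rewrite -(subnK im) iterD iterS; have [k k0 ->] := Hn i.
  by rewrite HZ Hv scaler0; elim: (m - i.+1)%N => //= l ->; rewrite linear0.
- by move=> m; have [k k0 ->] := Hn m; move=> /eqP; rewrite scaler_eq0 (negbTE k0) => /eqP.
Qed.

(** H commutes with Y^2 E up to a factor q^2 and terms acting by a scalar on an eigenvector of H;
    [ediag] absorbs them. *)
Lemma H_raise h v : h != 0 -> H v = h *: v ->
  H (oY (oY (oE v)) - ediag q z h *: v) =
  (q ^+ 2 * h) *: (oY (oY (oE v)) - ediag q z h *: v).
Proof.
move=> h0 Hv.
have YX : oY (oX v) = (h + zeta) *: v.
  by move/eqP: Hv; rewrite /Hop subr_eq -scalerDl => /eqP.
have XX : oY (oX (oX v)) = (q^-1 * (h + zeta + z)) *: oX v.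
  have := opXY (oX v); rewrite YX opZ hC => /eqP; rewrite eq_sym subr_eq -scalerDl.
  by move=> /eqP /(congr1 (fun u => q^-1 *: u)); rewrite !scalerA mulVf // scale1r => ->.
have EX : oX (oE v) = q^-1 *: oE (oX v) by rewrite opEX scalerA mulVf // scale1r.
have EYX := opEY (oX v); rewrite YX opZ in EYX.
have YEX : oY (oE (oX v)) = q *: ((h + zeta) *: oE v - oX (oX v)).
  by rewrite EYX addrC addKr scalerA mulfV // scale1r.
rewrite HB HZ Hv /Hop !opXY !hC EX !opL YEX !opL XX !opL YX.
vect (F : pzRingType); rewrite /ediag; by qfield hq; rewrite ?h0.
Qed.

End Inverse.

Let H_eigen_kill (a : nat -> F) (u : nat -> W) mu : mu != 0 ->
  injective a -> (forall i, wt mu (u i)) ->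
  (forall i, H (u i) = a i *: u i) -> exists n, u n = 0.
Proof.
move=> mu0 ainj wu Hu; apply: contrapT => hu.
have un0 n : u n <> 0 by move=> e; apply: hu; exists n.
apply: (@wt_triangular _ _ _ hN mu W u (fun n => kill H (mkseq a n)) mu0) => //.
- by move=> m; exact: killP.
- move=> m i im; apply: (@kill_eigen0 _ _ H _ (a i)); first exact: Hu.
  by apply: map_f; rewrite mem_iota.
- by move=> m; apply: contra_not (un0 m); exact: (kill_mkseq_neq0 ainj (Hu m)).
Qed.

Lemma exists_base : exists mu h v, [/\ mu != 0, h != 0 & [/\ v <> 0, wt mu v,
  H v = h *: v & oY (oY (oE v)) = ediag q z h *: v]].
Proof.
have [yi [Yyi yiY]] := exists_Yinv.
have [mu [v [mu0 wv v0]]] := exists_weight hN.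
have [n [e he]] := wt_fd hN mu0.
have [w [h [ww w0 Hw]]] := exists_eigenvector (A := H) he (@wtH mu)
  (fun u u' => @wtD _ _ V mu u u') (fun c u => @wtZ _ _ V mu c u) wv v0.
have h0 : h != 0.
  apply/eqP => h0; apply: w0; apply: (H_injective Yyi mu0 ww).
  by rewrite [LHS]Hw h0 scale0r.
pose hn i := h * q ^+ (2 * i).
pose fix u i := if i is i'.+1 then
  oY (oY (oE (u i'))) - ediag q z (hn i') *: u i' else w.
have hn0 i : hn i != 0 by rewrite mulf_neq0 // expf_neq0.
have Hu i : H (u i) = hn i *: u i.
  elim: i => [|i ih]; first by rewrite /hn muln0 expr0 mulr1.
  rewrite [u i.+1]/= H_raise // /hn (mulnS 2 i) exprD; congr (_ *: _).
  by rewrite mulrCA.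
have wu i : wt mu (u i).
  elim: i => [|i ih] //=; apply: wtB; last exact: wtZ.
  have := wtY (wtY (wtE ih)).
  by have -> : q^-1 * (q^-1 * (q ^+ 2 * mu)) = mu by qfield hq.
have hinj : injective hn.
  by move=> i j /(mulfI h0) /(gen_pown_inj hq); lia.
have [m um] := H_eigen_kill mu0 hinj wu Hu.
(* Descent from a vanishing [u m] to a nonzero vector whose successor in the chain is zero. *)
elim: m um => [|m ih] um; first by case: w0.
have [/ih //|um0] := pselect (u m = 0).
exists mu, (hn m), (u m); split=> //; split=> //.
by apply/eqP; rewrite -subr_eq0; apply/eqP.
Qed.

Theorem classification : exists (b lam : F) (d : nat) (v : int -> nat -> W),
  [/\ b != 0, z != 0, lam != 0, (0 < d)%N & lam ^+ 2 = q ^ (2 * d%:Z - 3)] /\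
  [/\ basis_action b z lam d (v : int -> nat -> V),
      (forall w, in_span (@fam W d v) w) & is_free (@fam W d v)].
Proof.
have [yi [Yyi yiY]] := exists_Yinv.
have [mu [h [u [mu0 h0 [u0 wu Hu Eu]]]]] := exists_base.
pose Yp (k : int) (w : W) := match k with
  | Posz n => iter n oY w | Negz n => iter n.+1 yi w end.
have YpS k w : oY (Yp k w) = Yp (k + 1) w.
  case: k => [n|[|n]].
  - by rewrite -PoszD addn1.
  - by rewrite /= Yyi.
  - have -> : Negz n.+1 + 1 = Negz n by rewrite !NegzE; lia.
    by rewrite [Yp _ _]/= Yyi.
have YpF k w : oF (Yp k w) = Yp k (oF w).
  elim/int_shift_ind: k => [|k ih|k ih] //.
    by rewrite -!YpS opFY ih.
  by apply: Yinj; rewrite -opFY !YpS.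
pose v k l := Yp k (iter l oF u).
have vY k l : oY (v k l) = v (k + 1) l by exact: YpS.
have vF k l : oF (v k l) = v k l.+1 by exact: YpF.
have vK : oK (v 0 0) = mu *: v 0 0 by exact: wu.
have vX : oX (v 0 0) = (h + zeta) *: v (-1) 0.
  apply: Yinj; rewrite opZ vY addNr scalerDl -[h *: _]Hu.
  by rewrite /Hop subrK.
have vE : oE (v 0 0) = ediag q z h *: v (-2) 0.
  by apply: Yinj; apply: Yinj; rewrite !opZ !vY; exact: Eu.
pose e := efam (etau q mu h) v.
have eY := efam_opY (etau q mu h) vY; have eF := efam_opF (etau q mu h) v.
have eK := eK hq Yinj eY eF vK.
have eX := eX hq hC Yinj mu0 h0 eY eF vK vX.
have He j : H (e 0 j) = (h * (q ^+ (2 * j))^-1) *: e 0 j.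
  rewrite /Hop /e eX opZ eY subrK expr0z mulr1 -exprM (mulnC j 2).
  have x0 := expf_neq0 (2 * j) q0; vect (F : pzRingType).
  by move: (q ^+ (2 * j)) x0 => x x0; qfield hq; rewrite ?x0.
have [m em] : exists m, e 0 m = 0.
  apply: (@H_eigen_kill (fun j => h * (q ^+ (2 * j))^-1) (fun j => e 0 j) mu) => //.
    by move=> i j /(mulfI h0) /invr_inj /(gen_pown_inj hq); lia.
  by move=> j; rewrite /wt /e eK expr0z divr1.
have ex : exists d, `[< e 0 d = 0 >] by exists m; apply/asboolP.
have [d /asboolP ed dmin] := ex_minnP ex.
have dlt j : (j < d)%N -> e 0 j <> 0.
  by move=> jd /asboolP /dmin; rewrite leqNgt jd.
have d0 : (0 < d)%N.
  by rewrite lt0n; apply/eqP => d0; apply: u0; move: ed; rewrite d0.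
have ekd k : e k d = 0.
  elim/int_shift_ind: k => [|k ih|k ih] //.
    by apply: etrans (esym (eY k d)) _; rewrite -/e ih op0.
  by apply: Yinj; rewrite [LHS]eY op0.
have low := elow0 hq hC Yinj mu0 h0 eY eF vK vX vE d0 ekd (dlt d.-1 _).
have {}low : elow q z mu h d = 0 by apply: low; rewrite prednK.
have mh := (elow_eq0 hq z mu0 h0 d0).1 low.
have zeta0 : zeta != 0.
  apply/eqP => z0; move: mh; rewrite z0 expr0n mul0r => /eqP.
  by rewrite expf_eq0 mulf_eq0 (negbTE mu0) (negbTE h0).
have z0 : z != 0 by move: zeta0; rewrite mulf_eq0 negb_or => /andP [].
pose b := - h / zeta; have b0 : b != 0.
  by rewrite mulf_neq0 ?oppr_eq0 ?invr_neq0.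
have hb : h = - (zeta * b) by rewrite /b mulrC mulfVK // opprK.
pose lam := mu * b; have lam0 : lam != 0 by rewrite mulf_neq0.
have mul : mu = lam / b by rewrite mulfK.
have hlam : lam ^+ 2 = q ^ (2 * d%:Z - 3).
  apply: (mulfI (expf_neq0 2 zeta0)); rewrite -mh hb /lam; ring.
have vK' : oK (v 0 0) = (lam / b) *: v 0 0 by rewrite -mul.
have vX' : oX (v 0 0) = (zeta * (1 - b)) *: v (-1) 0.
  by rewrite vX hb; congr (_ *: _); ring.
have vE' : oE (v 0 0) =
  ((q + q ^+ 2 - b^-1 * q ^+ 2 - b * q) / (q ^+ 2 - 1) * zeta) *: v (- 2) 0.
  by rewrite vE hb /ediag; congr (_ *: _); qfield hq; rewrite oppr_eq0 b0 mulf_neq0.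
rewrite /e hb mul in ekd dlt.
have va := v_basis_action hq z0 b0 lam0 hC Yinj vY vF vK' vX' vE' d0 ekd.
exists b, lam, d, v; split; split=> //; last first.
  exact: (v_free hq z0 b0 lam0 hC Yinj vY vF vK' vX' dlt).
have simV : simple_module V by case: hN => [[]].
apply: (@simple_full _ _ V _ (v 0 0) simV) => //.
  exact: (span_submodule hq b0 lam0 d0 va).
exact: (@fam_in_span _ _ V d v 0 0 d0).
Qed.

End Classification.

(** * Isomorphisms between twisted modules *)

Section IsomorphismClasses.
Variables (F : fieldType) (q : F) (hq : generic q).
Let q0 := gen_neq0 hq.

Lemma twist_shift (b z lam : F) (m : int) (b0 : b != 0) (b0' : b * q ^ m != 0) d :
  z != 0 -> lam != 0 -> (0 < d)%N -> lam ^+ 2 = q ^ (2 * d%:Z - 3) ->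
  isomorphic (twistB hq b0 (Nmod q lam z)) (twistB hq b0' (Nmod q lam z)).
Proof.
move=> z0 lam0 d0 hlam.
pose V := twistB hq b0 (Nmod q lam z).
have va := basis_action_shift hq m b0 lam0 (twist_action hq z0 lam0 d0 hlam b0).
apply: (isomorphic_of_basis hq b0' lam0 d0 va (twist_action hq z0 lam0 d0 hlam b0')).
- move=> w; have [s [c ->]] := twist_span z0 lam0 d0 hlam w.
  exists [seq (i.1 - m, i.2) | i <- s], (fun i => c (i.1 + m, i.2)).
  rewrite big_map; apply: eq_bigr => [[k l]] _; rewrite /fam /= subrK //.
- move=> s c us hs j hj; have := @twist_free _ _ hq _ _ _ z0 lam0 d0 hlam _ b0.
  move=> /(_ [seq (i.1 + m, i.2) | i <- s] (fun i => c (i.1 - m, i.2))).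
  have inj : injective (fun i : int * 'I_d => (i.1 + m, i.2)).
    by move=> [k l] [k' l'] /= [/addIr -> ->].
  rewrite map_inj_uniq // => /(_ us); rewrite big_map.
  rewrite (eq_bigr (fun i => c i *: @fam (vsp V) d (fun k l => vtw q z lam (k + m) l) i)).
    move=> /(_ hs (j.1 + m, j.2)) /=; rewrite addrK -surjective_pairing; apply.
    by apply/mapP; exists j.
  by move=> [k l] _ /=; rewrite addrK.
- exact: twist_span.
- exact: twist_free.
Qed.

Lemma twist_params (b b' z z' lam lam' : F) (b0 : b != 0) (b0' : b' != 0) d d' :
  z != 0 -> z' != 0 -> lam != 0 -> lam' != 0 -> (0 < d)%N -> (0 < d')%N ->
  lam ^+ 2 = q ^ (2 * d%:Z - 3) -> lam' ^+ 2 = q ^ (2 * d'%:Z - 3) ->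
  isomorphic (twistB hq b0 (Nmod q lam z)) (twistB hq b0' (Nmod q lam' z')) ->
  [/\ lam = lam', z = z' & exists m : int, b^-1 * b' = q ^ m].
Proof.
move=> z0 z0' lam0 lam0' d0 d0' hlam hlam' [f [g fg gf]].
have key (b1 b2 z1 z2 lam1 lam2 : F) (b10 : b1 != 0) (b20 : b2 != 0) d1 d2
    (h : {linear twistB hq b10 (Nmod q lam1 z1) -> twistB hq b20 (Nmod q lam2 z2)}) :
    z1 != 0 -> z2 != 0 -> lam1 != 0 -> lam2 != 0 -> (0 < d1)%N -> (0 < d2)%N ->
    lam1 ^+ 2 = q ^ (2 * d1%:Z - 3) -> lam2 ^+ 2 = q ^ (2 * d2%:Z - 3) ->
    injective h ->
    [/\ z1 = z2, exists l : nat, lam1 = lam2 / (q ^+ l) ^+ 2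
      & exists n : int, lam1 / b1 = lam2 / b2 * q ^ n].
  move=> z10 z20 lam10 lam20 d10 d20 hl1 hl2 hinj.
  apply: (params_of_morphism hq (f := h) b10 b20 z20 lam10 lam20 d10 d20
    (twist_action hq z10 lam10 d10 hl1 b10) (twist_action hq z20 lam20 d20 hl2 b20)).
    exact: twist_span.
  rewrite -(linear0 h) => /hinj v0.
  have := @twist_free _ _ hq _ _ _ z10 lam10 d10 hl1 _ b10 [:: (0, Ordinal d10)] (fun=> 1) isT.
  rewrite big_seq1 /fam /= v0 scaler0 => /(_ erefl _ (mem_head _ _)) /eqP.
  by rewrite oner_eq0.
have gl : linear g.
  by move=> a x y; apply: (can_inj fg); rewrite linearP !gf.
pose gL : {linear twistB hq b0' (Nmod q lam' z') -> twistB hq b0 (Nmod q lam z)} :=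
  HB.pack g (GRing.isLinear.Build _ _ _ _ g gl).
have [ez [l el] [n en]] := key _ _ _ _ _ _ b0 b0' d d' f z0 z0' lam0 lam0' d0 d0'
  hlam hlam' (can_inj fg).
have [_ [l' el'] _] := key _ _ _ _ _ _ b0' b0 d' d gL z0' z0 lam0' lam0 d0' d0
  hlam' hlam (can_inj gf).
(* The morphisms in the two directions give lam = lam q^(-2 (l + l')), so l + l' = 0. *)
have l0 : l = 0%N.
  have : q ^+ (2 * (l + l')) = q ^+ 0.
    rewrite expr0; apply: (mulfI lam0); rewrite mulr1 {1}el el'.
    have x0 := expf_neq0 l q0; have y0 := expf_neq0 l' q0.
    rewrite mulnC exprM exprD; move: (q ^+ l) (q ^+ l') x0 y0 => x y x0 y0.
    by field; rewrite x0 y0.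
  by move/(gen_pown_inj hq); lia.
have elam : lam = lam' by rewrite el l0 expr0 expr1n divr1.
split=> //; exists n; move: en; rewrite elam -mulrA => /(mulfI lam0') ->.
by rewrite mulrAC mulVf // mul1r.
Qed.

End IsomorphismClasses.

Theorem theorem5p5 (R : realType) (q : R[i]) (hq : generic q) :
  (forall L : lmodType (Sq q), class_N L ->
     exists (b z lam : R[i]) (hb : b != 0) (d : nat),
       [/\ z != 0, lam != 0, (0 < d)%N & lam ^+ 2 = q ^ (2 * d%:Z - 3)] /\
       isomorphic L (twistB hq hb (Nmod q lam z)) /\
       exists v : int -> nat -> L,
         is_basis (fun kl : int * 'I_d => v kl.1 kl.2) /\
         basis_action b z lam d v) /\
  (forall (b b' z z' lam lam' : R[i]) (hb : b != 0) (hb' : b' != 0),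
     z != 0 -> z' != 0 -> lam != 0 -> lam' != 0 ->
     (exists d : nat, (0 < d)%N /\ lam ^+ 2 = q ^ (2 * d%:Z - 3)) ->
     (exists d : nat, (0 < d)%N /\ lam' ^+ 2 = q ^ (2 * d%:Z - 3)) ->
     isomorphic (twistB hq hb (Nmod q lam z)) (twistB hq hb' (Nmod q lam' z'))
     <-> [/\ lam = lam', z = z' & exists m : int, b^-1 * b' = q ^ m]).
Proof.
split=> [L hL|b b' z z' lam lam' b0 b0' z0 z0' lam0 lam0' [d [d0 hd]] [d' [d0' hd']]].
  have [z hC] := central_scalar hL.
  have [b [lam [d [v [[b0 z0 lam0 d0 hlam] [va vs vf]]]]]] := classification hq hL hC.
  exists b, z, lam, b0, d; split=> //; split; last by exists v; split.
  refine (isomorphic_of_basis hq b0 lam0 d0 va (twist_action hq z0 lam0 d0 hlam b0) vs vf _ _).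
    exact: twist_span.
  exact: twist_free.
split; first exact: (twist_params z0 z0' lam0 lam0' d0 d0' hd hd').
move=> [el ez [m em]]; move: b0'; rewrite -el -ez.
have -> : b' = b * q ^ m by rewrite -em mulVKf.
by move=> b0'; refine (twist_shift hq b0 b0' z0 lam0 d0 hd).
Qed.
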